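(* Let $\theta,\omega\in H^\infty$ be inner functions with $\theta(0)=0$, and suppose $U_{(\theta)1}$ has no eigenvalues. Let $g\in L^2(m)$ be such that the operator $X\in\mathcal L(\mathcal K_\theta,\mathcal K_\omega)$, $Xf=P_{\mathcal K_\omega}(gf)$, $f\in\mathcal K_\theta$, is (well defined and) bounded with $X\mathcal K_\theta$ dense in $\mathcal K_\omega$, and such that the operator $K\in\mathcal L(\mathcal K_\theta,L^2(m)\ominus\mathcal K_\omega)$, $Kf=P_{L^2(m)\ominus\mathcal K_\omega}(gf)$, $f\in\mathcal K_\theta$, is compact. Let $T\in\mathcal L(\mathcal K_\omega)$ be invertible with $XU_{(\theta)1}=TX$. Then $$\sup_{n\geq0}\|T^{-n}\|\leq\Bigl(\sup_{n\geq0}\|T^n\|\Bigr)^2 .$$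
   Context: $m$ is normalized Lebesgue measure on $\mathbb T$; $H^2$ is the Hardy space of $\mathbb D$, identified with a subspace of $L^2(m)$ via boundary values. $\chi(z)=z$, $\mathbf 1(z)=1$. For inner $\theta$, $\mathcal K_\theta=H^2\ominus\theta H^2$; $S$ is multiplication by $\chi$ on $H^2$, $S_\theta=P_{\mathcal K_\theta}S|_{\mathcal K_\theta}$. When $\theta(0)=0$, $\overline\chi\theta$ (the function $\zeta\mapsto\overline\zeta\theta(\zeta)$) lies in $\mathcal K_\theta$, and $U_{(\theta)1}=S_\theta+(\cdot,\overline\chi\theta)\mathbf 1$, i.e. $f\mapsto S_\theta f+(f,\overline\chi\theta)\mathbf 1$, a unitary operator on $\mathcal K_\theta$. *)

(* Defs.v *)
(* MathComp + MathComp-Analysis (R : realType), complex numbers R[i]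
   from mathcomp-real-closed.  The unit circle T is parametrized by
   t in [0,1] via zeta = e(t) = exp(2 pi i t); normalized Lebesgue measure m
   on T is Lebesgue measure on [0,1].  Functions on T are represented as
   functions R -> R[i] (only their values on [0,1] matter); elements of
   L^2(m) are such functions, equalities between them are taken a.e. *)
From HB Require Import structures.
From mathcomp Require Import all_boot all_order all_algebra.
From mathcomp Require Import all_classical all_reals all_analysis.
From mathcomp Require Import complex.
From Stdlib Require Import ClassicalEpsilon.
Set Implicit Arguments. Unset Strict Implicit. Unset Printing Implicit Defensive.
Import Order.TTheory GRing.Theory Num.Theory.
Local Open Scope classical_set_scope.
Local Open Scope ring_scope.

Notation mu := (@lebesgue_measure _).

(* the interval [0,1] parametrizing the circle *)
Definition I01 (R : realType) : set R := `[0%R, 1%R].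
Arguments I01 R : clear implicits.

(* a.e. equality on the circle *)
Definition aeq (R : realType) (f h : R -> R[i]) : Prop :=
  {ae mu, forall t, I01 R t -> f t = h t}.

(* integral over the circle w.r.t. m of a complex function *)
Definition cint (R : realType) (f : R -> R[i]) : R[i] :=
  (Rintegral mu (I01 R) (fun t => complex.Re (f t)) +i*
   Rintegral mu (I01 R) (fun t => complex.Im (f t)))%C.

(* e(x) = exp(2 pi i x) ; chi(zeta) = zeta *)
Definition ecirc (R : realType) (x : R) : R[i] :=
  (cos (2 * pi * x) +i* sin (2 * pi * x))%C.
Definition chi (R : realType) : R -> R[i] := fun t => ecirc t.
Definition one (R : realType) : R -> R[i] := fun _ => 1.

(* membership in L^2(m) *)
Definition L2 (R : realType) (f : R -> R[i]) : Prop :=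
  measurable_fun (I01 R) (fun t => complex.Re (f t)) /\
  measurable_fun (I01 R) (fun t => complex.Im (f t)) /\
  mu.-integrable (I01 R) (fun t => ((complex.Re (f t)) ^+ 2 + (complex.Im (f t)) ^+ 2)%:E).

(* inner product (f, h) = int f conj(h) dm, and norm *)
Definition ip (R : realType) (f h : R -> R[i]) : R[i] :=
  cint (fun t => f t * (h t)^*)%C.
Definition l2norm (R : realType) (f : R -> R[i]) : R := Num.sqrt (complex.Re (ip f f)).

(* Fourier coefficients  \hat f(n) = int f(zeta) zeta^{-n} dm *)
Definition fourier (R : realType) (f : R -> R[i]) (n : int) : R[i] :=
  cint (fun t => f t * ecirc (- (n%:~R * t))).

(* Hardy space H^2 (boundary values) and H^infty *)
Definition H2 (R : realType) (f : R -> R[i]) : Prop :=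
  L2 f /\ forall n : int, (n < 0)%R -> fourier f n = 0.
Definition Hinf (R : realType) (f : R -> R[i]) : Prop :=
  H2 f /\ exists C : R, {ae mu, forall t, I01 R t ->
                          (complex.Re (f t)) ^+ 2 + (complex.Im (f t)) ^+ 2 <= C}.

(* inner functions: H^infty functions with |theta| = 1 a.e. on T *)
Definition inner_fun (R : realType) (th : R -> R[i]) : Prop :=
  Hinf th /\ {ae mu, forall t, I01 R t -> (complex.Re (th t)) ^+ 2 + (complex.Im (th t)) ^+ 2 = 1}.

(* value at 0 of (the analytic extension of) an H^2 function *)
Definition at0 (R : realType) (f : R -> R[i]) : R[i] := fourier f 0.

(* model space K_theta = H^2 \ominus theta H^2 *)
Definition Kmodel (R : realType) (th : R -> R[i]) : set (R -> R[i]) :=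
  [set f | H2 f /\ forall h, H2 h -> ip f (fun t => th t * h t) = 0].

(* orthogonal complement L^2(m) \ominus K of a set K *)
Definition ocompl (R : realType) (K : set (R -> R[i])) : set (R -> R[i]) :=
  [set f | L2 f /\ forall u, K u -> ip f u = 0].

(* orthogonal projection onto a closed subspace K (defined by choice:
   the element k of K with h - k orthogonal to K) *)
Definition orthproj (R : realType) (K : set (R -> R[i])) (h : R -> R[i]) : R -> R[i] :=
  epsilon (inhabits (fun _ => 0))
    (fun k => K k /\ forall u, K u -> ip (fun t => h t - k t) u = 0).

(* U_{(theta)1} f = S_theta f + (f, conj(chi) theta) 1,
   S_theta f = P_{K_theta}(chi f) *)
Definition Uth (R : realType) (th : R -> R[i]) (f : R -> R[i]) : R -> R[i] :=
  fun t => orthproj (Kmodel th) (fun s => chi s * f s) t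
           + ip f (fun s => (chi s)^*%C * th s) * one t.

(* bounded linear operators on a subspace K (acting on a.e.-classes) *)
Definition bounded_op (R : realType) (K K' : set (R -> R[i]))
  (A : (R -> R[i]) -> (R -> R[i])) : Prop :=
  (forall f, K f -> K' (A f)) /\
  (forall f h, K f -> K h -> aeq f h -> aeq (A f) (A h)) /\
  (forall (a : R[i]) f h, K f -> K h ->
     aeq (A (fun t => a * f t + h t)) (fun t => a * A f t + A h t)) /\
  (exists C : R, forall f, K f -> l2norm (A f) <= C * l2norm f).

(* operator norm of A restricted to K (as an extended real) *)
Definition opnorm (R : realType) (K : set (R -> R[i]))
  (A : (R -> R[i]) -> (R -> R[i])) : \bar R :=
  ereal_sup [set (l2norm (A f))%:E | f in [set f | K f /\ l2norm f <= 1]].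

(* compact operator from K to L^2: the image of the unit ball of K is
   relatively compact, i.e. every bounded sequence has a subsequence whose
   image is Cauchy in L^2 *)
Definition compact_op (R : realType) (K : set (R -> R[i]))
  (A : (R -> R[i]) -> (R -> R[i])) : Prop :=
  forall u : nat -> (R -> R[i]), (forall n, K (u n) /\ l2norm (u n) <= 1) ->
  exists phi : nat -> nat, (forall n, (phi n < phi n.+1)%N) /\
    forall eps : R, 0 < eps -> exists N : nat, forall m n, (N <= m)%N -> (N <= n)%N ->
      l2norm (fun t => A (u (phi m)) t - A (u (phi n)) t) < eps.

(* Main.v *)
Require Import Defs.
From HB Require Import structures.
From mathcomp Require Import all_boot all_order all_algebra.
From mathcomp Require Import all_classical all_reals all_analysis.
From mathcomp Require Import complex.
From mathcomp Require Import measurable_realfun ring lra zify.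
From Stdlib Require Import ClassicalEpsilon.
Import Order.TTheory GRing.Theory Num.Theory.
Import numFieldNormedType.Exports.
Import ComplexField.Normc.
Local Open Scope classical_set_scope.
Local Open Scope ring_scope.
Set Implicit Arguments.
Unset Strict Implicit.
Unset Printing Implicit Defensive.

(** Write U for U_{(theta)1} and V for its inverse on K_theta; both are
    explicit up to null sets, U f = chi f + (f, conj(chi) theta)(1 - theta).
    Let M = sup_(n >= 0) ||T^n|| be finite. From X U^n = T^n X one gets
    ||X V^m f|| <= M ||X V^n f|| for n >= m, and ||X U^n f|| <= M ||X f||, so
    that ||X V^m f|| <= M^2 ||X f|| follows once the forward and the backward
    orbits are compared. The operator X is multiplication by g up to a compact
    operator, and on the forward orbit the compact part tends to 0 in the mean,
    because U has no eigenvalues (Wiener's lemma). So it suffices to compare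
    the averages of ||g U^n f||^2 and of ||g V^n f||^2. The conjugation
    C f = theta conj(chi f) preserves |f| and satisfies C V = U C. For
    f = sum_k a_k U^k 1 this gives
    ||g V^n f|| = ||sum_k conj(a_k) g U^(n-1-k) 1||, and expanding the squares
    the two averages differ only by shifts of the bounded sequences
    n |-> (g U^(n+j) 1, g U^(n+k) 1), hence they agree in the limit. Such f are
    dense in K_theta, and X K_theta is dense in K_omega. *)

(** * Complete semi-inner product spaces *)

(** Compactness says nothing about a single time: [K U^n f] is small only for most [n], so the two
    orbits can be compared only through averages. Power boundedness of [T] turns averages back into
    bounds at a fixed time: every [||X V^n f||] with [n >= m] dominates [||X V^m f||] up to one
    factor [M], and [||X f||] dominates every [||X U^n f||] up to another, whence the square in the
    conclusion. The averaged quantities are squares of norms because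
    [||g f||^2 = ||X f||^2 + ||K f||^2]. On the backward orbit only [||X f|| <= ||g f||] is used, so
    the compact part has to be controlled on the forward orbit alone. The vectors [g U^k 1] are
    bounded although [g] may be unbounded, since [X] and [K] are bounded. Functions are not
    identified a.e., hence the Hilbert space arguments are carried out for semi-inner products, with
    equality up to vectors of norm zero. Wiener's lemma is obtained without the spectral theorem, by
    approximating with coboundaries uniformly over the circle and testing a Fejer-type kernel. *)

Section ComplexFacts.
Variable R : realType.
Implicit Types (z w : R[i]) (x y : R).

Lemma cReD z w : complex.Re (z + w) = complex.Re z + complex.Re w.
Proof. by case: z w => [? ?] [? ?]. Qed.

Lemma cReN z : complex.Re (- z) = - complex.Re z.
Proof. by case: z. Qed.

Lemma cImD z w : complex.Im (z + w) = complex.Im z + complex.Im w.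
Proof. by case: z w => [? ?] [? ?]. Qed.

Lemma cImN z : complex.Im (- z) = - complex.Im z.
Proof. by case: z. Qed.

Lemma cReM z w : complex.Re (z * w) =
  complex.Re z * complex.Re w - complex.Im z * complex.Im w.
Proof. by case: z w => [? ?] [? ?]. Qed.

Lemma cImM z w : complex.Im (z * w) =
  complex.Re z * complex.Im w + complex.Im z * complex.Re w.
Proof. by case: z w => [? ?] [? ?]. Qed.

Lemma cconjM z w : conjc (z * w) = conjc z * conjc w.
Proof. exact: rmorphM. Qed.

Lemma cconjK z : conjc (conjc z) = z.
Proof. exact: conjcK. Qed.

Lemma cconjD z w : conjc (z + w) = conjc z + conjc w.
Proof. exact: rmorphD. Qed.

Lemma cconjB z w : conjc (z - w) = conjc z - conjc w.
Proof. exact: rmorphB. Qed.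

Lemma cconj1 : conjc (1 : R[i]) = 1.
Proof. exact: rmorph1. Qed.

Lemma cRe_conj z : complex.Re (z^*%C) = complex.Re z.
Proof. by case: z. Qed.

Lemma cIm_conj z : complex.Im (z^*%C) = - complex.Im z.
Proof. by case: z. Qed.

Lemma Re_sum I (r : seq I) (P : pred I) (F : I -> R[i]) :
  complex.Re (\sum_(i <- r | P i) F i) = \sum_(i <- r | P i) complex.Re (F i).
Proof. by apply: (big_morph _ cReD). Qed.

Lemma complex_ReIm z w : complex.Re z = complex.Re w ->
  complex.Im z = complex.Im w -> z = w.
Proof. by case: z w => [? ?] [? ?] /= -> ->. Qed.

Lemma sqr_normcE z :
  normc z ^+ 2 = complex.Re z ^+ 2 + complex.Im z ^+ 2.
Proof.
by case: z => a b /=; rewrite sqr_sqrtr // addr_ge0 // sqr_ge0.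
Qed.

Lemma normc_ge0 z : 0 <= normc z.
Proof. by case: z => a b /=; rewrite sqrtr_ge0. Qed.

Lemma normc_conj z : normc z^*%C = normc z.
Proof. by case: z => a b /=; rewrite sqrrN. Qed.

Lemma Re_le_normc z : complex.Re z <= normc z.
Proof.
case: z => a b /=; apply: le_trans (ler_norm _) _.
by rewrite -sqrtr_sqr ler_wsqrtr // lerDl sqr_ge0.
Qed.

Lemma mulc_conj z : z * z^*%C = (normc z ^+ 2)%:C%C.
Proof.
by apply: complex_ReIm; rewrite ?cReM ?cImM cRe_conj cIm_conj sqr_normcE /=; ring.
Qed.

Lemma normc_real x : normc x%:C%C = `|x|.
Proof. by rewrite /= expr0n addr0 sqrtr_sqr. Qed.

Lemma normc_sum I (r : seq I) (P : pred I) (F : I -> R[i]) :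
  normc (\sum_(i <- r | P i) F i) <= \sum_(i <- r | P i) normc (F i).
Proof.
elim/big_ind2: _ => //; first by rewrite normc0.
by move=> x1 y1 x2 y2 h1 h2; apply: le_trans (le_normcD _ _) (lerD h1 h2).
Qed.

End ComplexFacts.

(** Definiteness is left out: functions that vanish a.e. have norm zero without being the zero
    function. Limits and projections are therefore determined only up to vectors of norm zero. *)
HB.mixin Record isSemiHilbert (R : realType) H of GRing.Lmodule R[i] H := {
  sdot : H -> H -> R[i];
  sdot_linl : forall (a : R[i]) (f g h : H),
    sdot (a *: f + g) h = a * sdot f h + sdot g h;
  sdotC : forall f g : H, sdot f g = (sdot g f)^*%C;
  Re_sdot_ge0 : forall f : H, 0 <= complex.Re (sdot f f);
  scomplete : forall u : nat -> H,
    (forall e : R, 0 < e -> exists N, forall m n, (N <= m)%N -> (N <= n)%N ->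
       complex.Re (sdot (u m - u n) (u m - u n)) < e) ->
    exists l, forall e : R, 0 < e -> exists N, forall n, (N <= n)%N ->
       complex.Re (sdot (u n - l) (u n - l)) < e
}.

#[short(type="semiHilbertType")]
HB.structure Definition SemiHilbert (R : realType) :=
  { H of GRing.Lmodule R[i] H & isSemiHilbert R H }.

Section SemiHilbertTheory.
Variables (R : realType) (H : semiHilbertType R).
Implicit Types (f g h : H) (a : R[i]) (M : H -> Prop).

Definition snorm f : R := Num.sqrt (complex.Re (sdot f f)).

Lemma sdotDl f g h : sdot (f + g) h = sdot f h + sdot g h.
Proof. by have := sdot_linl 1 f g h; rewrite scale1r mul1r. Qed.

Lemma sdot0l h : sdot 0 h = 0.
Proof.
by have := sdotDl 0 0 h; rewrite addr0 => /eqP; rewrite -subr_eq0 opprD addNKr oppr_eq0 => /eqP. Qed.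

Lemma sdotZl a f h : sdot (a *: f) h = a * sdot f h.
Proof. by have := sdot_linl a f 0 h; rewrite !addr0 sdot0l addr0. Qed.

Lemma sdotNl f h : sdot (- f) h = - sdot f h.
Proof. by rewrite -scaleN1r sdotZl mulN1r. Qed.

Lemma sdotBl f g h : sdot (f - g) h = sdot f h - sdot g h.
Proof. by rewrite sdotDl sdotNl. Qed.

Lemma sdotDr f g h : sdot f (g + h) = sdot f g + sdot f h.
Proof. by rewrite sdotC sdotDl rmorphD /= -!sdotC. Qed.

Lemma sdotZr a f h : sdot f (a *: h) = a^*%C * sdot f h.
Proof. by rewrite sdotC sdotZl rmorphM /= -sdotC. Qed.

Lemma sdotNr f h : sdot f (- h) = - sdot f h.
Proof. by rewrite sdotC sdotNl rmorphN /= -sdotC. Qed.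

Lemma sdotBr f g h : sdot f (g - h) = sdot f g - sdot f h.
Proof. by rewrite sdotDr sdotNr. Qed.

Lemma sdot0r h : sdot h 0 = 0.
Proof. by rewrite sdotC sdot0l rmorph0. Qed.

Lemma sdot_suml I (r : seq I) (P : pred I) (F : I -> H) h :
  sdot (\sum_(i <- r | P i) F i) h = \sum_(i <- r | P i) sdot (F i) h.
Proof. by apply: (big_morph (sdot^~ h)) => [f g|]; rewrite ?sdotDl ?sdot0l. Qed.

Lemma sdot_sumr I (r : seq I) (P : pred I) (F : I -> H) h :
  sdot h (\sum_(i <- r | P i) F i) = \sum_(i <- r | P i) sdot h (F i).
Proof. by apply: (big_morph (sdot h)) => [f g|]; rewrite ?sdotDr ?sdot0r. Qed.

Lemma snorm_ge0 f : 0 <= snorm f.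
Proof. exact: sqrtr_ge0. Qed.

Lemma snorm2 f : snorm f ^+ 2 = complex.Re (sdot f f).
Proof. by rewrite sqr_sqrtr // Re_sdot_ge0. Qed.

Lemma sdotff f : sdot f f = (snorm f ^+ 2)%:C%C.
Proof.
apply: complex_ReIm => /=; first by rewrite snorm2.
by have := congr1 (@complex.Im R) (sdotC f f); rewrite cIm_conj; lra.
Qed.

Lemma snorm0 : snorm (0 : H) = 0.
Proof. by rewrite /snorm sdot0l sqrtr0. Qed.

Lemma snormZ a f : snorm (a *: f) = normc a * snorm f.
Proof.
apply/eqP; rewrite -(@eqrXn2 _ 2) ?mulr_ge0 ?snorm_ge0 ?normc_ge0 //.
rewrite snorm2 sdotZl sdotZr sdotff mulrA mulc_conj -rmorphM /=.
by rewrite exprMn.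
Qed.

Lemma snormN f : snorm (- f) = snorm f.
Proof. by rewrite -scaleN1r snormZ normcN normc1 mul1r. Qed.

Lemma snormBC f g : snorm (f - g) = snorm (g - f).
Proof. by rewrite -snormN opprB. Qed.

Lemma snormD2 f g : snorm (f + g) ^+ 2 =
  snorm f ^+ 2 + 2 * complex.Re (sdot f g) + snorm g ^+ 2.
Proof.
rewrite !snorm2 sdotDl !sdotDr !cReD (sdotC g f) cRe_conj; ring.
Qed.

Lemma snormB2 f g : snorm (f - g) ^+ 2 =
  snorm f ^+ 2 - 2 * complex.Re (sdot f g) + snorm g ^+ 2.
Proof. by rewrite snormD2 snormN sdotNr cReN mulrN. Qed.

Lemma parallelogram f g : snorm (f + g) ^+ 2 + snorm (f - g) ^+ 2 =
  2 * snorm f ^+ 2 + 2 * snorm g ^+ 2.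
Proof. rewrite snormB2 snormD2; ring. Qed.

(** Expand [||s f - t g||^2 >= 0] and take [s = ||g||], [t = ||f||]. When a norm vanishes this
    choice degenerates, and other weights show that the real part cannot be positive. *)
Lemma Re_sdot_le f g : complex.Re (sdot f g) <= snorm f * snorm g.
Proof.
have key (s t : R) : 0 <= s -> 0 <= t -> 2 * (s * t) * complex.Re (sdot f g) <=
    s ^+ 2 * snorm f ^+ 2 + t ^+ 2 * snorm g ^+ 2.
  move=> s0 t0; have := sqr_ge0 (snorm (s%:C%C *: f - t%:C%C *: g)).
  rewrite snormB2 !snormZ !normc_real !exprMn !real_normK ?num_real //.
  rewrite sdotZl sdotZr !cReM /= oppr0 !mul0r !subr0; lra.
have := snorm_ge0 f; have := snorm_ge0 g.
set x := snorm f in key *; set y := snorm g in key *.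
set r := complex.Re _ in key *.
rewrite (le_eqVlt 0 y) => /orP[/eqP y0|y0]; rewrite (le_eqVlt 0 x) => /orP[/eqP x0|x0].
- have := key 1 1 ler01 ler01; rewrite -x0 -y0; nra.
- rewrite -y0 mulr0 leNgt; apply/negP => r0.
  have := key r (x ^+ 2) (ltW r0) (sqr_ge0 _); rewrite -y0.
  have : 0 < r ^+ 2 * x ^+ 2 by rewrite mulr_gt0 // exprn_gt0.
  nra.
- rewrite -x0 mul0r leNgt; apply/negP => r0.
  have := key (y ^+ 2) r (sqr_ge0 _) (ltW r0); rewrite -x0.
  have : 0 < r ^+ 2 * y ^+ 2 by rewrite mulr_gt0 // exprn_gt0.
  nra.
- have {}key := key y x (ltW y0) (ltW x0).
  have xy : 0 < 2 * (y * x) by rewrite !mulr_gt0.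
  rewrite -(ler_pM2l xy); lra.
Qed.

(** Multiplying [f] by the conjugate of [z = sdot f g] makes the inner product equal to [|z|^2]; the
    real version then applies and one factor [|z|] cancels. *)
Lemma cauchy_schwarz f g : normc (sdot f g) <= snorm f * snorm g.
Proof.
set z := sdot f g.
have [->|z0] := eqVneq z 0; first by rewrite normc0 mulr_ge0 ?snorm_ge0.
have nz : 0 < normc z.
  rewrite lt_neqAle normc_ge0 andbT eq_sym; apply/eqP => /eq0_normc h.
  by rewrite h eqxx in z0.
have := Re_sdot_le (z^*%C *: f) g.
rewrite sdotZl -/z mulrC mulc_conj snormZ normc_conj /= expr2 -mulrA.
by rewrite ler_pM2l.
Qed.

Lemma ler_snormD f g : snorm (f + g) <= snorm f + snorm g.
Proof.
rewrite -(@ler_pXn2r _ 2) ?nnegrE ?addr_ge0 ?snorm_ge0 // snormD2.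
have := Re_sdot_le f g; nra.
Qed.

Lemma ler_snorm_dist f g h : snorm (f - h) <= snorm (f - g) + snorm (g - h).
Proof. by rewrite -[f - h](subrKA g) ler_snormD. Qed.

Lemma ler_snormB f g : snorm (f - g) <= snorm f + snorm g.
Proof. by rewrite -[snorm g]snormN ler_snormD. Qed.

Lemma snorm_le_dist f g : snorm f <= snorm (f - g) + snorm g.
Proof. by rewrite -{1}[f](subrK g) ler_snormD. Qed.

Lemma ler_snorm_sum I (r : seq I) (P : pred I) (F : I -> H) :
  snorm (\sum_(i <- r | P i) F i) <= \sum_(i <- r | P i) snorm (F i).
Proof.
elim/big_ind2: _ => //; first by rewrite snorm0.
by move=> x1 y1 x2 y2 h1 h2; apply: le_trans (ler_snormD _ _) (lerD h1 h2).
Qed.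

Lemma sdot_eq0_norm f g : snorm f = 0 -> sdot f g = 0.
Proof.
move=> f0; apply: eq0_normc; apply/eqP; rewrite eq_le normc_ge0 andbT.
by have := cauchy_schwarz f g; rewrite f0 mul0r.
Qed.

Lemma complete_snorm (u : nat -> H) :
  (forall e : R, 0 < e -> exists N, forall m n, (N <= m)%N -> (N <= n)%N ->
       snorm (u m - u n) < e) ->
  exists l, forall e : R, 0 < e -> exists N, forall n, (N <= n)%N ->
       snorm (u n - l) < e.
Proof.
move=> cu; have [e e0|l hl] := @scomplete R H u.
  have [|N hN] := cu (Num.sqrt e); first by rewrite sqrtr_gt0.
  exists N => m n hm hn; have := hN m n hm hn.
  by rewrite /snorm ltr_sqrt.
exists l => e e0; have [|N hN] := hl (e ^+ 2); first by rewrite exprn_gt0.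
exists N => n hn; have := hN n hn.
by rewrite -snorm2 ltr_pXn2r // nnegrE ?snorm_ge0 ?ltW.
Qed.

Definition is_subspace M := M 0 /\ forall a f g, M f -> M g -> M (a *: f + g).

Definition sclosure M f := forall e : R, 0 < e -> exists g, M g /\ snorm (f - g) < e.

Definition sclosed M := forall f, sclosure M f -> M f.

Lemma subspaceD M f g : is_subspace M -> M f -> M g -> M (f + g).
Proof. by move=> [_ h] Mf Mg; rewrite -[f]scale1r; apply: h. Qed.

Lemma subspaceZ M a f : is_subspace M -> M f -> M (a *: f).
Proof. by move=> [h0 h] Mf; rewrite -[_ *: _]addr0; apply: h. Qed.

Lemma subspaceB M f g : is_subspace M -> M f -> M g -> M (f - g).
Proof.
by move=> sM Mf Mg; apply: subspaceD => //; rewrite -scaleN1r; apply: subspaceZ.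
Qed.

Lemma subspace_sum M I (r : seq I) (P : pred I) (F : I -> H) :
  is_subspace M -> (forall i, P i -> M (F i)) -> M (\sum_(i <- r | P i) F i).
Proof.
move=> sM MF; elim/big_ind: _ => //; first by case: sM.
by move=> x y; apply: subspaceD.
Qed.

Lemma sub_sclosure M f : M f -> sclosure M f.
Proof. by move=> Mf e e0; exists f; rewrite subrr snorm0. Qed.

Lemma sclosed_sclosure M : sclosed (sclosure M).
Proof.
move=> f cf e e0; have e2 : 0 < e / 2 by lra.
have [g [cg fg]] := cf _ e2; have [h [Mh gh]] := cg _ e2.
exists h; split=> //; apply: le_lt_trans (ler_snorm_dist _ g _) _; lra.
Qed.

Lemma subspace_sclosure M : is_subspace M -> is_subspace (sclosure M).
Proof.
move=> sM; split; first by apply: sub_sclosure; case: sM.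
move=> a f g cf cg e e0.
have na := normc_ge0 a.
have [|f' [Mf' hf]] := cf (e / 2 / (normc a + 1)).
  by rewrite divr_gt0 //; lra.
have [|g' [Mg' hg]] := cg (e / 2); first by lra.
exists (a *: f' + g'); split; first by case: sM => _; apply.
rewrite opprD addrACA -scalerBr; apply: le_lt_trans (ler_snormD _ _) _.
rewrite snormZ; have : normc a * snorm (f - f') <= e / 2; last by lra.
have : (normc a + 1) * snorm (f - f') < e / 2.
  by rewrite mulrC -ltr_pdivlMr //; lra.
have := snorm_ge0 (f - f'); lra.
Qed.

Lemma sclosure_sub M M' f : (forall g, M g -> M' g) -> sclosed M' ->
  sclosure M f -> M' f.
Proof.
move=> sub cM' cf; apply: cM' => e e0; have [g [Mg ?]] := cf e e0.
by exists g; split=> //; apply: sub.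
Qed.

Lemma sclosed_orth M : sclosed (fun f => forall u, M u -> sdot f u = 0).
Proof.
move=> f cf u Mu; apply: eq0_normc; apply/eqP; rewrite eq_le normc_ge0 andbT.
apply/ler_addgt0Pr => e e0; rewrite add0r.
have nu := snorm_ge0 u.
have [|g [gM fg]] := cf (e / (snorm u + 1)); first by rewrite divr_gt0 //; lra.
have -> : sdot f u = sdot (f - g) u by rewrite sdotBl (gM u) // subr0.
apply: le_trans (cauchy_schwarz _ _) _.
have : snorm (f - g) * (snorm u + 1) < e by rewrite -ltr_pdivlMr //; lra.
have := snorm_ge0 (f - g); lra.
Qed.

Lemma sclosedI M M' : sclosed M -> sclosed M' ->
  sclosed (fun f => M f /\ M' f).
Proof.
by move=> cM cM' f cf; split; [apply: cM|apply: cM'] => e e0;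
  have [g [[? ?] ?]] := cf e e0; exists g.
Qed.

Lemma orth_of_min f M : is_subspace M ->
  (forall u, M u -> snorm f ^+ 2 <= snorm (f - u) ^+ 2) ->
  forall u, M u -> sdot f u = 0.
Proof.
move=> sM minf u Mu; set z := sdot f u.
have h (t : R) : 2 * t * normc z ^+ 2 <= t ^+ 2 * normc z ^+ 2 * snorm u ^+ 2.
  have := minf _ (subspaceZ (t%:C%C * z) sM Mu).
  rewrite snormB2 sdotZr snormZ -/z normcM normc_real.
  rewrite !(cReM, cImM, cRe_conj, cIm_conj) !exprMn real_normK ?num_real //.
  rewrite !sqr_normcE /=; lra.
apply: eq0_normc; apply/eqP; rewrite -sqrf_eq0 eq_le sqr_ge0 andbT leNgt.
apply/negP => z0; have u0 := sqr_ge0 (snorm u).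
(* With [s = ||u||^2] and [t = 1 / (s + 1)] one has [t s <= 1], so the quadratic term in [h] is at
   most half of the linear one, which forces [|z|^2 = 0]. *)
have := h (1 / (snorm u ^+ 2 + 1)).
set s := snorm u ^+ 2 in u0 *; set w := normc z ^+ 2 in z0 *.
have s1 : 0 < s + 1 by lra.
have t0 : 0 < 1 / (s + 1) by rewrite divr_gt0.
have ts : 1 / (s + 1) * s <= 1.
  by rewrite mulrAC mul1r ler_pdivrMr //; lra.
set t := 1 / (s + 1) in t0 ts *.
have : 0 < t * w by rewrite mulr_gt0.
nra.
Qed.

(* The parallelogram law makes any minimising sequence for the distance
   to M Cauchy. *)
Theorem projection M : is_subspace M -> sclosed M ->
  forall h, exists k, M k /\ forall u, M u -> sdot (h - k) u = 0.
Proof.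
move=> sM cM h.
pose D := [set snorm (h - u) ^+ 2 | u in [set u | M u]].
have D0 : D (snorm (h - 0) ^+ 2) by exists 0 => //; case: sM.
have lbD : lbound D 0 by move=> _ [u _ <-]; rewrite sqr_ge0.
have hiD : has_inf D by split; [exists (snorm (h - 0) ^+ 2)|exists 0].
pose d := inf D.
have dle u : M u -> d <= snorm (h - u) ^+ 2.
  by move=> Mu; apply: ge_inf; [exists 0|exists u].
have /choice[u hu] (n : nat) :
    exists u, M u /\ snorm (h - u) ^+ 2 < d + n.+1%:R^-1.
  have n0 : 0 < n.+1%:R^-1 :> R by rewrite invr_gt0.
  have [_ [u Mu <-] hu] := inf_adherent n0 hiD.
  by exists u.
(* The midpoint of [u m] and [u n] lies in [M], so its squared distance to [h] is at least [d]. *)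
have distu m n : snorm (u m - u n) ^+ 2 <= 2 * m.+1%:R^-1 + 2 * n.+1%:R^-1.
  have [Mm hm] := hu m; have [Mn hn] := hu n.
  have Mmid : M (2^-1 *: (u m + u n)) by apply: subspaceZ => //; apply: subspaceD.
  have := parallelogram (h - u m) (h - u n).
  have -> : h - u m - (h - u n) = u n - u m by rewrite opprB addrC subrKA.
  rewrite [snorm (u n - _)]snormBC.
  have -> : h - u m + (h - u n) = 2 *: (h - 2^-1 *: (u m + u n)).
    rewrite scalerBr scalerA mulfV ?scale1r; last by rewrite pnatr_eq0.
    by rewrite scaler_nat mulr2n opprD addrACA.
  rewrite snormZ exprMn; have := dle _ Mmid.
  have -> : normc (2 : R[i]) = 2.
    by have := @normc_real R 2; rewrite rmorph_nat ger0_norm.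
  move: hm hn; move: (m.+1%:R^-1) (n.+1%:R^-1) => x y; lra.
have [|k hk] := @complete_snorm u.
  move=> e e0; have e4 : 0 < e ^+ 2 / 4 by rewrite divr_gt0 // exprn_gt0.
  pose N := Num.trunc ((e ^+ 2 / 4)^-1).
  have hN n : (N <= n)%N -> n.+1%:R^-1 < e ^+ 2 / 4.
    move=> Nn; rewrite invf_plt ?posrE ?ltr0n //.
    apply: lt_le_trans (truncnS_gt _) _.
    by rewrite ler_nat ltnS.
  exists N => m n hm hn.
  rewrite -(@ltr_pXn2r _ 2) ?nnegrE ?snorm_ge0 ?ltW //.
  apply: le_lt_trans (distu m n) _.
  have := hN m hm; have := hN n hn.
  move: (m.+1%:R^-1) (n.+1%:R^-1) => x y; lra.
have Mk : M k.
  apply: cM => e e0; have [N hN] := hk e e0.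
  by exists (u N); split; [case: (hu N)|rewrite snormBC hN].
exists k; split=> //.
have hkd : snorm (h - k) ^+ 2 <= d.
  have d0 : 0 <= d by apply: lb_le_inf => //; case: hiD.
  rewrite -[leRHS]sqr_sqrtr // ler_pXn2r ?nnegrE ?snorm_ge0 ?sqrtr_ge0 //.
  apply/ler_addgt0Pr => e e0; have e2 : 0 < e / 2 by lra.
  have [N hN] := hk _ e2.
  have es : 0 < (e / 2) ^+ 2 by rewrite exprn_gt0.
  pose n := maxn N (Num.trunc (((e / 2) ^+ 2)^-1)).
  have h1 : n.+1%:R^-1 < (e / 2) ^+ 2.
    rewrite invf_plt ?posrE ?ltr0n //; apply: lt_le_trans (truncnS_gt _) _.
    by rewrite ler_nat ltnS leq_maxr.
  have := ler_snorm_dist h (u n) k; have := hN n (leq_maxl _ _).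
  have : snorm (h - u n) <= Num.sqrt d + e / 2; last by lra.
  rewrite -(@ler_pXn2r _ 2) ?nnegrE ?snorm_ge0 ?addr_ge0 ?sqrtr_ge0 ?ltW //.
  have [_ hn] := hu n; rewrite sqrrD (sqr_sqrtr d0).
  have : 0 <= Num.sqrt d * (e / 2) by rewrite mulr_ge0 ?sqrtr_ge0 // ltW.
  move: hn h1; move: (n.+1%:R^-1) => x; lra.
apply: orth_of_min => // u' Mu'.
by apply: le_trans hkd _; rewrite -addrA -opprD; apply: dle; apply: subspaceD.
Qed.

Lemma bessel (e : nat -> H) f n :
  (forall i j, (i < n)%N -> (j < n)%N -> sdot (e i) (e j) = (i == j)%:R) ->
  \sum_(i < n) normc (sdot f (e i)) ^+ 2 <= snorm f ^+ 2.
Proof.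
move=> on; pose p := \sum_(i < n) sdot f (e i) *: e i.
have := sqr_ge0 (snorm (f - p)).
have fp : complex.Re (sdot f p) = \sum_(i < n) normc (sdot f (e i)) ^+ 2.
  rewrite sdot_sumr Re_sum; apply: eq_bigr => i _.
  by rewrite sdotZr mulrC mulc_conj.
have pp : snorm p ^+ 2 = complex.Re (sdot f p).
  rewrite snorm2 /p sdot_suml sdot_sumr; congr complex.Re.
  apply: eq_bigr => i _; rewrite sdotZl sdotZr sdot_sumr (bigD1 i) //=.
  rewrite sdotZr on // eqxx mulr1 big1 ?addr0; first by rewrite mulrC.
  move=> j ji; rewrite sdotZr on // (_ : (i == j :> nat) = false) ?mulr0 //.
  by rewrite eq_sym; apply/negbTE.
rewrite snormB2 pp fp; lra.
Qed.

End SemiHilbertTheory.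

(** * Square integrable functions on the circle *)

Section RealSquareIntegrable.
Variable R : realType.
Implicit Types (u v w : R -> R) (c : R).
Local Notation D := (I01 R).
Local Notation Rint u := (Rintegral mu D u).
Local Notation mfun u := (@measurable_fun _ _ (measurableTypeR R) R (I01 R) u).
Local Notation rintegrable u := (mu.-integrable D (EFin \o u)).

Lemma measurable_I01 : measurable (I01 R : set (measurableTypeR R)).
Proof. exact: measurable_itv. Qed.
Hint Resolve measurable_I01 : core.

Lemma mu_I01 : mu D = 1%E.
Proof. by rewrite /I01 lebesgue_measure_itv /= lte_fin ltr01 oppr0 adde0. Qed.

Lemma ae_imp (P Q : R -> Prop) : {ae mu, forall t, D t -> P t} ->
  (forall t, D t -> P t -> Q t) -> {ae mu, forall t, D t -> Q t}.
Proof.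
move=> hP PQ; have F := ae_filter_ringOfSetsType (@lebesgue_measure R).
by apply: (@filterS _ _ F _ _ _ hP) => t h Dt; apply: PQ => //; apply: h.
Qed.

Lemma ae_imp2 (P P' Q : R -> Prop) : {ae mu, forall t, D t -> P t} ->
  {ae mu, forall t, D t -> P' t} ->
  (forall t, D t -> P t -> P' t -> Q t) -> {ae mu, forall t, D t -> Q t}.
Proof.
move=> hP hP' PQ; have F := ae_filter_ringOfSetsType (@lebesgue_measure R).
apply: (@filterS2 _ _ F _ _ _ _ hP hP') => t h h' Dt.
by apply: PQ => //; [apply: h|apply: h'].
Qed.

Lemma rintegrable_measurable u : rintegrable u -> mfun u.
Proof. by move=> /measurable_int /measurable_EFinP. Qed.

Lemma rintegrable_cst c : rintegrable (cst c).
Proof.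
apply/integrableP; split; first by apply/measurable_EFinP; exact: measurable_cst.
by rewrite /= integral_cst // [X in (_ * X)%E]mu_I01 mule1 ltry.
Qed.

Lemma rintegrable_le u v : mfun u -> rintegrable v ->
  (forall t, D t -> `|u t| <= v t) -> rintegrable u.
Proof.
move=> mu_ iv uv; apply: le_integrable iv => //; first exact/measurable_EFinP.
move=> x Dx /=; rewrite lee_fin (le_trans (uv x Dx)) //; exact: ler_norm.
Qed.

Lemma rintegrableD u v : rintegrable u -> rintegrable v ->
  rintegrable (fun t => u t + v t).
Proof. by move=> iu iv; have := integrableD measurable_I01 iu iv. Qed.

Lemma rintegrableZ c u : rintegrable u -> rintegrable (fun t => c * u t).
Proof. by move=> iu; have := integrableZl measurable_I01 c iu. Qed.

Lemma rintegrableN u : rintegrable u -> rintegrable (fun t => - u t).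
Proof. by move=> iu; have := integrableN iu. Qed.

Lemma RintD u v : rintegrable u -> rintegrable v ->
  Rint (fun t => u t + v t) = Rint u + Rint v.
Proof. by move=> iu iv; rewrite RintegralD. Qed.

Lemma RintZ c u : rintegrable u -> Rint (fun t => c * u t) = c * Rint u.
Proof. by move=> iu; rewrite RintegralZl. Qed.

Lemma RintN u : rintegrable u -> Rint (fun t => - u t) = - Rint u.
Proof.
move=> iu; rewrite -mulN1r -RintZ //.
by apply: eq_Rintegral => t _; rewrite mulN1r.
Qed.

Lemma Rint_cst c : Rint (cst c) = c.
Proof. by rewrite Rintegral_cst // [X in fine X]mu_I01 mulr1. Qed.

Lemma Rint_le u v : rintegrable u -> rintegrable v ->
  (forall t, D t -> u t <= v t) -> Rint u <= Rint v.
Proof. by move=> iu iv uv; apply: le_Rintegral. Qed.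

Lemma Rint_ge0 u : (forall t, D t -> 0 <= u t) -> 0 <= Rint u.
Proof. by move=> h; apply: Rintegral_ge0. Qed.

Lemma EFin_Rint u : rintegrable u ->
  (Rint u)%:E = (\int[mu]_(t in D) (u t)%:E)%E.
Proof. by move=> iu; rewrite /Rintegral fineK // (integrable_fin_num _ iu). Qed.

Lemma Rint_ae u v : mfun u -> mfun v ->
  {ae mu, forall t, D t -> u t = v t} -> Rint u = Rint v.
Proof.
move=> mu_ mv uv; rewrite /Rintegral; congr fine; apply: ae_eq_integral => //.
- exact/measurable_EFinP.
- exact/measurable_EFinP.
- by apply: ae_imp uv _ => t Dt h /=; rewrite h.
Qed.

Lemma rintegrable_ae u v : mfun v -> rintegrable u ->
  {ae mu, forall t, D t -> u t = v t} -> rintegrable v.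
Proof.
move=> mv iu uv; have mu_ := rintegrable_measurable iu.
apply/integrableP; split; first exact/measurable_EFinP.
have /integrableP[_] := iu; congr (_ < _)%E; apply: ae_eq_integral => //.
- by apply: measurableT_comp => //; apply/measurable_EFinP.
- by apply: measurableT_comp => //; apply/measurable_EFinP.
- by apply: ae_imp uv _ => t Dt h /=; rewrite h.
Qed.

Lemma Rint_eq0_ae u : rintegrable u -> (forall t, D t -> 0 <= u t) ->
  Rint u = 0 -> {ae mu, forall t, D t -> u t = 0}.
Proof.
move=> iu u0 h; have mu_ := rintegrable_measurable iu.
have /(ae_eq_integral_abs mu measurable_I01) : @measurable_fun _ _ (measurableTypeR R) _ D (EFin \o u).
  exact/measurable_EFinP.
move=> [+ _] => hab.
have {}hab : ae_eq mu D (EFin \o u) (cst 0).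
  apply: hab; rewrite -[RHS](congr1 EFin h) EFin_Rint //.
  by apply: eq_integral => t /set_mem Dt /=; rewrite ger0_norm ?u0.
by apply: ae_imp hab _ => t Dt [].
Qed.

Definition sqint u := mfun u /\ rintegrable (fun t => u t ^+ 2).

Lemma sqintM u v : sqint u -> sqint v -> rintegrable (fun t => u t * v t).
Proof.
move=> [mu_ iu] [mv iv].
apply: (@rintegrable_le _ (fun t => u t ^+ 2 + v t ^+ 2)).
- exact: measurable_funM.
- exact: rintegrableD.
- move=> t _; rewrite ler_norml; have := sqr_ge0 (u t + v t).
  have := sqr_ge0 (u t - v t); have := sqr_ge0 (u t); have := sqr_ge0 (v t).
  by move=> ? ? ? ?; apply/andP; split; nra.
Qed.

Lemma sqint_cst c : sqint (cst c).
Proof. by split; [exact: measurable_cst|exact: (rintegrable_cst (c ^+ 2))]. Qed.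

Lemma sqint_rintegrable u : sqint u -> rintegrable u.
Proof.
move=> su; have := sqintM su (sqint_cst 1).
by congr (integrable _ _ _); apply/funext => t /=; rewrite mulr1.
Qed.

Lemma sqintD u v : sqint u -> sqint v -> sqint (fun t => u t + v t).
Proof.
move=> su sv; split; first by apply: measurable_funD; [case: su|case: sv].
have := rintegrableD (rintegrableD su.2 (rintegrableZ 2 (sqintM su sv))) sv.2.
by congr (integrable _ _ _); apply/funext => t /=; congr (_ %:E); ring.
Qed.

Lemma sqintZ c u : sqint u -> sqint (fun t => c * u t).
Proof.
move=> su; split; first by apply: measurable_funM => //; case: su.
have := rintegrableZ (c ^+ 2) su.2.
by congr (integrable _ _ _); apply/funext => t /=; rewrite exprMn.
Qed.

Lemma sqintN u : sqint u -> sqint (fun t => - u t).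
Proof.
by move=> /(sqintZ (-1)); congr sqint; apply/funext => t; rewrite mulN1r.
Qed.

Lemma sqintB u v : sqint u -> sqint v -> sqint (fun t => u t - v t).
Proof. by move=> su /sqintN; apply: sqintD. Qed.

Lemma sqint_le u v : mfun u -> rintegrable v ->
  (forall t, D t -> u t ^+ 2 <= v t) -> sqint u.
Proof.
move=> mu_ iv uv; split=> //; apply: rintegrable_le iv _.
- exact: measurable_funX.
- by move=> t Dt; rewrite ger0_norm ?sqr_ge0 // uv.
Qed.

(** Integrate [2 |u| <= c u^2 + 1/c] over a space of mass 1. The free weight [c] does the work of
    the Cauchy-Schwarz inequality between the mean of [|u|] and that of [u^2]. *)
Lemma Rint_norm_le u (c : R) : 0 < c -> sqint u ->
  Rint (fun t => `|u t|) <= 2^-1 * (c * Rint (fun t => u t ^+ 2) + c^-1).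
Proof.
move=> c0 su; rewrite -[c^-1 in leRHS]Rint_cst -RintZ; last exact: su.2.
rewrite -RintD; [|exact: rintegrableZ su.2|exact: rintegrable_cst].
rewrite -RintZ; last by apply: rintegrableD; [exact: rintegrableZ su.2|exact: rintegrable_cst].
apply: Rint_le.
- exact: integrable_norm (sqint_rintegrable su).
- apply: rintegrableZ; apply: rintegrableD; [exact: rintegrableZ su.2|exact: rintegrable_cst].
move=> t _ /=; rewrite -[u t ^+ 2]real_normK ?num_real //.
move: (`|u t|) => x; have := sqr_ge0 (c * x - 1).
have ci : c * c^-1 = 1 by rewrite divff // gt_eqF.
have : 0 < c^-1 by rewrite invr_gt0.
move: (c^-1) ci => d cd d0 h.
have : 0 <= d * (c * x - 1) ^+ 2 by rewrite mulr_ge0 // ltW.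
have -> : d * (c * x - 1) ^+ 2 = (c * d) * (c * x ^+ 2) - 2 * (c * d) * x + d by ring.
rewrite cd; lra.
Qed.

(* A subsequence with summable increments converges a.e.; Fatou's lemma then
   gives convergence in the mean to the pointwise limit. *)
Lemma sqint_complete (u : nat -> R -> R) : (forall n, sqint (u n)) ->
  (forall e : R, 0 < e -> exists N, forall m n, (N <= m)%N -> (N <= n)%N ->
     Rint (fun t => (u m t - u n t) ^+ 2) < e) ->
  exists l, sqint l /\
   forall e : R, 0 < e -> exists N, forall n, (N <= n)%N ->
     Rint (fun t => (u n t - l t) ^+ 2) < e.
Proof.
move=> su cu.
(* A mean square below [4^-k] yields, with the weight [c = 2^k], an increment of mean absolute value
   at most [2^-k], which is summable. *)
have /choice[N0 hN0] (k : nat) : exists N, forall m n, (N <= m)%N -> (N <= n)%N ->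
     Rint (fun t => (u m t - u n t) ^+ 2) < (4^-1) ^+ k.
  by apply: cu; rewrite exprn_gt0.
(* The sum puts both [phi k] and [phi k.+1] beyond [N0 k]; the summand [k] makes [phi] tend to
   infinity. *)
pose phi k := (k + \sum_(i < k.+1) N0 i)%N.
have phi_ge k : (N0 k <= phi k)%N.
  by rewrite /phi big_ord_recr /= addnA leq_addl.
have phi_geS k : (N0 k <= phi k.+1)%N.
  by rewrite /phi 2!big_ord_recr /=; lia.
have phi_id k : (k <= phi k)%N by rewrite leq_addr.
pose v k := u (phi k).
pose d k t := v k.+1 t - v k t.
have sd k : sqint (d k) by apply: sqintB; apply: su.
have hd k : Rint (fun t => `|d k t|) <= (2^-1) ^+ k.
  have c0 : (0 : R) < 2 ^+ k by rewrite exprn_gt0.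
  apply: le_trans (Rint_norm_le c0 (sd k)) _.
  have := ltW (hN0 k _ _ (phi_geS k) (phi_ge k)).
  rewrite -[Rint _]/(Rint (fun t => d k t ^+ 2)).
  move: (Rint _) => x hx; rewrite exprVn.
  have e4 : (4 : R)^-1 ^+ k = (2 ^+ k)^-1 * (2 ^+ k)^-1.
    by rewrite -invfM -exprD addnn -mul2n exprM exprVn; congr (_ ^+ _)^-1; ring.
  rewrite e4 in hx.
  have : 2 ^+ k * x <= (2 ^+ k)^-1.
    by rewrite mulrC -ler_pdivlMr.
  lra.
have md k : @measurable_fun _ _ (measurableTypeR R) _ D (fun t => `|(d k t)%:E|%E).
  apply: measurableT_comp => //; apply/measurable_EFinP; exact: (sd k).1.
pose S t := (\sum_(k <oo) `|(d k t)%:E|)%E.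
have mS : @measurable_fun _ _ (measurableTypeR R) _ D S by apply: ge0_emeasurable_sum.
have iS : mu.-integrable D S.
  apply/integrableP; split=> //.
  have -> : (\int[mu]_(t in D) `|S t| = \int[mu]_(t in D) S t)%E.
    by apply: eq_integral => t _; rewrite gee0_abs //; apply: nneseries_ge0.
  rewrite integral_nneseries //.
  apply: (@le_lt_trans _ _ (\sum_(k <oo) ((2^-1) ^+ k)%:E)%E).
    apply: lee_nneseries => [k _ _|k _]; first exact: integral_ge0.
    by rewrite -EFin_Rint ?lee_fin //; apply: integrable_norm (sqint_rintegrable (sd k)).
  have -> : (\sum_(k <oo) (((2 : R)^-1) ^+ k)%:E)%E = (limn (series (geometric 1 (2^-1 : R))))%:E.
    rewrite -EFin_lim; last first.
      by apply: is_cvg_geometric_series; rewrite ger0_norm; lra.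
    congr (limn _); apply/funext => n /=; rewrite /series /= sumEFin.
    by congr (_ %:E); apply: eq_bigr => i _; rewrite /geometric /= mul1r.
  exact: ltry.
(* The upper limit is a measurable function on the whole circle, including the null set where the
   subsequence may diverge. *)
pose l t := fine (limn_esup (fun k => (v k t)%:E)).
have ml : mfun l.
  apply: (measurableT_comp (fine_measurable measurableT)).
  apply: measurable_fun_limn_esup => k; apply/measurable_EFinP; exact: (su _).1.
have vl : {ae mu, forall t, D t -> v ^~ t @ \oo --> l t}.
  apply: ae_imp (integrable_ae measurable_I01 iS) _ => t Dt h.
  have cs : cvgn (series (fun k => d k t)).
    apply: normed_cvg; apply/cvg_ex; exists (fine (S t)).
    have : (\sum_(0 <= k < n) `|(d k t)%:E|)%E @[n --> \oo] --> S t.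
      by apply: is_cvg_nneseries => n _ _.
    rewrite -{1}[S t]fineK // => /fine_cvg; apply: cvg_trans; apply: near_eq_cvg.
    apply: nearW => n /=; rewrite /series /=.
    by rewrite sumEFin.
  have cv : cvgn (v ^~ t).
    have -> : v ^~ t = (fun n => v 0%N t + series (fun k => d k t) n).
      apply/funext => n; rewrite /series /=.
      by rewrite -[d]/(fun k t => v k.+1 t - v k t) telescope_sumr // subrKC.
    by apply: is_cvgD => //; exact: is_cvg_cst.
  have : (fun k => (v k t)%:E) @ \oo --> (limn (v ^~ t))%:E.
    by apply/cvg_EFin; [exact: nearW|].
  by move=> /cvg_limn_einf_sup[_ h2]; rewrite /l h2.
(* Fatou's lemma in [k] for [(u n - v k)^2], with [n] fixed. It bounds an extended integral, so it
   also yields the square integrability of [u n - l], hence of [l]. *)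
have key n (e : R) N : (forall m, (N <= m)%N -> Rint (fun t => (u n t - u m t) ^+ 2) <= e) ->
    (\int[mu]_(t in D) ((u n t - l t) ^+ 2)%:E <= e%:E)%E.
  move=> hm.
  have mk k : @measurable_fun _ _ (measurableTypeR R) _ D (fun t => ((u n t - v k t) ^+ 2)%:E).
    by apply/measurable_EFinP; apply: measurable_funX; apply: (sqintB _ _).1; apply: su.
  have -> : (\int[mu]_(t in D) ((u n t - l t) ^+ 2)%:E =
      \int[mu]_(t in D) limn_einf (fun k => ((u n t - v k t) ^+ 2)%:E))%E.
    apply: ae_eq_integral => //.
    - apply/measurable_EFinP; apply: measurable_funX; apply: measurable_funB => //.
      exact: (su n).1.
    - apply: measurableT_comp => //; apply: measurable_fun_limn_esup => k.
      exact: measurableT_comp.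
    - apply: ae_imp vl _ => t Dt cvl /=.
      suff /cvg_limn_einf_sup[-> _] : (fun k => ((u n t - v k t) ^+ 2)%:E) @ \oo -->
        ((u n t - l t) ^+ 2)%:E by [].
      apply/cvg_EFin; first exact: nearW.
      apply: cvgM; apply: cvgB => //; exact: cvg_cst.
  apply: le_trans (fatou _ measurable_I01 mk _) _.
    by move=> k t _; rewrite lee_fin sqr_ge0.
  rewrite limn_einf_lim; apply: lime_le; first exact: is_cvg_einfs.
  apply: nearW => k; apply: (@ereal_inf_le _ _ _).
  exists (\int[mu]_(t in D) ((u n t - v (maxn k N) t) ^+ 2)%:E)%E.
    by exists (maxn k N) => //=; rewrite leq_maxl.
  rewrite -EFin_Rint ?lee_fin; last exact: (sqintB (su _) (su _)).2.
  apply: hm; exact: leq_trans (leq_maxr _ _) (phi_id _).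
have sl : sqint l.
  have [N hN] := cu 1 ltr01.
  have {}hN := key N 1 N (fun m hm => ltW (hN N m (leqnn _) hm)).
  have snl : sqint (fun t => u N t - l t).
    have mul_ : mfun (fun t => u N t - l t).
      by apply: measurable_funB => //; exact: (su N).1.
    split=> //; apply/integrableP; split.
      by apply/measurable_EFinP; apply: measurable_funX.
    apply: le_lt_trans (ltry 1); apply: le_trans hN.
    by rewrite le_eqVlt; apply/orP; left; apply/eqP; apply: eq_integral => t _ /=;
      rewrite ger0_norm ?sqr_ge0.
  have := sqintB (su N) snl; congr sqint; apply/funext => t; ring.
exists l; split=> // e e0; have e2 : 0 < e / 2 by lra.
have [N hN] := cu _ e2; exists N => n hn.
have := key n (e / 2) N (fun m hm => ltW (hN n m hn hm)).
rewrite -EFin_Rint; last exact: (sqintB (su _) sl).2.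
rewrite lee_fin; lra.
Qed.

End RealSquareIntegrable.

Section ComplexIntegral.
Variable R : realType.
Implicit Types (f g h z w : R -> R[i]) (a : R[i]).
Local Notation D := (I01 R).
Local Notation Rint u := (Rintegral mu D u).
Local Notation mfun u := (@measurable_fun _ _ (measurableTypeR R) R (I01 R) u).
Local Notation rintegrable u := (mu.-integrable D (EFin \o u)).
Local Notation rpart f := (fun t => complex.Re (f t)).
Local Notation ipart f := (fun t => complex.Im (f t)).

Definition cmeasurable z := mfun (rpart z) /\ mfun (ipart z).

Definition cintegrable z := rintegrable (rpart z) /\ rintegrable (ipart z).

Lemma L2P f : L2 f <-> sqint (rpart f) /\ sqint (ipart f).
Proof.
split=> [[mr [mi i]]|[[mr ir] [mi ii]]]; last first.
  by split=> //; split=> //; apply: rintegrableD.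
split; apply: (sqint_le _ i) => //= t _; rewrite ?lerDl ?lerDr sqr_ge0 //.
Qed.

Lemma cintD z w : cintegrable z -> cintegrable w ->
  cint (fun t => z t + w t) = cint z + cint w.
Proof.
move=> [zr zi] [wr wi]; apply: complex_ReIm; rewrite ?cReD ?cImD /= -RintD //;
  by apply: eq_Rintegral => t _; rewrite ?cReD ?cImD.
Qed.

Lemma cintZ a z : cintegrable z -> cint (fun t => a * z t) = a * cint z.
Proof.
move=> [zr zi]; rewrite /cint; apply: complex_ReIm => /=; rewrite (cReM, cImM) /=.
  rewrite -!RintZ // -RintN; last exact: rintegrableZ.
  rewrite -RintD; [|exact: rintegrableZ|by apply: rintegrableN; exact: rintegrableZ].
  by apply: eq_Rintegral => t _; rewrite cReM.
rewrite -!RintZ // -RintD; [|exact: rintegrableZ|exact: rintegrableZ].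
by apply: eq_Rintegral => t _; rewrite cImM.
Qed.

Lemma cint_conj z : cintegrable z -> cint (fun t => (z t)^*%C) = (cint z)^*%C.
Proof.
move=> [zr zi]; rewrite /cint; apply: complex_ReIm => /=.
  by apply: eq_Rintegral => t _; rewrite cRe_conj.
by rewrite -RintN //; apply: eq_Rintegral => t _; rewrite cIm_conj.
Qed.

Lemma ipE f h : ip f h = cint (fun t => f t * (h t)^*%C).
Proof. by []. Qed.

Lemma cintegrable_ip f h : L2 f -> L2 h -> cintegrable (fun t => f t * (h t)^*%C).
Proof.
move=> /L2P[fr fi] /L2P[hr hi]; split.
  have := rintegrableD (sqintM fr hr) (sqintM fi hi).
  congr (integrable _ _ _); apply/funext => t /=.
  by rewrite cReM cRe_conj cIm_conj mulrN opprK.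
have := rintegrableD (rintegrableN (sqintM fr hi)) (sqintM fi hr).
congr (integrable _ _ _); apply/funext => t /=.
by rewrite cImM cRe_conj cIm_conj mulrN.
Qed.

Lemma L2_lin a f h : L2 f -> L2 h -> L2 (fun t => a * f t + h t).
Proof.
move=> /L2P[fr fi] /L2P[hr hi]; apply/L2P; split.
  have := sqintD (sqintB (sqintZ (complex.Re a) fr) (sqintZ (complex.Im a) fi)) hr.
  by congr sqint; apply/funext => t; rewrite cReD cReM.
have := sqintD (sqintD (sqintZ (complex.Re a) fi) (sqintZ (complex.Im a) fr)) hi.
by congr sqint; apply/funext => t; rewrite cImD cImM.
Qed.

Lemma L20 : L2 (fun=> 0 : R[i]).
Proof. by apply/L2P; split; exact: sqint_cst. Qed.

Definition L2pred : {pred R -> R[i]} := fun f => `[< L2 f >].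

Lemma L2pred_submod_closed : submod_closed L2pred.
Proof.
split; first by apply/asboolP; exact: L20.
by move=> a f g /asboolP Lf /asboolP Lg; apply/asboolP; exact: L2_lin.
Qed.

HB.instance Definition _ := GRing.isSubmodClosed.Build R[i] (R -> R[i]) L2pred
  L2pred_submod_closed.

End ComplexIntegral.

(** No quotient by a.e. equality is taken: identities that hold at every point become equalities of
    vectors, and a.e. equality is expressed by [snorm (f - g) = 0]. *)
Record L2t (R : realType) := MkL2t { L2val :> R -> R[i]; _ : L2val \in @L2pred R }.

HB.instance Definition _ (R : realType) := [isSub for @L2val R].
HB.instance Definition _ (R : realType) := gen_eqMixin (L2t R).
HB.instance Definition _ (R : realType) := gen_choiceMixin (L2t R).
HB.instance Definition _ (R : realType) := [SubChoice_isSubLmodule of L2t R by <:].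

(** * The space [L^2(m)]: completeness, multiplication operators and conjugation *)

Section L2Space.
Variable R : realType.
Implicit Types (f g h : L2t R) (a : R[i]) (z w : R -> R[i]).
Local Notation D := (I01 R).
Local Notation Rint u := (Rintegral mu D u).

Lemma L2valP f : L2 f.
Proof. by case: f => f /= /asboolP. Qed.

Lemma L2t_eq f g : (forall t, f t = g t) -> f = g.
Proof. by move=> h; apply: val_inj; apply/funext. Qed.

Lemma L2valD f g t : (f + g) t = f t + g t. Proof. by []. Qed.
Lemma L2valN f t : (- f) t = - f t. Proof. by []. Qed.
Lemma L2valZ a f t : (a *: f) t = a * f t. Proof. by []. Qed.
Lemma L2val0 t : (0 : L2t R) t = 0. Proof. by []. Qed.

Lemma ip_linl a f g h : ip (a *: f + g) h = a * ip f h + ip g h.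
Proof.
rewrite /ip -cintZ; last exact: cintegrable_ip (L2valP _) (L2valP _).
have [fh1 fh2] := cintegrable_ip (L2valP f) (L2valP h).
rewrite -cintD; last exact: cintegrable_ip (L2valP _) (L2valP _).
  by congr cint; apply/funext => t; rewrite L2valD L2valZ mulrDl mulrA.
have := cintegrable_ip (L2valP (a *: f)) (L2valP h); congr cintegrable.
by apply/funext => t; rewrite L2valZ mulrA.
Qed.

Lemma ipC f g : ip f g = (ip g f)^*%C.
Proof.
rewrite !ipE -cint_conj; last exact: cintegrable_ip (L2valP _) (L2valP _).
by congr cint; apply/funext => t; rewrite cconjM cconjK mulrC.
Qed.

Lemma Re_ip z : complex.Re (ip z z) =
  Rint (fun t => complex.Re (z t) ^+ 2 + complex.Im (z t) ^+ 2).
Proof.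
by apply: eq_Rintegral => t _; rewrite mulc_conj /= sqr_normcE.
Qed.

Lemma Re_ip_ge0 f : 0 <= complex.Re (ip f f).
Proof. by rewrite Re_ip; apply: Rint_ge0 => t _; rewrite addr_ge0 ?sqr_ge0. Qed.

Lemma Re_ipE f : complex.Re (ip f f) =
  Rint (fun t => complex.Re (f t) ^+ 2) + Rint (fun t => complex.Im (f t) ^+ 2).
Proof.
by rewrite Re_ip; have /L2P[[_ fr] [_ fi]] := L2valP f; rewrite RintD.
Qed.

Lemma L2_complete (u : nat -> L2t R) :
  (forall e : R, 0 < e -> exists N, forall m n, (N <= m)%N -> (N <= n)%N ->
     complex.Re (ip (u m - u n) (u m - u n)) < e) ->
  exists l : L2t R, forall e : R, 0 < e -> exists N, forall n, (N <= n)%N ->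
     complex.Re (ip (u n - l) (u n - l)) < e.
Proof.
move=> cu.
have sq_ge0 (v : R -> R) : 0 <= Rint (fun t => v t ^+ 2).
  by apply: Rint_ge0 => t _; rewrite sqr_ge0.
have [n|e e0|lr [slr hr]] := @sqint_complete R (fun n t => complex.Re (u n t)).
- by have /L2P[] := L2valP (u n).
- have [N hN] := cu e e0; exists N => m n hm hn.
  apply: le_lt_trans (hN m n hm hn); rewrite Re_ipE.
  rewrite (_ : Rint _ = Rint (fun t => complex.Re ((u m - u n) t) ^+ 2)) ?lerDl //.
  by apply: eq_Rintegral => t _; rewrite L2valD L2valN cReD cReN.
have [n|e e0|li [sli hi]] := @sqint_complete R (fun n t => complex.Im (u n t)).
- by have /L2P[] := L2valP (u n).
- have [N hN] := cu e e0; exists N => m n hm hn.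
  apply: le_lt_trans (hN m n hm hn); rewrite Re_ipE.
  rewrite (_ : Rint _ = Rint (fun t => complex.Im ((u m - u n) t) ^+ 2)) ?lerDr //.
  by apply: eq_Rintegral => t _; rewrite L2valD L2valN cImD cImN.
have Ll : (fun t => (lr t +i* li t)%C) \in @L2pred R by apply/asboolP/L2P.
exists (MkL2t Ll) => e e0; have e2 : 0 < e / 2 by lra.
have [N1 h1] := hr _ e2; have [N2 h2] := hi _ e2.
exists (maxn N1 N2) => n; rewrite geq_max => /andP[n1 n2].
rewrite Re_ipE.
rewrite (_ : Rint _ = Rint (fun t => (complex.Re (u n t) - lr t) ^+ 2)); last first.
  by apply: eq_Rintegral => t _; rewrite L2valD L2valN cReD cReN.
rewrite (_ : Rint (fun t => complex.Im _ ^+ 2) =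
    Rint (fun t => (complex.Im (u n t) - li t) ^+ 2)); last first.
  by apply: eq_Rintegral => t _; rewrite L2valD L2valN cImD cImN.
have := h1 n n1; have := h2 n n2; lra.
Qed.

HB.instance Definition _ := isSemiHilbert.Build R (L2t R)
  ip_linl ipC Re_ip_ge0 L2_complete.

Lemma snormE f : snorm f = l2norm f. Proof. by []. Qed.

Lemma sdotE f g : sdot f g = ip f g. Proof. by []. Qed.

Lemma aeqP f g : aeq f g <-> snorm (f - g) = 0.
Proof.
have /L2P[[mr ir] [mi ii]] := L2valP (f - g).
have nn t : 0 <= complex.Re ((f - g) t) ^+ 2 + complex.Im ((f - g) t) ^+ 2.
  by rewrite addr_ge0 ?sqr_ge0.
split=> [fg|/eqP].
  rewrite /snorm sdotE Re_ip (@Rint_ae _ _ (cst 0)) ?Rint_cst ?sqrtr0 //.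
  - by apply: measurable_funD; apply: measurable_funX.
  - apply: ae_imp fg _ => t Dt ft.
    by rewrite L2valD L2valN ft subrr /= expr0n addr0.
rewrite -sqrf_eq0 snorm2 sdotE Re_ip => /eqP h.
apply: ae_imp (Rint_eq0_ae _ _ h) _ => //; first exact: rintegrableD.
move=> t Dt; rewrite L2valD L2valN => /eqP.
rewrite paddr_eq0 ?sqr_ge0 // !sqrf_eq0 cReD cReN cImD cImN => /andP[/eqP h1 /eqP h2].
by apply: complex_ReIm; lra.
Qed.

Lemma aeq_sym z w : aeq z w -> aeq w z.
Proof. by move=> h; apply: ae_imp h _. Qed.

Lemma aeq_trans z w x : aeq z w -> aeq w x -> aeq z x.
Proof. by move=> h h'; apply: ae_imp2 h h' _ => t _ ->. Qed.

(* The values outside L^2 are sent to 0. *)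
Definition toL2 z : L2t R := insubd 0 z.

Lemma toL2K z : L2 z -> L2val (toL2 z) = z.
Proof. by move=> Lz; rewrite /toL2 insubdK //; apply/asboolP. Qed.

Lemma toL2_val f : toL2 f = f.
Proof. by apply: val_inj; rewrite /= toL2K //; exact: L2valP. Qed.

Definition bdd z := cmeasurable z /\ exists C : R, {ae mu, forall t, D t ->
  complex.Re (z t) ^+ 2 + complex.Im (z t) ^+ 2 <= C}.

Lemma cmeasurableM z w : cmeasurable z -> cmeasurable w ->
  cmeasurable (fun t => z t * w t).
Proof.
move=> [zr zi] [wr wi]; split.
  have := measurable_funB (measurable_funM zr wr) (measurable_funM zi wi).
  by congr measurable_fun; apply/funext => t /=; rewrite cReM.
have := measurable_funD (measurable_funM zr wi) (measurable_funM zi wr).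
by congr measurable_fun; apply/funext => t /=; rewrite cImM.
Qed.

Lemma cmeasurable_conj z : cmeasurable z -> cmeasurable (fun t => (z t)^*%C).
Proof.
move=> [zr zi]; split.
  by move: zr; congr measurable_fun; apply/funext => t /=; rewrite cRe_conj.
have : measurable_fun _ _ := measurableT_comp (@oppr_measurable R setT) zi.
by congr measurable_fun; apply/funext => t /=; rewrite cIm_conj.
Qed.

Lemma L2_ae_le z w C : cmeasurable z -> L2 w ->
  {ae mu, forall t, D t -> complex.Re (z t) ^+ 2 + complex.Im (z t) ^+ 2 <=
    C * (complex.Re (w t) ^+ 2 + complex.Im (w t) ^+ 2)} -> L2 z.
Proof.
move=> [mr mi] [_ [_ iw]] zw; split=> //; split=> //.
pose b t := `|C * (complex.Re (w t) ^+ 2 + complex.Im (w t) ^+ 2)|.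
have ib : mu.-integrable D (EFin \o b).
  exact: (integrable_norm (rintegrableZ C iw)).
have mz : @measurable_fun _ _ (measurableTypeR R) R D
    (fun t => complex.Re (z t) ^+ 2 + complex.Im (z t) ^+ 2).
  by apply: measurable_funD; apply: measurable_funX.
(* [rintegrable_le] wants a bound at every point, while the given one holds a.e.: the truncation at
   [b] is bounded everywhere and agrees with the integrand a.e. *)
apply: (@rintegrable_ae _ (fun t =>
  Num.min (complex.Re (z t) ^+ 2 + complex.Im (z t) ^+ 2) (b t))) => //.
  apply: (rintegrable_le _ ib).
    exact: measurable_minr mz (rintegrable_measurable ib).
  move=> t Dt; rewrite ger0_norm ?ge_min ?lexx ?orbT //.
  by rewrite le_min normr_ge0 addr_ge0 ?sqr_ge0.
apply: ae_imp zw _ => t Dt h; apply/min_idPl.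
exact: le_trans h (ler_norm _).
Qed.

Lemma sqr_modM (x y : R[i]) : complex.Re (x * y) ^+ 2 + complex.Im (x * y) ^+ 2 =
  (complex.Re x ^+ 2 + complex.Im x ^+ 2) * (complex.Re y ^+ 2 + complex.Im y ^+ 2).
Proof. by rewrite -!sqr_normcE normcM exprMn. Qed.

Lemma L2_cmeasurable z : L2 z -> cmeasurable z.
Proof. by move=> [? []]. Qed.

Lemma L2_bddM z w : bdd z -> L2 w -> L2 (fun t => z t * w t).
Proof.
move=> [mz [C hC]] Lw; apply: (@L2_ae_le _ w C) => //.
  by apply: cmeasurableM => //; exact: L2_cmeasurable.
apply: ae_imp hC _ => t Dt h; rewrite sqr_modM ler_wpM2r //.
by rewrite addr_ge0 ?sqr_ge0.
Qed.

Lemma bddM z w : bdd z -> bdd w -> bdd (fun t => z t * w t).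
Proof.
move=> [mz [C hC]] [mw [C' hC']]; split; first exact: cmeasurableM.
exists (C * C'); apply: ae_imp2 hC hC' _ => t Dt h h'; rewrite sqr_modM.
by apply: ler_pM => //; rewrite addr_ge0 ?sqr_ge0.
Qed.

Lemma bdd_conj z : bdd z -> bdd (fun t => (z t)^*%C).
Proof.
move=> [mz [C hC]]; split; first exact: cmeasurable_conj.
by exists C; apply: ae_imp hC _ => t Dt; rewrite cRe_conj cIm_conj sqrrN.
Qed.

Lemma bdd_cst a : bdd (cst a).
Proof.
split; first by split; exact: measurable_cst.
by exists (complex.Re a ^+ 2 + complex.Im a ^+ 2); apply: aeW.
Qed.

Lemma bdd_L2 z : bdd z -> L2 z.
Proof.
move=> bz; have L1 : L2 (cst (1 : R[i])) by apply/L2P; split; exact: sqint_cst.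
have := L2_bddM bz L1; congr L2; apply/funext => t; exact: mulr1.
Qed.

Lemma L2_conj z : L2 z -> L2 (fun t => (z t)^*%C).
Proof.
move=> Lz; apply: (@L2_ae_le _ z 1) => //.
  by apply: cmeasurable_conj; exact: L2_cmeasurable.
by apply: aeW => t _; rewrite mul1r cRe_conj cIm_conj sqrrN.
Qed.

Definition Mul z f : L2t R := toL2 (fun t => z t * f t).

Lemma MulE z f t : bdd z -> Mul z f t = z t * f t.
Proof. by move=> bz; rewrite /Mul toL2K //; apply: L2_bddM => //; exact: L2valP. Qed.

Lemma Mul_lin z a f g : bdd z -> Mul z (a *: f + g) = a *: Mul z f + Mul z g.
Proof.
move=> bz; apply: L2t_eq => t; rewrite L2valD L2valZ !MulE //.
by rewrite L2valD L2valZ mulrDr mulrCA.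
Qed.

Lemma sdot_Mul z f g : bdd z -> sdot (Mul z f) g = sdot f (Mul (fun t => (z t)^*%C) g).
Proof.
move=> bz; rewrite !sdotE !ipE; congr cint; apply/funext => t.
by rewrite (MulE _ _ bz) (MulE _ _ (bdd_conj bz)) cconjM cconjK mulrCA mulrA.
Qed.

Definition Cj f : L2t R := toL2 (fun t => (f t)^*%C).

Lemma CjE f t : Cj f t = (f t)^*%C.
Proof. by rewrite /Cj toL2K //; apply: L2_conj; exact: L2valP. Qed.

Lemma CjK f : Cj (Cj f) = f.
Proof. by apply: L2t_eq => t; rewrite !CjE cconjK. Qed.

Lemma sdot_Cj f g : sdot (Cj f) (Cj g) = sdot g f.
Proof.
by rewrite !sdotE !ipE; congr cint; apply/funext => t; rewrite !CjE cconjK mulrC.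
Qed.

Lemma Cj_lin a f g : Cj (a *: f + g) = a^*%C *: Cj f + Cj g.
Proof.
by apply: L2t_eq => t; rewrite L2valD L2valZ !CjE L2valD L2valZ cconjD cconjM.
Qed.

Lemma snorm_ae f g :
  aeq (fun t => (normc (f t) ^+ 2)%:C%C) (fun t => (normc (g t) ^+ 2)%:C%C) ->
  snorm f = snorm g.
Proof.
move=> fg; rewrite /snorm !sdotE !Re_ip; congr Num.sqrt.
have /L2P[[mr _] [mi _]] := L2valP f; have /L2P[[mr' _] [mi' _]] := L2valP g.
apply: Rint_ae; try by apply: measurable_funD; apply: measurable_funX.
by apply: ae_imp fg _ => t Dt [] /=; rewrite !sqr_normcE.
Qed.

End L2Space.

(** * Fourier coefficients *)

Section Exponentials.
Variable R : realType.
Implicit Types (x y t c : R) (n m : int).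
Local Notation D := (I01 R).
Local Notation Rint u := (Rintegral mu D u).

Lemma ecircD x y : ecirc (x + y) = ecirc x * ecirc y.
Proof.
by apply: complex_ReIm; rewrite ?cReM ?cImM /= mulrDr ?cosD ?sinD //; ring.
Qed.

Lemma ecirc0 : ecirc (0 : R) = 1.
Proof. by apply: complex_ReIm; rewrite /= mulr0 ?cos0 ?sin0. Qed.

Lemma ecircN x : ecirc (- x) = conjc (ecirc x).
Proof. by apply: complex_ReIm; rewrite /= mulrN ?cosN ?sinN. Qed.

Lemma ecircNM x : ecirc (- x) * ecirc x = 1.
Proof. by rewrite -ecircD addNr ecirc0. Qed.

Lemma ecirc_int n : ecirc (n%:~R : R) = 1.
Proof.
have e1 : ecirc (1 : R) = 1.
  have -> : (1 : R) = 2^-1 + 2^-1 by lra.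
  have h : 2 * pi * 2^-1 = pi :> R by lra.
  by rewrite ecircD; apply: complex_ReIm; rewrite ?cReM ?cImM /= h cospi sinpi; ring.
have en (k : nat) : ecirc (k%:R : R) = 1.
  by elim: k => [|k IH]; rewrite ?ecirc0 // -natr1 ecircD IH e1 mulr1.
case: n => k; first exact: en.
by rewrite NegzE rmorphN /= ecircN en; apply: complex_ReIm; rewrite /= ?oppr0.
Qed.

Lemma sqr_mod_ecirc x : complex.Re (ecirc x) ^+ 2 + complex.Im (ecirc x) ^+ 2 = 1.
Proof. exact: cos2Dsin2. Qed.

Lemma normc_ecirc x : normc (ecirc x) = 1.
Proof. by rewrite /= cos2Dsin2 sqrtr1. Qed.

Lemma is_derive_cosM c x : is_derive x 1 (fun t => cos (c * t)) (- sin (c * x) * c).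
Proof.
have h : is_derive x 1 (fun t => c * t) c.
  by apply: is_derive_eq; rewrite -[RHS]mulr1.
exact: (is_derive1_comp (is_derive_cos (c * x)) h).
Qed.

Lemma is_derive_sinM c x : is_derive x 1 (fun t => sin (c * t)) (cos (c * x) * c).
Proof.
have h : is_derive x 1 (fun t => c * t) c.
  by apply: is_derive_eq; rewrite -[RHS]mulr1.
exact: (is_derive1_comp (is_derive_sin (c * x)) h).
Qed.

Lemma continuous_cosM c : continuous (fun t => cos (c * t)).
Proof.
by move=> x; apply: differentiable_continuous; apply/derivable1_diffP;
  have [] := is_derive_cosM c x.
Qed.

Lemma continuous_sinM c : continuous (fun t => sin (c * t)).
Proof.
by move=> x; apply: differentiable_continuous; apply/derivable1_diffP;
  have [] := is_derive_sinM c x.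
Qed.

Lemma Rint_derive (F f : R -> R) : continuous f ->
  (forall x, is_derive x 1 F (f x)) -> Rint f = F 1 - F 0.
Proof.
move=> cf dF; rewrite /Rintegral /I01.
rewrite (@continuous_FTC2 _ f F) //.
- exact: continuous_subspaceT.
- have cF : continuous F.
    by move=> x; apply: differentiable_continuous; apply/derivable1_diffP;
      have [] := dF x.
  split=> [x _|//|//]; first by have [] := dF x.
  + exact: cvg_at_right_filter (cF 0).
  + exact: cvg_at_left_filter (cF 1).
- by move=> x _; rewrite derive1E; have [] := dF x.
Qed.

Lemma cmeasurable_ecirc c : cmeasurable (fun t => ecirc (c * t)).
Proof.
split=> /=; under eq_fun do rewrite mulrA.
  apply: measurable_funTS; apply: continuous_measurable_fun; exact: continuous_cosM.
apply: measurable_funTS; apply: continuous_measurable_fun; exact: continuous_sinM.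
Qed.

Lemma bdd_ecirc c : bdd (fun t => ecirc (c * t)).
Proof.
split; first exact: cmeasurable_ecirc.
by exists 1; apply: aeW => t _; rewrite sqr_mod_ecirc.
Qed.

Lemma cint_ecirc n : cint (fun t => ecirc (n%:~R * t)) = (n == 0)%:R.
Proof.
have [->|n0] := eqVneq n 0.
  have -> : (fun t : R => ecirc (0%:~R * t)) = cst 1.
    by apply/funext => t; rewrite mul0r ecirc0.
  by apply: complex_ReIm; rewrite /= Rint_cst.
pose c : R := 2 * pi * n%:~R.
have c0 : c != 0 by rewrite !mulf_neq0 ?intr_eq0 // gt_eqF ?pi_gt0.
have e1 := ecirc_int n; have {e1}[c1 s1] : cos c = 1 /\ sin c = 0.
  by split; [have := congr1 (@complex.Re R) e1|have := congr1 (@complex.Im R) e1].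
apply: complex_ReIm => /=.
  under eq_Rintegral do rewrite mulrA.
  have d x : is_derive x 1 (fun t => c^-1 * sin (c * t)) (cos (c * x)).
    have h := is_derive_sinM c x.
    by apply: is_derive_eq; rewrite /GRing.scale /= mulrCA mulVf // mulr1.
  rewrite [LHS](Rint_derive (@continuous_cosM c) d).
  by rewrite mulr1 mulr0 s1 sin0 subrr.
under eq_Rintegral do rewrite mulrA.
have d x : is_derive x 1 (fun t => - c^-1 * cos (c * t)) (sin (c * x)).
  have h := is_derive_cosM c x.
  apply: is_derive_eq; rewrite /GRing.scale /= mulNr mulNr mulrN opprK.
  by rewrite mulrCA mulVf // mulr1.
rewrite [LHS](Rint_derive (@continuous_sinM c) d).
by rewrite mulr1 mulr0 c1 cos0 subrr.
Qed.

Definition en n : L2t R := toL2 (fun t => ecirc (n%:~R * t)).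

Lemma enE n t : en n t = ecirc (n%:~R * t).
Proof. by rewrite /en toL2K //; apply: bdd_L2; exact: bdd_ecirc. Qed.

Lemma sdot_en n m : sdot (en n) (en m) = (n == m)%:R.
Proof.
rewrite sdotE ipE -subr_eq0 -cint_ecirc; congr cint; apply/funext => t.
by rewrite !enE -ecircN -ecircD rmorphB mulrBl.
Qed.

Lemma fourierE (f : L2t R) n : fourier f n = sdot f (en n).
Proof.
by rewrite sdotE ipE; congr cint; apply/funext => t; rewrite enE -ecircN.
Qed.

End Exponentials.

(** * Approximation of the sign function by iterated polynomials *)

Section SignApproximation.
Variable R : realType.
Implicit Types y d : R.

(** The Newton-Schulz iteration for the sign function. Being polynomial, it maps real trigonometric
    polynomials to trigonometric polynomials, so indicators of arcs can be approximated without a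
    Weierstrass or Fejer theorem. *)
Definition sgstep y : R := (3 * y - y ^+ 3) / 2.

Lemma sgstep_itv y : `|y| <= 1 -> `|sgstep y| <= 1.
Proof.
rewrite !ler_norml /sgstep => /andP[h1 h2].
have a : 0 <= (1 - y) ^+ 2 * (2 + y) by rewrite mulr_ge0 ?sqr_ge0 //; lra.
have b : 0 <= (1 + y) ^+ 2 * (2 - y) by rewrite mulr_ge0 ?sqr_ge0 //; lra.
by apply/andP; split; lra.
Qed.

Lemma iter_sgstep_itv y n : `|y| <= 1 -> `|iter n sgstep y| <= 1.
Proof. by move=> hy; elim: n => //= n IH; exact: sgstep_itv. Qed.

Lemma iter_sgstepN y n : iter n sgstep (- y) = - iter n sgstep y.
Proof. by elim: n => //= n ->; rewrite /sgstep; field. Qed.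

(** The error factors as [1 - sgstep z = (1 - z) (1 - z/2 - z^2/2)]. The iterates stay above [y], so
    each step multiplies the error by at most [1 - y/2]. *)
Lemma iter_sgstep_pos y n : 0 < y <= 1 ->
  [/\ y <= iter n sgstep y, iter n sgstep y <= 1 &
      1 - iter n sgstep y <= (1 - y / 2) ^+ n].
Proof.
move=> /andP[y0 y1]; elim: n => [|n /= [h1 h2 h3]]; first by split=> //=; lra.
set z := iter n sgstep y in h1 h2 h3 *.
have a : 0 <= (1 - z) ^+ 2 * (2 + z) by rewrite mulr_ge0 ?sqr_ge0 //; lra.
have b : 0 <= z * (1 - z) * (1 + z) by rewrite !mulr_ge0 //; lra.
have e : (1 - y / 2) * (1 - z) - (1 - sgstep z) = (1 - z) * ((z - y) + z ^+ 2) / 2.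
  by rewrite /sgstep; field.
have c : 0 <= (1 - z) * ((z - y) + z ^+ 2) / 2.
  have z2 := sqr_ge0 z; rewrite divr_ge0 // mulr_ge0 //; lra.
have d : (1 - y / 2) * (1 - z) <= (1 - y / 2) * (1 - y / 2) ^+ n.
  by rewrite ler_wpM2l //; lra.
split; [rewrite /sgstep; lra|rewrite /sgstep; lra|rewrite exprS; lra].
Qed.

Lemma cvg_iter_sgstep y : `|y| <= 1 -> (fun n => iter n sgstep y) @ \oo --> Num.sg y.
Proof.
have pos z : 0 < z <= 1 -> (fun n => iter n sgstep z) @ \oo --> (1 : R).
  move=> hz; have /andP[z0 z1] := hz.
  apply: (@squeeze_cvgr _ _ _ _ (fun n => 1 - (1 - z / 2) ^+ n) (cst 1)).
  - apply: nearW => n; have [h1 h2 h3] := iter_sgstep_pos n hz.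
    by rewrite h2 andbT; lra.
  - rewrite -[X in _ --> X]subr0; apply: cvgB; first exact: cvg_cst.
    by apply: cvg_expr; rewrite ger0_norm; lra.
  - exact: cvg_cst.
rewrite ler_norml => /andP[h1 h2].
have [y0|y0|y0] := ltgtP y 0.
- rewrite ltr0_sg //; have -> : (fun n => iter n sgstep y) = (fun n => - iter n sgstep (- y)).
    by apply/funext => n; rewrite iter_sgstepN opprK.
  by apply: cvgN; apply: pos; lra.
- by rewrite gtr0_sg //; apply: pos; lra.
- rewrite y0 sgr0; have -> : (fun n => iter n sgstep (0 : R)) = cst 0.
    by apply/funext; elim=> //= n ->; rewrite /sgstep; field.
  exact: cvg_cst.
Qed.

End SignApproximation.

Section FourierUniqueness.
Variable R : realType.
Implicit Types (f g : L2t R) (z w : R -> R[i]) (u q : R -> R).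
Local Notation D := (I01 R).
Local Notation Rint u := (Rintegral mu D u).
Local Notation rintegrable u := (mu.-integrable D (EFin \o u)).

(** Terms may repeat and come in any order. What is wanted is an algebra of bounded functions
    containing the exponentials, and every closure property is an induction on the terms. *)
Inductive trigpoly : (R -> R[i]) -> Prop :=
| trigpoly0 : trigpoly (fun=> 0)
| trigpolyS a (n : int) z : trigpoly z ->
    trigpoly (fun t => a * ecirc (n%:~R * t) + z t).

Lemma trigpolyD z w : trigpoly z -> trigpoly w -> trigpoly (fun t => z t + w t).
Proof.
move=> hz hw; elim: hz => [|a n z' hz' IH].
  by move: hw; congr trigpoly; apply/funext => t; rewrite add0r.
have := trigpolyS a n IH; congr trigpoly; apply/funext => t; exact: addrA.
Qed.

Lemma trigpolyZ a z : trigpoly z -> trigpoly (fun t => a * z t).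
Proof.
elim=> [|b n z' _ IH].
  by rewrite (_ : (fun=> _) = fun=> 0); [exact: trigpoly0|apply/funext => t; rewrite mulr0].
have := trigpolyS (a * b) n IH; congr trigpoly.
by apply/funext => t; rewrite mulrDr mulrA.
Qed.

Lemma trigpoly_shift n z : trigpoly z -> trigpoly (fun t => ecirc (n%:~R * t) * z t).
Proof.
elim=> [|b m z' _ IH].
  by rewrite (_ : (fun _ => _) = fun=> 0); [exact: trigpoly0|apply/funext => t; rewrite mulr0].
have := trigpolyS b (n + m) IH; congr trigpoly.
by apply/funext => t; rewrite mulrDr rmorphD mulrDl ecircD mulrCA.
Qed.

Lemma trigpolyM z w : trigpoly z -> trigpoly w -> trigpoly (fun t => z t * w t).
Proof.
move=> hz hw; elim: hz => [|a n z' hz' IH].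
  by rewrite (_ : (fun _ => _) = fun=> 0); [exact: trigpoly0|apply/funext => t; rewrite mul0r].
have := trigpolyD (trigpolyZ a (trigpoly_shift n hw)) IH; congr trigpoly.
by apply/funext => t; rewrite mulrDl mulrA.
Qed.

Lemma trigpoly_cst a : trigpoly (fun=> a).
Proof.
have := trigpolyS a 0 trigpoly0; congr trigpoly.
by apply/funext => t; rewrite mul0r ecirc0 mulr1 addr0.
Qed.

Lemma bdd_trigpoly z : trigpoly z -> bdd z.
Proof.
elim=> [|a n z' _ [mz [C hC]]]; first exact: bdd_cst.
have [[m1 m2] _] := bddM (bdd_cst a) (bdd_ecirc (n%:~R : R)).
case: mz => m3 m4; split.
  split; [have := measurable_funD m1 m3|have := measurable_funD m2 m4];
    by congr measurable_fun; apply/funext => t; rewrite ?cReD ?cImD.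
exists (2 * normc a ^+ 2 + 2 * C); apply: ae_imp hC _ => t Dt h.
rewrite -!sqr_normcE in h *.
have h1 := le_normcD (a * ecirc (n%:~R * t)) (z' t).
rewrite normcM normc_ecirc mulr1 in h1.
have := normc_ge0 (a * ecirc (n%:~R * t) + z' t).
have := sqr_ge0 (normc a - normc (z' t)); nra.
Qed.

Lemma sdot_trigpoly f z : (forall n, sdot f (en R n) = 0) -> trigpoly z ->
  sdot f (toL2 z) = 0.
Proof.
move=> f0; elim=> [|a n z' tz' IH].
  rewrite (_ : toL2 _ = 0) ?sdot0r //.
  by apply: L2t_eq => t; rewrite toL2K //; exact: L20.
rewrite (_ : toL2 _ = a *: en R n + toL2 z').
  by rewrite sdotDr sdotZr f0 IH mulr0 addr0.
apply: L2t_eq => t; rewrite L2valD L2valZ enE !toL2K //.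
  by apply: bdd_L2; exact: bdd_trigpoly.
by apply: bdd_L2; apply: bdd_trigpoly; exact: trigpolyS.
Qed.

Lemma trigpoly_sgstep q : trigpoly (fun t => (q t)%:C%C) ->
  trigpoly (fun t => (sgstep (q t))%:C%C).
Proof.
move=> tq; have t3 := trigpolyM tq (trigpolyM tq tq).
have := trigpolyD (trigpolyZ (3 / 2)%:C%C tq) (trigpolyZ (- 2^-1)%:C%C t3).
congr trigpoly; apply/funext => t; rewrite -!rmorphM -rmorphD /=; congr (_%:C%C).
by rewrite /sgstep; field.
Qed.

(** Each factor has half-integer frequency, but the product is
    [(cos (2 pi t - pi x) - cos (pi x)) / 2], a trigonometric polynomial of degree 1. On the circle
    it changes sign exactly at the endpoints of the arc from [0] to [x]. *)
Definition sinprod (x t : R) := sin (pi * t) * sin (pi * (x - t)).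

Lemma trigpoly_sinprod x : trigpoly (fun t => (sinprod x t)%:C%C).
Proof.
have tz := trigpolyS (4^-1%:C%C * ecirc (- (x / 2))) 1
  (trigpolyS (4^-1%:C%C * ecirc (x / 2)) (-1) (trigpoly_cst (- (cos (pi * x) / 2))%:C%C)).
move: tz; congr trigpoly; apply/funext => t.
rewrite mul1r mulN1r -!mulrA -!ecircD addrA -mulrDr.
have -> : x / 2 - t = - (- (x / 2) + t) by rewrite opprD opprK.
rewrite ecircN; have e : 2 * pi * (- (x / 2) + t) = pi * t - pi * (x - t) by field.
have e' : pi * x = pi * t + pi * (x - t) by ring.
rewrite e' /sinprod; apply: complex_ReIm;
  rewrite !(cReD, cImD, cReM, cImM, cRe_conj, cIm_conj) /= e; last by ring.
by rewrite cosB cosD; field.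
Qed.

Lemma norm_sinprod x t : `|sinprod x t| <= 1.
Proof. by rewrite normrM mulr_ile1 // sin_max. Qed.

Lemma sg_sinprod_lt x t : 0 < x < 1 -> 0 < t < x -> Num.sg (sinprod x t) = 1.
Proof.
move=> /andP[x0 x1] /andP[t0 tx]; have p0 := pi_gt0 R.
rewrite gtr0_sg // mulr_gt0 // sin_gt0_pi //.
  rewrite mulr_gt0 //=; have : 0 < pi * (1 - t) by rewrite mulr_gt0 //; lra.
  lra.
apply/andP; split; first by rewrite mulr_gt0 //; lra.
have : 0 < pi * (1 - (x - t)) by rewrite mulr_gt0 //; lra.
lra.
Qed.

Lemma sg_sinprod_gt x t : 0 < x < 1 -> x < t < 1 -> Num.sg (sinprod x t) = -1.
Proof.
move=> /andP[x0 x1] /andP[tx t1]; have p0 := pi_gt0 R.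
rewrite ltr0_sg // /sinprod -opprB mulrN sinN mulrN oppr_lt0.
rewrite mulr_gt0 // sin_gt0_pi //.
  rewrite mulr_gt0 //=; last by lra.
  have : 0 < pi * (1 - t) by rewrite mulr_gt0 //; lra.
  lra.
apply/andP; split; first by rewrite mulr_gt0 //; lra.
have : 0 < pi * (1 - (t - x)) by rewrite mulr_gt0 //; lra.
lra.
Qed.

Lemma measurable_trigpoly_re q : trigpoly (fun t => (q t)%:C%C) ->
  @measurable_fun _ _ (measurableTypeR R) R D q.
Proof. by move=> /bdd_trigpoly[[]]. Qed.

Lemma ae_neq (x : R) : {ae mu, forall t, D t -> t != x}.
Proof.
exists [set x]; split; [exact: measurable_set1|exact: lebesgue_measure_set1|].
by move=> t /= /not_implyP[_ /negP]; rewrite negbK => /eqP.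
Qed.

(* Iterating sgstep on sinprod x gives trigonometric polynomials that converge
   boundedly to the sign of sinprod x, which is 1 on ]0, x[ and -1 on ]x, 1[. *)
Lemma Rint_itv_eq0 u : rintegrable u ->
  (forall q, trigpoly (fun t => (q t)%:C%C) -> Rint (fun t => u t * q t) = 0) ->
  forall x, 0 < x < 1 -> Rintegral mu `[0, x] u = 0.
Proof.
move=> iu u0 x hx; have /andP[x0 x1] := hx.
have mu_ := rintegrable_measurable iu.
pose q n t := iter n (@sgstep R) (sinprod x t).
have tq n : trigpoly (fun t => (q n t)%:C%C).
  by elim: n => [|n IH]; [exact: trigpoly_sinprod|exact: trigpoly_sgstep].
pose s t := Num.sg (sinprod x t).
have q1 n t : `|q n t| <= 1 by apply: iter_sgstep_itv; exact: norm_sinprod.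
have cq t : (fun n => (u t * q n t)%:E) @ \oo --> (u t * s t)%:E.
  apply/cvg_EFin; first exact: nearW.
  by apply: cvgMr => //; apply: cvg_iter_sgstep; exact: norm_sinprod.
have mq n : @measurable_fun _ _ (measurableTypeR R) _ D (fun t => (u t * q n t)%:E).
  apply/measurable_EFinP; apply: measurable_funM => //.
  exact: measurable_trigpoly_re.
have ms : @measurable_fun _ _ (measurableTypeR R) _ D (fun t => (u t * s t)%:E).
  by apply: (emeasurable_fun_cvg _ _ mq) => t _; exact: cq.
have [|||is_ _ hl] := @dominated_convergence _ _ _ (@lebesgue_measure R) D
  (@measurable_I01 R) (fun n t => (u t * q n t)%:E) (fun t => (u t * s t)%:E)
  (fun t => `|u t|%:E) mq ms.
- by apply: aeW => t _; exact: cq.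
- exact: integrable_norm iu.
- apply: aeW => t n _; rewrite abse_EFin lee_fin normrM ler_piMr //.
have us0 : Rint (fun t => u t * s t) = 0.
  have e : (fun n => \int[mu]_(t in D) (u t * q n t)%:E)%E = cst 0%E.
    apply/funext => n; rewrite -EFin_Rint ?u0 //.
    apply: (rintegrable_le _ (integrable_norm iu)).
      by apply/measurable_EFinP; exact: mq.
    by move=> t _; rewrite normrM ler_piMr.
  have {}hl : (fun n => \int[mu]_(t in D) (u t * q n t)%:E)%E @ \oo -->
    (\int[mu]_(t in D) (u t * s t)%:E)%E := hl.
  rewrite e in hl.
  have := cvg_lim (@ereal_hausdorff R) hl.
  by rewrite lim_cst // /Rintegral => <-.
have u1 : Rint u = 0.
  have := u0 (fun=> 1) (trigpoly_cst _); congr (_ = _).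
  by apply: eq_Rintegral => t _; rewrite mulr1.
(* Away from [0], [x] and [1] the indicator of [[0, x]] equals [(1 + s) / 2]. *)
transitivity (2^-1 * Rint (fun t => u t + u t * s t)); last first.
  by rewrite RintD // u1 us0 addr0 mulr0.
rewrite -RintZ; last exact: rintegrableD.
rewrite /Rintegral; congr fine.
have sD : (`[0, x] : set R) `<=` D.
  by move=> t /=; rewrite /I01 /= !in_itv /= => /andP[-> h]; rewrite (le_trans h) // ltW.
rewrite -{1}(setIidr sD) integral_mkcondr; apply: ae_eq_integral.
- exact: (@measurable_I01 R).
- apply/measurable_restrict => //; first exact: (@measurable_I01 R).
  by apply: measurable_funS (@measurable_I01 R) _ _; [exact: subIsetl|exact/measurable_EFinP].
- apply/measurable_EFinP; apply: measurable_funM => //; apply: measurable_funD => //.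
  exact/measurable_EFinP.
apply: ae_imp2 (ae_imp2 (ae_neq 0) (ae_neq 1) (fun t Dt h h' => conj h h')) (ae_neq x) _.
move=> t; rewrite /I01 /= in_itv /= => /andP[t0 t1] [n0 n1] nx.
have {n0}t0 : 0 < t by rewrite lt_neqAle eq_sym n0.
have {n1}t1 : t < 1 by rewrite lt_neqAle n1.
rewrite patchE; case: ifPn => [|].
  rewrite inE /= in_itv /= => /andP[_ tx].
  have -> : s t = 1 by apply: sg_sinprod_lt => //; rewrite t0 lt_neqAle nx.
  by congr (_ %:E); lra.
rewrite notin_setE /= in_itv /= (ltW t0) /= => /negP; rewrite -ltNge => xt.
have -> : s t = -1 by apply: sg_sinprod_gt => //; rewrite xt.
by congr (_ %:E); lra.
Qed.

(** All integrals of [u] over [[0, x]] vanish, and the integral function has derivative [u] a.e.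
    Extending [u] by zero makes the integral function vanish on the whole line; beyond [1] this uses
    the constant test function. *)
Lemma ae0_of_trig_orth u : rintegrable u ->
  (forall q, trigpoly (fun t => (q t)%:C%C) -> Rint (fun t => u t * q t) = 0) ->
  {ae mu, forall t, D t -> u t = 0}.
Proof.
move=> iu u0; pose v := u \_ D.
have iv : mu.-integrable [set: measurableTypeR R] (EFin \o v).
  move/(integrable_mkcond _ (@measurable_I01 R)): iu; congr integrable.
  by apply/funext => t /=; rewrite /v !patchE; case: ifP.
have hF x : Rintegral mu `[0, x] v = 0.
  have u1 : Rint u = 0.
    have := u0 (fun=> 1) (trigpoly_cst _); congr (_ = _).
    by apply: eq_Rintegral => t _; rewrite mulr1.
  have [x0|x0] := ltP 0 x; last first.
    have [x0'|x0'|->] := ltgtP x 0.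
    - by rewrite set_itv_ge ?Rintegral_set0 // bnd_simp -ltNge.
    - by have := lt_le_trans x0' x0; rewrite ltxx.
    by rewrite set_itv1 Rintegral_set1.
  have [x1|x1] := ltP x 1.
    transitivity (Rintegral mu `[0, x] u); last by apply: Rint_itv_eq0; rewrite ?x0.
    apply: eq_Rintegral => t.
    rewrite inE /= in_itv /= => /andP[t0 tx]; rewrite /v /patch ifT // inE.
    by rewrite /I01 /= in_itv /= t0 (le_trans tx) // ltW.
  rewrite -[RHS]u1 /v -Rintegral_mkcondr; congr (Rintegral _ _ _).
  apply/seteqP; split=> t /=; rewrite /I01 /= !in_itv /=; first by case.
  by move=> /andP[t0 t1]; rewrite t0 t1 (le_trans t1).
have := @FTC1 R v (BLeft 0) _ _.
have h1 : forall y, mu.-integrable [set` Interval (BLeft 0) (BRight y)] (EFin \o v).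
  by move=> y; apply: integrableS iv => //.
have h2 : locally_integrable [set: R] v.
  exact: open_integrable_locally openT iv.
move=> /(_ h1 h2) hae.
have hae' : {ae mu, forall t, D t -> 0 < t ->
    derivable (fun x : R => \int[mu]_(t in `[0, x]) v t) t 1 /\
    (fun x : R => \int[mu]_(t in `[0, x]) v t)^`()%classic t = v t}.
  have F := ae_filter_ringOfSetsType (@lebesgue_measure R).
  by apply: (@filterS _ _ F _ _ _ hae) => t h _ t0; apply: h; rewrite /= lte_fin.
apply: ae_imp2 hae' (ae_neq 0) _ => t Dt h n0.
have [|_] := h; first by move: Dt; rewrite /I01 /= in_itv lt_neqAle eq_sym n0 => /andP[].
rewrite (_ : (fun x => _) = cst 0); last by apply/funext => x; rewrite hF.
by rewrite derive1_cst /v patchE ifT // inE.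
Qed.

(** Pairing with real-valued trigonometric polynomials separates the real and imaginary parts of
    [f], to which the real result applies. *)
Lemma fourier_unique f : (forall n, sdot f (en R n) = 0) -> snorm f = 0.
Proof.
move=> f0; have /L2P[sr si] := L2valP f.
have key q : trigpoly (fun t => (q t)%:C%C) ->
    Rint (fun t => complex.Re (f t) * q t) = 0 /\
    Rint (fun t => complex.Im (f t) * q t) = 0.
  move=> tq; have := sdot_trigpoly f0 tq.
  rewrite sdotE ipE toL2K; last by apply: bdd_L2; exact: bdd_trigpoly.
  move=> h; split.
    have := congr1 (@complex.Re R) h => /= <-; apply: eq_Rintegral => t _.
    by rewrite cReM /= oppr0 mulr0 subr0.
  have := congr1 (@complex.Im R) h => /= <-; apply: eq_Rintegral => t _.
  by rewrite cImM /= oppr0 mulr0 add0r.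
have hr := ae0_of_trig_orth (sqint_rintegrable sr) (fun q tq => (key q tq).1).
have hi := ae0_of_trig_orth (sqint_rintegrable si) (fun q tq => (key q tq).2).
rewrite -(subr0 f); apply/aeqP; apply: ae_imp2 hr hi _ => t Dt h1 h2.
by apply: complex_ReIm; rewrite L2val0.
Qed.

End FourierUniqueness.

(** * Hardy space and model spaces *)

Section Span.
Variables (R : realType) (H : semiHilbertType R).
Implicit Types (f g h : H) (M : H -> Prop) (v : nat -> H).

(** In this form a property stable under linear combinations is proved on the span by instantiating
    [M]; [spanP] recovers coefficients when they are wanted. *)
Definition span v f := forall M, is_subspace M -> (forall k, M (v k)) -> M f.

Lemma subspace_span v : is_subspace (span v).
Proof.
split; first by move=> M sM _; exact: sM.1.
by move=> a f g hf hg M sM Mv; apply: sM.2; [apply: hf|apply: hg].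
Qed.

Lemma span_base v k : span v (v k).
Proof. by move=> M _; apply. Qed.

Lemma spanP v f : span v f -> exists N (a : nat -> R[i]), f = \sum_(k < N) a k *: v k.
Proof.
move=> hf; pose P g := exists N (a : nat -> R[i]), g = \sum_(k < N) a k *: v k.
apply: (hf P); last first.
  move=> k; exists k.+1, (fun j => (j == k)%:R); rewrite big_ord_recr /= eqxx scale1r.
  rewrite big1 ?add0r // => i _; rewrite (_ : (_ == _) = false) ?scale0r //.
  by apply/negbTE; rewrite neq_ltn ltn_ord.
have pad N N' (a : nat -> R[i]) : (N <= N')%N ->
    \sum_(k < N) a k *: v k = \sum_(k < N') (if (k < N)%N then a k else 0) *: v k.
  move=> NN'; rewrite (big_ord_widen N' (fun k => a k *: v k)) // big_mkcond /=.
  by apply: eq_bigr => i _; case: ifP => //; rewrite scale0r.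
split; first by exists 0%N, (fun=> 0); rewrite big_ord0.
move=> c _ _ [N [a ->]] [N' [b ->]].
pose K := maxn N N'; exists K, (fun k => c * (if (k < N)%N then a k else 0) +
  (if (k < N')%N then b k else 0)).
rewrite (pad _ K a) ?leq_maxl // (pad _ K b) ?leq_maxr //.
rewrite scaler_sumr -big_split; apply: eq_bigr => i _.
by rewrite scalerA scalerDl.
Qed.

Lemma sclosure_null M f g : sclosure M g -> snorm (f - g) = 0 -> sclosure M f.
Proof.
move=> cg fg e e0; have [h [Mh gh]] := cg e e0; exists h; split=> //.
by apply: le_lt_trans (ler_snorm_dist f g h) _; rewrite fg add0r.
Qed.

(** Project [f] onto the closure of [M]: the remainder lies in [K] and is orthogonal to [M], hence
    null. The density results for powers of [chi], for the orbit of [1] and for coboundaries all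
    come from here. *)
Lemma dense_of_orth K M : is_subspace K -> sclosed K -> is_subspace M ->
  (forall f, M f -> K f) ->
  (forall w, K w -> (forall u, M u -> sdot w u = 0) -> snorm w = 0) ->
  forall f, K f -> sclosure M f.
Proof.
move=> sK cK sM MK h f Kf.
have [k [ck ok]] := projection (subspace_sclosure sM) (@sclosed_sclosure _ _ M) f.
apply: (sclosure_null ck); apply: h.
  by apply: subspaceB => //; apply: sclosure_sub ck.
by move=> u Mu; apply: ok; exact: sub_sclosure.
Qed.

Lemma sdot_null_l f f' g : snorm (f - f') = 0 -> sdot f g = sdot f' g.
Proof.
by move=> h; apply/eqP; rewrite -subr_eq0 -sdotBl; apply/eqP; exact: sdot_eq0_norm.
Qed.

End Span.

Section Hardy.
Variable R : realType.
Implicit Types (f g h : L2t R) (n : int).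
Local Notation en := (@en R).

Definition H2s f := forall n, n < 0 -> sdot f (en n) = 0.

Lemma H2P f : H2 f <-> H2s f.
Proof.
split=> [[_ h] n n0|h]; first by rewrite -fourierE h.
by split; [exact: L2valP|move=> n n0; rewrite fourierE h].
Qed.

Lemma subspace_H2s : is_subspace H2s.
Proof.
split=> [n _|a f g hf hg n n0]; first exact: sdot0l.
by rewrite sdotDl sdotZl hf // hg // mulr0 addr0.
Qed.

Lemma sclosed_H2s : sclosed H2s.
Proof.
move=> f cf n n0.
apply: (@sclosed_orth _ _ (fun u => u = en n) f _ _ (erefl _)) => e e0.
by have [g [hg ?]] := cf e e0; exists g; split=> // _ ->; exact: hg.
Qed.

Definition cchi (t : R) : R[i] := conjc (chi t).

Lemma bdd_chi : bdd (@chi R).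
Proof.
have := bdd_ecirc (1 : R); congr bdd; apply/funext => t; by rewrite mul1r.
Qed.

Lemma bdd_cchi : bdd cchi.
Proof. exact: bdd_conj bdd_chi. Qed.

Lemma chiK t : cchi t * chi t = 1 :> R[i].
Proof. by rewrite /cchi /chi -ecircN ecircNM. Qed.

Lemma chi_en n : Mul (@chi R) (en n) = en (n + 1).
Proof.
apply: L2t_eq => t; rewrite MulE ?enE; last exact: bdd_chi.
by rewrite /chi -ecircD rmorphD mulrDl mul1r addrC.
Qed.

Lemma cchi_en n : Mul cchi (en n) = en (n - 1).
Proof.
apply: L2t_eq => t; rewrite MulE ?enE; last exact: bdd_cchi.
by rewrite /cchi /chi -ecircN -ecircD rmorphB mulrBl mul1r addrC.
Qed.

Lemma Mul_cchi_chi f : Mul cchi (Mul (@chi R) f) = f.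
Proof.
apply: L2t_eq => t; rewrite !MulE ?mulrA ?chiK ?mul1r //; [exact: bdd_chi|exact: bdd_cchi].
Qed.

Lemma Mul_chi_cchi f : Mul (@chi R) (Mul cchi f) = f.
Proof.
apply: L2t_eq => t; rewrite !MulE ?mulrA; [|exact: bdd_cchi|exact: bdd_chi].
by rewrite [chi t * _]mulrC chiK mul1r.
Qed.

Lemma sdot_chi f g : sdot (Mul (@chi R) f) g = sdot f (Mul cchi g).
Proof. exact: sdot_Mul bdd_chi. Qed.

Lemma sdot_cchi f g : sdot (Mul cchi f) g = sdot f (Mul (@chi R) g).
Proof.
have -> : @chi R = (fun t => conjc (cchi t)).
  by apply/funext => t; rewrite /cchi cconjK.
exact: sdot_Mul (@bdd_cchi).
Qed.

Lemma sdot_chichi f g : sdot (Mul (@chi R) f) (Mul (@chi R) g) = sdot f g.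
Proof. by rewrite sdot_chi Mul_cchi_chi. Qed.

Lemma H2s_chi f : H2s f -> H2s (Mul (@chi R) f).
Proof. by move=> hf n n0; rewrite sdot_chi cchi_en hf //; lia. Qed.

Lemma H2s_en (k : nat) : H2s (en k).
Proof.
by move=> n n0; rewrite sdot_en (_ : (_ == _) = false) //; apply/negbTE; lia.
Qed.

Lemma H2s_dense f : H2s f -> sclosure (span (fun k : nat => en k)) f.
Proof.
apply: dense_of_orth; [exact: subspace_H2s|exact: sclosed_H2s|exact: subspace_span|..].
  by move=> g hg; apply: hg; [exact: subspace_H2s|exact: H2s_en].
move=> w hw ow; apply: fourier_unique => n.
case: (ltP n 0) => [|n0]; first exact: hw.
case: n n0 => [k _|k]; last by lia.
by apply: ow; exact: (@span_base _ _ (fun k : nat => en k) k).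
Qed.

Lemma Cj_en n : Cj (en n) = en (- n).
Proof. by apply: L2t_eq => t; rewrite CjE !enE -ecircN rmorphN mulNr. Qed.

Lemma sdot_Cjr f g : sdot f (Cj g) = sdot g (Cj f).
Proof. by rewrite -{1}[f]CjK sdot_Cj. Qed.

(* The left-hand side is the mean of chi f h; by density h may be taken to be
   a power of chi. *)
Lemma H2s_mean_mul f h : H2s f -> H2s h -> sdot (Mul (@chi R) f) (Cj h) = 0.
Proof.
move=> hf hh; rewrite sdot_Cjr.
pose M g := forall u, u = Cj (Mul (@chi R) f) -> sdot g u = 0.
suff : M h by move=> /(_ _ (erefl _)).
apply: (sclosure_sub _ (@sclosed_orth _ _ (fun u => u = _)) (H2s_dense hh)).
move=> g hg; apply: (hg M).
  split=> [u _|a g1 g2 h1 h2 u eu]; first exact: sdot0l.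
  by rewrite sdotDl sdotZl (h1 u eu) (h2 u eu) mulr0 addr0.
move=> k u ->; rewrite -sdot_Cjr Cj_en sdot_chi cchi_en hf //; lia.
Qed.

(** Both sides are the mean of the product [z f g]. *)
Lemma Mul_Cj_swap (z : R -> R[i]) f g : bdd z ->
  sdot (Mul z f) (Cj g) = sdot (Mul z g) (Cj f).
Proof.
move=> bz; rewrite !sdotE !ipE; congr cint; apply/funext => t.
by rewrite !CjE !cconjK !MulE // mulrAC.
Qed.

End Hardy.

(** * Model spaces and the projections onto them and onto their complements *)

Section ModelSpace.
Variables (R : realType) (th : R -> R[i]).
Hypothesis inn : inner_fun th.
Implicit Types (f g h : L2t R).
Local Notation en := (@en R).
Local Notation chi := (@chi R).
Local Notation cchi := (@cchi R).

Lemma bdd_inner : bdd th.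
Proof.
have [[[L _] hb] _] := inn; split; first exact: L2_cmeasurable.
exact: hb.
Qed.
Hint Resolve bdd_inner bdd_chi bdd_cchi : core.

Definition tv : L2t R := toL2 th.

Lemma tvE t : tv t = th t.
Proof. by rewrite /tv toL2K //; exact: bdd_L2. Qed.

Lemma Mul_en0 (z : R -> R[i]) t : bdd z -> Mul z (en 0) t = z t.
Proof. by move=> bz; rewrite MulE // enE mul0r ecirc0 mulr1. Qed.

Lemma tv_Mul : tv = Mul th (en 0).
Proof. by apply: L2t_eq => t; rewrite Mul_en0 // tvE. Qed.

Lemma H2s_tv : H2s tv.
Proof.
apply/H2P; have [[h _] _] := inn; move: h; congr H2.
by apply/funext => t; rewrite tvE.
Qed.

Lemma inner_unimod : {ae mu, forall t, I01 R t -> conjc (th t) * th t = 1}.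
Proof.
have [_ h] := inn; apply: ae_imp h _ => t Dt h.
by rewrite mulrC mulc_conj sqr_normcE h.
Qed.

Lemma sdot_inner f g : sdot (Mul th f) (Mul th g) = sdot f g.
Proof.
rewrite sdot_Mul // [LHS]sdotC [RHS]sdotC; congr conjc; apply: sdot_null_l.
apply/aeqP; apply: ae_imp inner_unimod _ => t Dt h.
by rewrite !MulE //; [rewrite mulrA h mul1r|exact: bdd_conj].
Qed.

Definition Ks f := H2s f /\ forall h, H2s h -> sdot f (Mul th h) = 0.

Lemma KmodelP f : Kmodel th f <-> Ks f.
Proof.
split=> [[/H2P hf h]|[hf h]]; split=> //.
- move=> g hg; have := h g (proj2 (H2P g) hg); rewrite sdotE; congr (_ = _).
  by rewrite !ipE; congr cint; apply/funext => t; rewrite MulE.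
- exact/H2P.
- move=> g hg; have [Lg _] := hg; have := h (toL2 g).
  rewrite -H2P toL2K // => /(_ hg); rewrite sdotE; congr (_ = _).
  by rewrite !ipE; congr cint; apply/funext => t; rewrite MulE // toL2K.
Qed.

Lemma Kmodel_L2 (f : R -> R[i]) : Kmodel th f -> L2 f.
Proof. by case=> [[]]. Qed.

Lemma Kmodel_toL2 (f : R -> R[i]) : Kmodel th f -> Ks (toL2 f).
Proof. by move=> Kf; apply/KmodelP; rewrite toL2K //; exact: Kmodel_L2. Qed.

Lemma subspace_Ks : is_subspace Ks.
Proof.
split; first by split; [exact: (subspace_H2s R).1|move=> h _; exact: sdot0l].
move=> a f g [hf of_] [hg og]; split; first exact: (subspace_H2s R).2.
by move=> h hh; rewrite sdotDl sdotZl of_ // og // mulr0 addr0.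
Qed.

Lemma sclosed_Ks : sclosed Ks.
Proof.
apply: sclosedI; first exact: sclosed_H2s.
move=> f cf h hh.
apply: (@sclosed_orth _ _ (fun u => u = Mul th h) f _ _ (erefl _)) => e e0.
by have [g [hg ?]] := cf e e0; exists g; split=> // _ ->; exact: hg.
Qed.

(** [orthproj] is a choice operator, so its defining property holds only once a projection is known
    to exist. The projection theorem in [L2t] supplies one. *)
Lemma orthproj_inner (f : R -> R[i]) : L2 f ->
  Kmodel th (orthproj (Kmodel th) f) /\
  forall u, Kmodel th u -> ip (fun t => f t - orthproj (Kmodel th) f t) u = 0.
Proof.
move=> Lf; apply: (epsilon_spec _ (fun k => Kmodel th k /\
  forall u, Kmodel th u -> ip (fun t => f t - k t) u = 0)).
have [k [Kk hk]] := projection subspace_Ks sclosed_Ks (toL2 f).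
exists k; split; first exact/KmodelP.
move=> u Ku; have := hk _ (Kmodel_toL2 Ku); rewrite sdotE; congr (_ = _).
rewrite !ipE; congr cint; apply/funext => t.
by rewrite L2valD L2valN !toL2K //; exact: Kmodel_L2.
Qed.

Lemma orthproj_ocompl (f : R -> R[i]) : L2 f ->
  ocompl (Kmodel th) (orthproj (ocompl (Kmodel th)) f) /\
  forall u, ocompl (Kmodel th) u ->
    ip (fun t => f t - orthproj (ocompl (Kmodel th)) f t) u = 0.
Proof.
move=> Lf; apply: (epsilon_spec _ (fun k => ocompl (Kmodel th) k /\
  forall u, ocompl (Kmodel th) u -> ip (fun t => f t - k t) u = 0)).
have [k [Kk hk]] := projection subspace_Ks sclosed_Ks (toL2 f).
(* With [k] the projection onto the model space, the remainder is the projection onto the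
   complement. *)
exists (toL2 f - k); split.
  split; first exact: L2valP.
  move=> u Ku; have := hk _ (Kmodel_toL2 Ku); rewrite sdotE toL2K //.
  exact: Kmodel_L2.
move=> u [Lu hu]; have := hu k (proj2 (KmodelP k) Kk).
rewrite -[u]toL2K // -sdotE sdotC => /(congr1 (@conjc R)).
rewrite cconjK rmorph0 sdotE => <-; rewrite !ipE; congr cint; apply/funext => t.
by rewrite L2valD L2valN toL2K // opprB addrC subrK.
Qed.

(** The projections [p] and [q] are chosen independently, so they add up to [f] only a.e. The
    remainder [f - p - q] is orthogonal to [p] and to [f - q], hence to itself. *)
Lemma orthproj_pythagoras (f : R -> R[i]) : L2 f ->
  aeq f (fun t => orthproj (Kmodel th) f t + orthproj (ocompl (Kmodel th)) f t) /\
  l2norm f ^+ 2 = l2norm (orthproj (Kmodel th) f) ^+ 2 +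
    l2norm (orthproj (ocompl (Kmodel th)) f) ^+ 2.
Proof.
move=> Lf; have [Kp op] := orthproj_inner Lf; have [[Lq Kq] oq] := orthproj_ocompl Lf.
set p := orthproj _ _ in Kp op *; set q := orthproj _ _ in Lq Kq oq *.
have Lp := Kmodel_L2 Kp.
have e0 : snorm (toL2 f - toL2 p - toL2 q) = 0.
  have h1 : sdot (toL2 f - toL2 p - toL2 q) (toL2 p) = 0.
    rewrite sdotBl; have := op p Kp; have := Kq p Kp.
    rewrite -[ip q p]/(ip q p) => e1 e2; rewrite !sdotE !toL2K //.
    rewrite (_ : ip _ _ = ip (fun t => f t - p t) p).
      by rewrite e1 e2 subr0.
    by rewrite !ipE; congr cint; apply/funext => t; rewrite L2valD L2valN !toL2K.
  have Kd : ocompl (Kmodel th) (toL2 f - toL2 p).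
    split; first exact: L2valP.
    move=> u Ku; rewrite -(op u Ku) !ipE; congr cint; apply/funext => t.
    by rewrite L2valD L2valN !toL2K.
  have Kd' : ocompl (Kmodel th) (toL2 f - toL2 p - toL2 q).
    split; first exact: L2valP.
    move=> u Ku; have Lu := Kmodel_L2 Ku; rewrite -[u]toL2K // -sdotE sdotBl.
    by rewrite !sdotE !toL2K // Kd.2 // Kq // subr0.
  have h2 := oq _ Kd'.
  have h3 : sdot (toL2 f - toL2 q) (toL2 f - toL2 p - toL2 q) = 0.
    rewrite sdotE -h2 !ipE; congr cint; apply/funext => t.
    by rewrite !L2valD !L2valN !toL2K.
  apply/eqP; rewrite -sqrf_eq0 snorm2; apply/eqP.
  have -> : toL2 f - toL2 p - toL2 q = (toL2 f - toL2 q) - toL2 p by rewrite addrAC.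
  rewrite [X in sdot X _]addrC sdotDl sdotNl.
  rewrite addrAC in h1.
  have -> : toL2 f - toL2 q - toL2 p = toL2 f - toL2 p - toL2 q by rewrite addrAC.
  by rewrite h3 sdotC addrAC h1 rmorph0 oppr0 addr0.
split.
  have : snorm (toL2 f - (toL2 p + toL2 q)) = 0 by rewrite opprD addrA.
  move=> /aeqP h; apply: ae_imp h _ => t Dt.
  by rewrite L2valD !toL2K.
have sf : snorm (toL2 f) = snorm (toL2 p + toL2 q).
  apply/eqP; rewrite eq_le; apply/andP; split.
    apply: le_trans (snorm_le_dist _ (toL2 p + toL2 q)) _.
    by rewrite opprD addrA e0 add0r.
  apply: le_trans (snorm_le_dist _ (toL2 f)) _.
  by rewrite snormBC opprD addrA e0 add0r.
have := snormD2 (toL2 p) (toL2 q); rewrite -sf.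
have -> : sdot (toL2 p) (toL2 q) = 0.
  by rewrite sdotC sdotE !toL2K // Kq // rmorph0.
by rewrite !snormE !toL2K //= mulr0 addr0.
Qed.

End ModelSpace.

(** * The unitary operator of a model space *)

Section ClarkUnitary.
Variables (R : realType) (th : R -> R[i]).
Hypothesis inn : inner_fun th.
Hypothesis th0 : at0 th = 0.
Implicit Types (f g h : L2t R).
Local Notation en := (@en R).
Local Notation chi := (@chi R).
Local Notation cchi := (@cchi R).
Local Notation tv := (tv th).
Local Notation Ks := (Ks th).
Let bth := bdd_inner inn.
Let bc := @bdd_chi R.
Let bcc := @bdd_cchi R.

Definition cth : L2t R := Mul cchi tv.

Definition Uop f : L2t R := Mul chi f + sdot f cth *: (en 0 - tv).

(** Since [sdot f (en 0)] is [f(0)], this is the backward shift of [f] plus [f(0)] times [cth]. *)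
Definition Vop f : L2t R := Mul cchi f - sdot f (en 0) *: Mul cchi (en 0 - tv).

Definition Cop f : L2t R := Mul th (Mul cchi (Cj f)).

Lemma sdot_en_self n : sdot (en n) (en n) = 1.
Proof. by rewrite sdot_en eqxx. Qed.

Lemma sdot_tv_en0 : sdot tv (en 0) = 0.
Proof.
rewrite -th0 /at0 -fourierE; congr (fourier _ 0).
by apply/funext => t; rewrite tvE.
Qed.

Lemma sdot_en0_tv : sdot (en 0) tv = 0.
Proof. by rewrite sdotC sdot_tv_en0 rmorph0. Qed.

Lemma sdot_tv_tv : sdot tv tv = 1.
Proof. by rewrite (tv_Mul inn) sdot_inner // sdot_en. Qed.

Lemma H2s_cth : H2s cth.
Proof.
move=> n n0; rewrite sdot_cchi chi_en.
have [->|n1] := eqVneq (n + 1) 0; first exact: sdot_tv_en0.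
by apply: (H2s_tv inn); lia.
Qed.

Lemma chi_cth : Mul chi cth = tv.
Proof. exact: Mul_chi_cchi. Qed.

(** Up to conjugation this is the mean of [theta h], that is its value at 0. It vanishes because
    [theta = chi cth] with [cth] in [H^2], which is where [theta(0) = 0] enters. *)
Lemma sdot_en0_Mul_th h : H2s h -> sdot (en 0) (Mul th h) = 0.
Proof.
move=> hh; have e0 : Cj (en 0) = en 0 by rewrite Cj_en oppr0.
rewrite sdotC -e0 Mul_Cj_swap // -(tv_Mul inn) -chi_cth.
by rewrite (H2s_mean_mul H2s_cth hh) rmorph0.
Qed.

Lemma Ks_sdot_tv f : Ks f -> sdot f tv = 0.
Proof. by move=> [_ of_]; rewrite (tv_Mul inn) of_ //; exact: (H2s_en R 0). Qed.

Lemma Ks_en0 : Ks (en 0).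
Proof. by split; [exact: (H2s_en R 0)|exact: sdot_en0_Mul_th]. Qed.

Lemma H2s_cchi h : H2s h -> H2s (Mul cchi (h - sdot h (en 0) *: en 0)).
Proof.
move=> hh n n0; rewrite sdot_cchi chi_en sdotBl sdotZl sdot_en.
have [->|n1] := eqVneq (n + 1) 0; first by rewrite mulr1 subrr.
by rewrite hh ?mulr0 ?subr0 //; lia.
Qed.

Lemma MulB (z : R -> R[i]) f g : bdd z -> Mul z (f - g) = Mul z f - Mul z g.
Proof.
move=> bz; have := Mul_lin (-1) g f bz.
by rewrite !scaleN1r ![- _ + _]addrC.
Qed.

Lemma MulZ (z : R -> R[i]) (a : R[i]) f : bdd z -> Mul z (a *: f) = a *: Mul z f.
Proof.
by move=> bz; apply: L2t_eq => t; rewrite L2valZ !MulE // L2valZ mulrCA.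
Qed.

Lemma Mul_swap (z w : R -> R[i]) f : bdd z -> bdd w -> Mul z (Mul w f) = Mul w (Mul z f).
Proof. by move=> bz bw; apply: L2t_eq => t; rewrite !MulE // mulrCA. Qed.

(** Only the constant term of [h] counts, because [conj(chi) (h - h(0))] is again in [H^2]. The
    value is the one that [sdot f cth *: tv] gives, which explains the subtraction of [tv] in
    [Uop]. *)
Lemma sdot_chi_Mul_th f h : Ks f -> H2s h ->
  sdot (Mul chi f) (Mul th h) = conjc (sdot h (en 0)) * sdot f cth.
Proof.
move=> [_ of_] hh; set c := sdot h (en 0).
rewrite sdot_chi Mul_swap //.
have -> : Mul cchi h = Mul cchi (h - c *: en 0) + c *: Mul cchi (en 0).
  by rewrite MulB // MulZ // subrK.
have -> : Mul th (Mul cchi (h - c *: en 0) + c *: Mul cchi (en 0)) =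
    c *: cth + Mul th (Mul cchi (h - c *: en 0)).
  by rewrite addrC Mul_lin // Mul_swap // /cth (tv_Mul inn).
by rewrite sdotDr sdotZr of_ ?addr0 //; exact: H2s_cchi.
Qed.

Lemma sdot_tv_Mul_th h : sdot tv (Mul th h) = conjc (sdot h (en 0)).
Proof. by rewrite (tv_Mul inn) sdot_inner // sdotC. Qed.

Lemma Ks_Uop f : Ks f -> Ks (Uop f).
Proof.
move=> Kf; have [hf of_] := Kf; split.
  have sH := subspace_H2s R.
  rewrite /Uop; apply: (subspaceD sH); first exact: H2s_chi.
  apply: (subspaceZ _ sH); apply: (subspaceB sH); [exact: (H2s_en R 0)|exact: H2s_tv].
move=> h hh; rewrite sdotDl sdotZl sdotBl sdot_chi_Mul_th //.
by rewrite sdot_en0_Mul_th // sdot_tv_Mul_th; ring.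
Qed.

Lemma Uop_lin a f g : Uop (a *: f + g) = a *: Uop f + Uop g.
Proof.
rewrite /Uop Mul_lin // sdotDl sdotZl; move: (en 0 - tv) => d.
by rewrite scalerDl scalerDr -scalerA addrACA.
Qed.

Lemma sdot_chi_en0 f : H2s f -> sdot (Mul chi f) (en 0) = 0.
Proof. by move=> hf; rewrite sdot_chi cchi_en hf. Qed.

(** With [c_f = (f, cth)], each of the two cross terms equals [- c_f conj(c_g)]. They cancel the
    last term, because [1] and [theta] are orthonormal and so [||1 - theta||^2 = 2]. *)
Lemma sdot_Uop f g : Ks f -> Ks g -> sdot (Uop f) (Uop g) = sdot f g.
Proof.
move=> [hf of_] [hg og].
have cf (h : L2t R) : sdot (Mul chi h) tv = sdot h cth by rewrite sdot_chi.
have ct (h : L2t R) : sdot tv (Mul chi h) = conjc (sdot h cth) by rewrite sdotC cf.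
have c1 : sdot (en 0) (Mul chi g) = 0 by rewrite sdotC sdot_chi_en0 // rmorph0.
rewrite /Uop sdotDl !sdotDr sdotZl sdotZr sdotZr sdotZl !sdotBl !sdotBr.
rewrite sdot_chichi cf ct c1 sdot_chi_en0 // sdot_en0_tv sdot_tv_en0 sdot_tv_tv.
by rewrite sdot_en_self; ring.
Qed.

Lemma Uop_Vop f : Ks f -> Uop (Vop f) = f.
Proof.
move=> Kf; rewrite /Uop /Vop MulB // MulZ // !Mul_chi_cchi.
rewrite sdotBl sdotZl sdot_cchi chi_cth Ks_sdot_tv // sdot_cchi chi_cth.
rewrite sdotBl sdot_en0_tv sdot_tv_tv !sub0r mulrN1 opprK.
by rewrite subrK.
Qed.

Lemma sdot_Uop_en0 f : Ks f -> sdot (Uop f) (en 0) = sdot f cth.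
Proof.
move=> [hf _]; rewrite sdotDl sdotZl sdot_chi_en0 // sdotBl sdot_tv_en0 sdot_en_self.
by rewrite subr0 mulr1 add0r.
Qed.

Lemma Vop_Uop f : Ks f -> Vop (Uop f) = f.
Proof.
move=> Kf; rewrite /Vop sdot_Uop_en0 // /Uop.
rewrite (addrC (Mul chi f)) Mul_lin // Mul_cchi_chi.
by rewrite addrAC subrr add0r.
Qed.

Lemma Ks_Vop f : Ks f -> Ks (Vop f).
Proof.
move=> Kf; have [hf of_] := Kf; split.
  move=> n n0; rewrite sdotBl sdotZl !sdot_cchi chi_en sdotBl sdot_en.
  have [->|n1] := eqVneq (n + 1) 0.
    by rewrite sdot_tv_en0 subr0 mulr1 subrr.
  have n2 : n + 1 < 0 by lia.
  by rewrite hf // (H2s_tv inn) // subrr mulr0 subrr.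
move=> h hh; rewrite sdotBl sdotZl !sdot_cchi Mul_swap // of_; last exact: H2s_chi.
rewrite sdotBl sdot_en0_Mul_th; last exact: H2s_chi.
by rewrite sdot_tv_Mul_th sdot_chi_en0 // rmorph0 subrr mulr0 subrr.
Qed.

Lemma CopE f t : Cop f t = th t * (cchi t * conjc (f t)).
Proof. by rewrite /Cop MulE // MulE // CjE. Qed.

Lemma UopE f t : Uop f t = chi t * f t + sdot f cth * (1 - th t).
Proof. by rewrite /Uop L2valD L2valZ L2valD L2valN MulE // enE mul0r ecirc0 tvE. Qed.

Lemma VopE f t : Vop f t = cchi t * f t - sdot f (en 0) * (cchi t * (1 - th t)).
Proof.
rewrite /Vop L2valD L2valN L2valZ MulE // MulE // L2valD L2valN.
by rewrite enE mul0r ecirc0 tvE.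
Qed.

Lemma Cop_lin a f g : Cop (a *: f + g) = conjc a *: Cop f + Cop g.
Proof. by rewrite /Cop Cj_lin !Mul_lin. Qed.

Lemma snorm_chi f : snorm (Mul chi f) = snorm f.
Proof. by rewrite /snorm sdot_chichi. Qed.

Lemma Uop_null f g : snorm (f - g) = 0 -> snorm (Uop f - Uop g) = 0.
Proof.
move=> h; have -> : Uop f - Uop g = Uop (f - g).
  have := Uop_lin (-1) g f; rewrite !scaleN1r ![- _ + _]addrC => ->.
  by rewrite addrC.
by rewrite /Uop sdot_eq0_norm // scale0r addr0 snorm_chi.
Qed.

(* Multiplication by th turns conj(th) into 1 almost everywhere; this is where
   Cop V = U Cop comes from. *)
Lemma Cop_Vop f : snorm (Cop (Vop f) - Uop (Cop f)) = 0.
Proof.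
apply/aeqP; apply: ae_imp (inner_unimod inn) _ => t Dt ht.
have cc : sdot (Cop f) cth = conjc (sdot f (en 0)).
  have -> : sdot (Cop f) cth = sdot (Cj f) (en 0).
    by rewrite /Cop /cth Mul_swap // sdot_cchi Mul_chi_cchi (tv_Mul inn) sdot_inner.
  by rewrite sdotC sdot_Cjr Cj_en oppr0.
rewrite UopE !CopE VopE cc; have hc := chiK t.
have hk : conjc (cchi t) = chi t by rewrite /cchi cconjK.
have e : conjc (cchi t * f t - sdot f (en 0) * (cchi t * (1 - th t))) =
  chi t * conjc (f t) - conjc (sdot f (en 0)) * (chi t * (1 - conjc (th t))).
  by rewrite cconjB !cconjM hk cconjB cconj1.
rewrite e; move: (conjc (f t)) (conjc (sdot f (en 0))) => x y.
move: (conjc (th t)) ht => z; move: (th t) => w zw.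
move: (cchi t) (chi t) hc => p q pq {e hk cc}.
transitivity ((p * q) * (w * x) - y * ((p * q) * (w - z * w))); first by ring.
have -> : q * (w * (p * x)) = p * q * (w * x) by ring.
by rewrite zw pq; ring.
Qed.

Definition clark k : L2t R := iter k Uop (en 0).

Lemma Ks_clark k : Ks (clark k).
Proof. by elim: k => [|k IH]; [exact: Ks_en0|exact: Ks_Uop]. Qed.

Lemma span_clark_Uop s : span clark s -> span clark (Uop s).
Proof.
move=> hs; apply: (hs (fun s => span clark (Uop s))).
  split.
    have -> : Uop 0 = 0.
      have := Uop_lin 1 0 0; rewrite !scale1r addr0 => /eqP.
      by rewrite -subr_eq0 opprD addNKr oppr_eq0 => /eqP.
    exact: (subspace_span clark).1.
  by move=> a f g hf hg; rewrite Uop_lin; apply: (subspace_span clark).2.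
by move=> k; exact: (@span_base _ _ clark k.+1).
Qed.

(** If [chi^k = s + theta r] and [c = (s, cth)], then [chi s = U s - c (1 - theta)], hence
    [chi^(k+1) = (U s - c) + theta (c + chi r)]. *)
Lemma en_clark (k : nat) : exists s r, [/\ span clark s, H2s r & en k = s + Mul th r].
Proof.
elim: k => [|k [s [r [hs hr e]]]].
  exists (en 0), 0; split; [exact: (@span_base _ _ clark 0)|exact: (subspace_H2s R).1|].
  have := MulZ 0 0 bth; rewrite !scale0r => ->; by rewrite addr0.
have sS := subspace_span clark.
exists (Uop s - sdot s cth *: clark 0), (sdot s cth *: en 0 + Mul chi r); split.
- apply: (subspaceB sS); first exact: span_clark_Uop.
  by apply: (subspaceZ _ sS); exact: (@span_base _ _ clark 0).
- by apply: (subspace_H2s R).2; [exact: (H2s_en R 0)|exact: H2s_chi].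
- have -> : en k.+1 = Mul chi (en k) by rewrite chi_en -addn1.
  have -> : Mul th (sdot s cth *: en 0 + Mul chi r) = sdot s cth *: tv + Mul chi (Mul th r).
    by rewrite Mul_lin // -(tv_Mul inn) [Mul th (Mul chi r)]Mul_swap.
  rewrite e -[s in LHS]scale1r Mul_lin // scale1r /Uop scalerBr /clark /=.
  rewrite -[_ + _ - _]addrA [_ - _ - _]addrAC subrr add0r.
  by rewrite addrA subrK.
Qed.

(** The vector [1] is cyclic for [U]: an element of the model space orthogonal to its orbit is
    orthogonal to [theta H^2] as well, hence to every power of [chi]. *)
Lemma clark_dense f : Ks f -> sclosure (span clark) f.
Proof.
apply: dense_of_orth; [exact: subspace_Ks|exact: sclosed_Ks|exact: subspace_span|..].
  by move=> g hg; apply: hg; [exact: subspace_Ks|exact: Ks_clark].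
move=> w [hw ow] osp; apply: fourier_unique => n.
case: (ltP n 0) => [|n0]; first exact: hw.
case: n n0 => [k _|k]; last by lia.
have [s [r [hs hr ->]]] := en_clark k.
by rewrite sdotDr osp // ow // addr0.
Qed.

(** [chi f - c theta] with [c = (f, cth)] lies in the model space and differs from [chi f] by a
    vector orthogonal to it. It is therefore the compressed shift of [f], up to the null set left
    open by the choice in [orthproj]. *)
Lemma Uth_Uop (f : R -> R[i]) : Kmodel th f -> aeq (Uth th f) (Uop (toL2 f)).
Proof.
move=> Kf; have Lf := Kmodel_L2 Kf; have Kf' := Kmodel_toL2 inn Kf.
pose F := toL2 f; pose c := sdot F cth.
have Lcf : L2 (fun s => chi s * f s) by apply: L2_bddM.
have [Kp op] := orthproj_inner inn Lcf.
set p := orthproj _ _ in Kp op; have Lp := Kmodel_L2 Kp.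
have Kp' := Kmodel_toL2 inn Kp.
have Kq : Ks (Mul chi F - c *: tv).
  split; first by apply: (subspaceB (subspace_H2s R)); [apply: H2s_chi; exact: Kf'.1|
    apply: (subspaceZ _ (subspace_H2s R)); exact: H2s_tv].
  move=> h hh; rewrite sdotBl sdotZl sdot_chi_Mul_th // sdot_tv_Mul_th -/c.
  by rewrite mulrC subrr.
have n0 : snorm (toL2 p - (Mul chi F - c *: tv)) = 0.
  set d := toL2 p - _; have Kd : Ks d by exact: (subspaceB (subspace_Ks th)).
  apply/eqP; rewrite -sqrf_eq0 snorm2; apply/eqP.
  have de : d = c *: tv - (Mul chi F - toL2 p) by rewrite /d !opprB addrCA.
  rewrite {1}de sdotBl sdotZl [sdot tv d]sdotC Ks_sdot_tv // rmorph0 mulr0 sub0r.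
  have := op d (proj2 (KmodelP inn d) Kd).
  rewrite (_ : ip _ _ = sdot (Mul chi F - toL2 p) d) => [->|]; first by rewrite oppr0.
  rewrite sdotE !ipE; congr cint; apply/funext => t.
  by rewrite L2valD L2valN MulE // /F !toL2K.
have cE : ip f (fun s => (chi s)^*%C * th s) = c.
  rewrite /c sdotE !ipE; congr cint; apply/funext => t.
  by rewrite /F toL2K // /cth MulE // tvE.
move/aeqP: n0 => n0; apply: ae_imp n0 _ => t Dt.
rewrite toL2K // /Uth -/p cE => ->.
have FE : F t = f t by rewrite /F toL2K.
rewrite UopE -/F -/c L2valD L2valN L2valZ MulE // (tvE inn) FE /Defs.one mulr1.
by rewrite mulrBr mulr1 addrA addrAC.
Qed.

Lemma Kmodel_Uth (f : R -> R[i]) : Kmodel th f -> Kmodel th (Uth th f).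
Proof.
move=> Kf; have Lf := Kmodel_L2 Kf.
have Lcf : L2 (fun s => chi s * f s) by apply: L2_bddM.
have [Kp _] := orthproj_inner inn Lcf; have Lp := Kmodel_L2 Kp.
set p := orthproj _ _ in Kp Lp.
pose F := toL2 p + ip f (fun s => (chi s)^*%C * th s) *: en 0.
have -> : Uth th f = F.
  apply/funext => t; rewrite /F L2valD L2valZ enE mul0r ecirc0 toL2K //.
apply/(KmodelP inn); apply: (subspaceD (subspace_Ks th)); first exact: Kmodel_toL2.
by apply: (subspaceZ _ (subspace_Ks th)); exact: Ks_en0.
Qed.

Lemma Vop_lin a f g : Vop (a *: f + g) = a *: Vop f + Vop g.
Proof.
rewrite /Vop Mul_lin // sdotDl sdotZl; move: (Mul cchi (en 0 - tv)) => d.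
by rewrite scalerDl scalerBr -scalerA opprD addrACA.
Qed.

Lemma Cop_en0 : Cop (en 0) = cth.
Proof. by rewrite /Cop /cth Cj_en oppr0 Mul_swap // (tv_Mul inn). Qed.

Lemma Vop_en0 : Vop (en 0) = cth.
Proof.
by rewrite /Vop sdot_en_self scale1r MulB // opprB addrCA subrr addr0.
Qed.

Lemma Cop_iter_Vop n f : snorm (Cop (iter n Vop f) - iter n Uop (Cop f)) = 0.
Proof.
elim: n => [|n IH]; first by rewrite subrr snorm0.
apply/eqP; rewrite eq_le snorm_ge0 andbT.
apply: le_trans (ler_snorm_dist _ (Uop (Cop (iter n Vop f))) _) _.
by rewrite Cop_Vop add0r Uop_null.
Qed.

(** [C 1] and [V 1] are both [cth], so [C V^(n+1) 1 = U^(n+1) V 1 = U^n 1]: the exponent drops by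
    one. *)
Lemma Cop_iter_Vop_en0 n : snorm (Cop (iter n.+1 Vop (en 0)) - clark n) = 0.
Proof.
have <- : iter n.+1 Uop (Cop (en 0)) = clark n.
  by rewrite Cop_en0 -Vop_en0 iterSr Uop_Vop //; exact: Ks_en0.
exact: Cop_iter_Vop.
Qed.

Lemma iter_Vop_clark n k : (k <= n)%N -> iter n Vop (clark k) = iter (n - k) Vop (en 0).
Proof.
elim: k n => [|k IH] n; first by rewrite subn0.
case: n => // n kn; rewrite iterSr /= Vop_Uop; first exact: IH.
exact: Ks_clark.
Qed.

Lemma Ks_iter_Vop n f : Ks f -> Ks (iter n Vop f).
Proof. by move=> Kf; elim: n => //= n IH; exact: Ks_Vop. Qed.

Lemma Ks_iter_Uop n f : Ks f -> Ks (iter n Uop f).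
Proof. by move=> Kf; elim: n => //= n IH; exact: Ks_Uop. Qed.

Lemma iter_Uop_Vop n f : Ks f -> iter n Uop (iter n Vop f) = f.
Proof.
move=> Kf; elim: n => // n IH; rewrite [LHS]iterSr /= Uop_Vop //.
exact: Ks_iter_Vop.
Qed.

Lemma iter_Uop_sum n D (a : nat -> R[i]) (v : nat -> L2t R) :
  iter n Uop (\sum_(k < D) a k *: v k) = \sum_(k < D) a k *: iter n Uop (v k).
Proof.
have U0 : Uop 0 = 0 by rewrite /Uop sdot0l scale0r addr0; have := MulZ 0 0 bc; rewrite !scale0r.
elim: D => [|D IH].
  by rewrite !big_ord0; elim: n => //= n ->.
rewrite !big_ord_recr /= -IH addrC [RHS]addrC.
by elim: n {IH} => //= n ->; rewrite Uop_lin.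
Qed.

Lemma iter_Vop_sum n D (a : nat -> R[i]) (v : nat -> L2t R) :
  iter n Vop (\sum_(k < D) a k *: v k) = \sum_(k < D) a k *: iter n Vop (v k).
Proof.
have V0 : Vop 0 = 0.
  by rewrite /Vop sdot0l scale0r subr0; have := MulZ 0 0 bcc; rewrite !scale0r.
elim: D => [|D IH].
  by rewrite !big_ord0; elim: n => //= n ->.
rewrite !big_ord_recr /= -IH addrC [RHS]addrC.
by elim: n {IH} => //= n ->; rewrite Vop_lin.
Qed.

Lemma Cop_sum D (a : nat -> R[i]) (v : nat -> L2t R) :
  Cop (\sum_(k < D) a k *: v k) = \sum_(k < D) conjc (a k) *: Cop (v k).
Proof.
elim: D => [|D IH].
  rewrite !big_ord0; apply: L2t_eq => t.
  by rewrite CopE L2val0 rmorph0 !mulr0.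
by rewrite !big_ord_recr /= -IH addrC [RHS]addrC Cop_lin.
Qed.

(** [V^n U^k 1 = V^(n-k) 1], which [Cop] sends to [U^(n-k-1) 1]. The condition [D <= n] keeps all
    these exponents nonnegative. *)
Lemma Cop_iter_Vop_sum n D (a : nat -> R[i]) : (D <= n)%N ->
  snorm (Cop (iter n Vop (\sum_(k < D) a k *: clark k)) -
    \sum_(k < D) conjc (a k) *: clark (n - k.+1)) = 0.
Proof.
move=> Dn; rewrite iter_Vop_sum (Cop_sum D a (fun k => iter n Vop (clark k))).
rewrite -sumrB; apply/eqP; rewrite eq_le snorm_ge0 andbT.
apply: le_trans (ler_snorm_sum _ _ _) _; rewrite big1 // => k _.
have kn : (k < n)%N by apply: leq_trans Dn.
rewrite -scalerBr snormZ iter_Vop_clark; last exact: ltnW.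
have -> : (n - k)%N = (n - k.+1).+1 by lia.
by rewrite Cop_iter_Vop_en0 mulr0.
Qed.

Lemma normc_Cop f : {ae mu, forall t, I01 R t -> normc (Cop f t) ^+ 2 = normc (f t) ^+ 2}.
Proof.
apply: ae_imp (inner_unimod inn) _ => t Dt ht; rewrite CopE.
have h (x : R[i]) : normc x ^+ 2 = 1 -> normc x = 1.
  by move=> hx; apply/eqP; rewrite -(@eqrXn2 _ 2) ?normc_ge0 // hx expr1n.
have h1 : normc (th t) = 1.
  apply: h; apply: complexI; rewrite -mulc_conj mulrC; exact: ht.
have h2 : normc (cchi t) = 1 by rewrite /cchi normc_conj normc_ecirc.
by rewrite normcM h1 mul1r normcM h2 mul1r normc_conj.
Qed.

End ClarkUnitary.

(** * Mean ergodic theorem and Wiener's lemma *)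

Section Averages.
Variable R : realType.
Implicit Types a b : nat -> R.

(** Convergence of the averages to 0, meant for nonnegative sequences: only the upper bound is
    recorded, and without a division by [L]. *)
Definition avg0 a := forall d : R, 0 < d -> exists L0, forall L, (L0 <= L)%N ->
  \sum_(k < L) a k <= d * L%:R.

Lemma avg0_le a b : (forall k, a k <= b k) -> avg0 b -> avg0 a.
Proof.
move=> ab hb d d0; have [L0 h] := hb d d0; exists L0 => L hL.
by apply: le_trans (h L hL); apply: ler_sum => i _.
Qed.

Lemma avg0D a b : avg0 a -> avg0 b -> avg0 (fun k => a k + b k).
Proof.
move=> ha hb d d0; have d2 : 0 < d / 2 by lra.
have [L0 h0] := ha _ d2; have [L1 h1] := hb _ d2; exists (maxn L0 L1) => L.
rewrite geq_max => /andP[l0 l1]; rewrite big_split /=.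
have := h0 L l0; have := h1 L l1; lra.
Qed.

Lemma avg0_sum r (a : nat -> nat -> R) : (forall i, avg0 (a i)) ->
  avg0 (fun k => \sum_(i < r) a i k).
Proof.
move=> ha; elim: r => [|r IH].
  by move=> d d0; exists 0%N => L _; rewrite big1 ?mulr_ge0 ?ler0n ?ltW // => i _; rewrite big_ord0.
by apply: avg0_le (avg0D IH (ha r)) => k; rewrite big_ord_recr.
Qed.

(** Sum [2 d a <= a^2 + d^2], using squares that are at most [d^2] in the mean. *)
Lemma avg0_sqr a : avg0 (fun k => a k ^+ 2) -> avg0 a.
Proof.
move=> ha d d0; have d2 : 0 < d ^+ 2 by rewrite exprn_gt0.
have [L0 h] := ha _ d2; exists L0 => L hL.
have : \sum_(k < L) (2 * d) * a k <= \sum_(k < L) (a k ^+ 2 + d ^+ 2).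
  by apply: ler_sum => i _; have := sqr_ge0 (a i - d); lra.
rewrite big_split /= -mulr_sumr sumr_const card_ord -[_ *+ L]mulr_natr.
move: (h L hL); set S := \sum_(k < L) a k; set T := \sum_(k < L) a k ^+ 2.
move=> h1 h2; have dd : 0 < 2 * d by lra.
rewrite -(ler_pM2l dd); lra.
Qed.

End Averages.

Section MeanErgodic.
Variables (R : realType) (H : semiHilbertType R) (K : H -> Prop) (U : H -> H).
Implicit Types (f g h : H) (s : R).
Hypothesis sK : is_subspace K.
Hypothesis cK : sclosed K.
Hypothesis U_lin : forall (a : R[i]) f g, U (a *: f + g) = a *: U f + U g.
Hypothesis K_U : forall f, K f -> K (U f).
Hypothesis U_iso : forall f g, K f -> K g -> sdot (U f) (U g) = sdot f g.
Hypothesis noeig : forall (s : R) f, K f ->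
  snorm (U f - ecirc s *: f) = 0 -> snorm f = 0.

(** The twist moves the possible eigenvalue [e(s)] of [U] to 1, so the absence of eigenvalues on the
    circle says that no [V s] has a fixed vector other than null ones. *)
Let V s f := ecirc (- s) *: U f.

Lemma twist_lin s (a : R[i]) f g : V s (a *: f + g) = a *: V s f + V s g.
Proof. by rewrite /V U_lin scalerDr !scalerA mulrC. Qed.

Lemma twistD s f g : V s (f + g) = V s f + V s g.
Proof. by have := twist_lin s 1 f g; rewrite !scale1r. Qed.

Lemma twist0 s : V s 0 = 0.
Proof.
by have := twistD s 0 0; rewrite addr0 => /eqP; rewrite -subr_eq0 opprD addNKr oppr_eq0 => /eqP. Qed.

Lemma twistB s f g : V s (f - g) = V s f - V s g.
Proof. by have := twist_lin s (-1) g f; rewrite !scaleN1r ![- _ + _]addrC. Qed.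

Lemma K_twist s f : K f -> K (V s f).
Proof. by move=> Kf; apply: subspaceZ => //; exact: K_U. Qed.

Lemma snorm_U f : K f -> snorm (U f) = snorm f.
Proof. by move=> Kf; rewrite /snorm U_iso. Qed.

Lemma snorm_twist s f : K f -> snorm (V s f) = snorm f.
Proof. by move=> Kf; rewrite snormZ normc_ecirc mul1r snorm_U. Qed.

Lemma K_iter_twist s n f : K f -> K (iter n (V s) f).
Proof. by move=> Kf; elim: n => //= n IH; exact: K_twist. Qed.

Lemma snorm_iter_twist s n f : K f -> snorm (iter n (V s) f) = snorm f.
Proof. by move=> Kf; elim: n => //= n IH; rewrite snorm_twist ?IH //; exact: K_iter_twist. Qed.

Lemma iter_twistD s n f g : iter n (V s) (f + g) = iter n (V s) f + iter n (V s) g.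
Proof. by elim: n => //= n ->; rewrite twistD. Qed.

(* von Neumann's argument: a vector of K orthogonal to all h - V h is fixed
   by V, hence null. *)
Lemma coboundary_dense s e (eps : R) : K e -> 0 < eps ->
  exists h, K h /\ snorm (e - (h - V s h)) < eps.
Proof.
move=> Ke eps0; pose M f := exists h, K h /\ f = h - V s h.
have sM : is_subspace M.
  split; first by exists 0; split; [exact: sK.1|rewrite twist0 subrr].
  move=> a f g [h [Kh ->]] [h' [Kh' ->]]; exists (a *: h + h').
  by split; [exact: sK.2|rewrite twist_lin scalerBr opprD addrACA].
have [||k [[k' [Kk' ->]] hk]] := @dense_of_orth R H K M sK cK sM _ _ e Ke eps eps0.
- by move=> f [h [Kh ->]]; apply: subspaceB => //; exact: K_twist.
- move=> w Kw ow.
  have h0 : sdot w (w - V s w) = 0 by apply: ow; exists w.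
  (* Orthogonality to its own coboundary gives [Re (w, V w) = ||w||^2], and [V] is isometric, so
     [||w - V w||^2 = 2 ||w||^2 - 2 ||w||^2]. *)
  have h1 : snorm (w - V s w) = 0.
    apply/eqP; rewrite -sqrf_eq0 snormB2 snorm_twist //.
    have : complex.Re (sdot w w) - complex.Re (sdot w (V s w)) = 0.
      by have := congr1 (@complex.Re R) h0; rewrite sdotBr cReD cReN.
    by rewrite -snorm2 => ?; apply/eqP; lra.
  apply: (noeig (s := s)) => //.
  have -> : U w - ecirc s *: w = (- ecirc s) *: (w - V s w).
    rewrite scalerBr scalerA mulNr [ecirc s * _]mulrC ecircNM scaleN1r opprK.
    by rewrite scaleNr addrC.
  by rewrite snormZ h1 mulr0.
by exists k'.
Qed.

Lemma near_normc_ecircB (s0 : R) (d : R) : 0 < d ->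
  \forall s \near s0, normc (ecirc (- s) - ecirc (- s0)) < d.
Proof.
move=> d0; have c1 := @continuous_cosM R (2 * pi) s0.
have c2 := @continuous_sinM R (2 * pi) s0.
have d2 : 0 < d / 2 by lra.
near=> s.
have h1 : `|cos (2 * pi * s0) - cos (2 * pi * s)| < d / 2.
  by near: s; move/cvgrPdist_lt: c1; apply.
have h2 : `|sin (2 * pi * s0) - sin (2 * pi * s)| < d / 2.
  by near: s; move/cvgrPdist_lt: c2; apply.
rewrite -(@ltr_pXn2r _ 2) ?nnegrE ?normc_ge0 ?ltW // sqr_normcE.
rewrite cReD cImD cReN cImN /= !mulrN !cosN !sinN.
move: h1 h2; rewrite !ltr_norml => /andP[a1 a2] /andP[b1 b2]; nra.
Unshelve. all: by end_near. Qed.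

(** An [h] that works for [s0] works for [s] near [s0], because [V s h - V s0 h] is a small multiple
    of [U h]. Compactness of [[0, 1]] then gives one bound [B] for all parameters. *)
Lemma coboundary_uniform e (eps : R) : K e -> 0 < eps -> exists B : R, forall s,
  0 <= s <= 1 -> exists h, [/\ K h, snorm h <= B & snorm (e - (h - V s h)) < eps].
Proof.
move=> Ke eps0; have e2 : 0 < eps / 2 by lra.
pose P (B s : R) := exists h, [/\ K h, snorm h <= B & snorm (e - (h - V s h)) < eps].
have := compact_near_coveringP (`[0%R, 1%R] : set R).
move=> [/(_ (@segment_compact R 0 1)) cov _].
have [|B [_ hB]] := cov R (pinfty_nbhs R) P _ _; last first.
  exists (B + 1) => s hs; apply: hB; rewrite ?ltrDl //= in_itv.
move=> s0 _; have [h [Kh hh]] := coboundary_dense s0 Ke e2.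
have nh := snorm_ge0 h.
have d0 : 0 < eps / 2 / (snorm h + 1) by rewrite divr_gt0 //; lra.
exists ([set s | normc (ecirc (- s) - ecirc (- s0)) < eps / 2 / (snorm h + 1)],
  [set B | snorm h < B]).
  by split => /=; [exact: near_normc_ecircB|apply: nbhs_pinfty_gt; exact: num_real].
move=> [s B] /= [hs hB]; exists h; split=> //; first exact: ltW.
have -> : e - (h - V s h) = (e - (h - V s0 h)) + (ecirc (- s) - ecirc (- s0)) *: U h.
  rewrite scalerBl -/(V s h) -/(V s0 h) !opprB -addrA; congr (_ + _).
  by rewrite [RHS]addrC subrKA.
apply: le_lt_trans (ler_snormD _ _) _.
rewrite snormZ snorm_U //.
have : normc (ecirc (- s) - ecirc (- s0)) * (snorm h + 1) < eps / 2.
  by rewrite -ltr_pdivlMr //; lra.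
have := normc_ge0 (ecirc (- s) - ecirc (- s0)); lra.
Qed.

(** Write [e = (h - V h) + r]: the coboundary telescopes to [h - V^N h], and each of the [N]
    iterates of [r] has norm [||r||]. *)
Lemma snorm_sum_iter_twist e s h N : K e -> K h ->
  snorm (\sum_(n < N) iter n (V s) e) <=
  2 * snorm h + N%:R * snorm (e - (h - V s h)).
Proof.
move=> Ke Kh; set r := e - _.
have Kr : K r by apply: subspaceB => //; apply: subspaceB => //; exact: K_twist.
have -> : \sum_(n < N) iter n (V s) e =
    (h - iter N (V s) h) + \sum_(n < N) iter n (V s) r.
  have -> : h - iter N (V s) h = \sum_(n < N) iter n (V s) (h - V s h).
    elim: N => [|N IH]; first by rewrite big_ord0 subrr.
    rewrite big_ord_recr /= -IH.
    have -> : iter N (V s) (h - V s h) = iter N (V s) h - V s (iter N (V s) h).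
      by elim: N {IH} => //= N ->; rewrite twistB.
    by rewrite addrA subrK.
  rewrite -big_split /=; apply: eq_bigr => n _.
  by rewrite -iter_twistD /r addrC subrK.
apply: le_trans (ler_snormD _ _) (lerD _ _).
  by apply: le_trans (ler_snormB _ _) _; rewrite snorm_iter_twist //; lra.
apply: le_trans (ler_snorm_sum _ _ _) _.
under eq_bigr do rewrite snorm_iter_twist //.
by rewrite sumr_const card_ord -[_ *+ N]mulr_natl.
Qed.

Section Orbit.
Variable e : H.
Hypothesis Ke : K e.

Local Notation u n := (iter n U e).

Lemma iter_twistE s n : iter n (V s) e = ecirc (n%:R * - s) *: u n.
Proof.
elim: n => [|n IH]; first by rewrite mul0r ecirc0 scale1r.
have UZ (a : R[i]) f : U (a *: f) = a *: U f.
  have U0 : U 0 = 0.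
    have := U_lin 1 0 0; rewrite !scale1r addr0 => /eqP.
    by rewrite -subr_eq0 opprD addNKr oppr_eq0 => /eqP.
  by have := U_lin a f 0; rewrite U0 !addr0.
by rewrite /= IH /V UZ scalerA -ecircD -[in RHS]natr1 mulrDl mul1r addrC.
Qed.

Lemma K_orbit n : K (u n).
Proof. by elim: n => //= n IH; exact: K_U. Qed.

Lemma sdot_orbit n m : sdot (u (n + m)) (u m) = sdot (u n) e.
Proof.
elim: m => [|m IH]; first by rewrite addn0.
by rewrite addnS /= U_iso //; exact: K_orbit.
Qed.

(** The function [s |-> ||sum_(n < N) e(-n s) U^n e||^2], expanded so that its Fourier coefficients
    can be read off. *)
Definition fejer N : L2t R :=
  \sum_(n < N) \sum_(m < N) sdot (u n) (u m) *: en R (Posz m - Posz n).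

Lemma fejerE N s : fejer N s = (snorm (\sum_(n < N) iter n (V s) e) ^+ 2)%:C%C.
Proof.
rewrite -sdotff.
have sumE (I : finType) (F : I -> L2t R) t : (\sum_i F i) t = \sum_i F i t.
  by apply: (big_morph (fun f : L2t R => f t)) => // x y; rewrite L2valD.
rewrite /fejer sumE sdot_suml; apply: eq_bigr => n _.
rewrite sumE sdot_sumr; apply: eq_bigr => m _.
rewrite !iter_twistE sdotZl sdotZr L2valZ enE -ecircN mulrA -ecircD mulrC.
by congr (ecirc _ * _); rewrite rmorphB /=; ring.
Qed.

(** The frequency [-k] comes from the pairs with [n = m + k]. There are [N - k] of them, and each
    contributes [(U^k e, e)] by isometry. *)
Lemma sdot_fejer N k : (k <= N)%N ->
  sdot (fejer N) (en R (- Posz k)) = (N - k)%:R * sdot (u k) e.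
Proof.
move=> kN; rewrite /fejer exchange_big sdot_suml.
transitivity (\sum_(m < N) ((m + k < N)%N : nat)%:R * sdot (u k) e).
  apply: eq_bigr => m _; rewrite sdot_suml.
  under eq_bigr do rewrite sdotZl sdot_en.
  have ->: \sum_(i < N) sdot (u i) (u m) * ((m%:Z - i%:Z == - k%:Z) : nat)%:R =
      \sum_(i < N | i == (m + k)%N :> nat) sdot (u k) e.
    rewrite [RHS]big_mkcond; apply: eq_bigr => i _.
    have -> : (m%:Z - i%:Z == - k%:Z) = (i == (m + k)%N :> nat) by lia.
    case: eqP => [->|_]; last by rewrite mulr0.
    by rewrite mulr1 addnC sdot_orbit.
  case: ltnP => h.
    rewrite (big_pred1 (Ordinal h)) ?mul1r //.
  rewrite big1 ?mul0r // => i /eqP ei; have := ltn_ord i; rewrite ei ltnNge h //.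
rewrite -mulr_suml -natr_sum; congr (_%:R * _).
have -> : (\sum_(m < N) ((m + k < N)%N : nat) = \sum_(m < N | (m < N - k)%N) 1)%N.
  rewrite [RHS]big_mkcond; apply: eq_bigr => m _.
  by rewrite ltn_subRL addnC; case: ifP.
by rewrite -(big_ord_widen N (fun=> 1%N)) ?leq_subr // sum1_card card_ord.
Qed.

Lemma snorm_fejer N S : (forall s, 0 <= s <= 1 ->
    snorm (\sum_(n < N) iter n (V s) e) ^+ 2 <= S) ->
  snorm (fejer N) ^+ 2 <= S * (N%:R * snorm e ^+ 2).
Proof.
move=> hS; have /L2P[sr si] := L2valP (fejer N).
have fe : complex.Re (sdot (fejer N) (en R 0)) = N%:R * snorm e ^+ 2.
  have -> : en R 0 = en R (- Posz 0) by rewrite oppr0.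
  rewrite sdot_fejer // subn0 -[iter 0 U e]/e sdotff.
  have -> : (N%:R : R[i]) = (N%:R : R)%:C%C by rewrite rmorph_nat.
  by rewrite cReM /= mulr0 subr0.
have fi : complex.Re (sdot (fejer N) (en R 0)) =
    Rintegral mu (I01 R) (fun t => complex.Re (fejer N t)).
  rewrite sdotE ipE; apply: eq_Rintegral => t _.
  by rewrite enE mul0r ecirc0 cconj1 mulr1.
rewrite -fe fi -RintZ; last exact: sqint_rintegrable.
rewrite snorm2 sdotE Re_ip; apply: Rint_le.
- exact: rintegrableD sr.2 si.2.
- apply: rintegrableZ; exact: sqint_rintegrable.
move=> t; rewrite /I01 /= in_itv /= => ht; rewrite fejerE /= expr0n addr0 expr2.
by rewrite ler_wpM2r ?sqr_ge0 // hS.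
Qed.

(* Wiener's lemma: the square of the norm of the Fejer-type kernel is at most
   its maximum times its integral, because the kernel is nonnegative. *)
Theorem wiener : avg0 (fun k => normc (sdot (u k) e) ^+ 2).
Proof.
move=> d d0; set E := snorm e ^+ 2; have E0 : 0 <= E by exact: sqr_ge0.
(* The final estimate is [8 E c], which this choice keeps below [d]. *)
pose c := d / (8 * (E + 1)); have c0 : 0 < c by rewrite divr_gt0 //; lra.
pose eps := Num.sqrt c / 2.
have sc0 : 0 < Num.sqrt c by rewrite sqrtr_gt0.
have eps0 : 0 < eps by rewrite divr_gt0.
have [B hB] := coboundary_uniform Ke eps0.
(* From here on [B <= L eps], so a sum over [2 L] terms has norm at most
   [2 B + 2 L eps <= 4 L eps = 2 L sqrt c]. *)
pose L0 := (Num.trunc (`|B| / eps)).+1.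
exists L0 => L hL.
have BL : B <= L%:R * eps.
  have : `|B| / eps <= L%:R.
    by apply: le_trans (ltW (truncnS_gt _)) _; rewrite ler_nat.
  by rewrite ler_pdivrMr // => h; apply: le_trans h; exact: ler_norm.
have Lpos : (0 < L)%N by apply: leq_trans hL.
have Lr : 0 < L%:R :> R by rewrite ltr0n.
(* Length [2 L] makes the weight [2 L - k] at least [L] for all [k < L]. *)
have := @snorm_fejer (2 * L) ((2 * L%:R * Num.sqrt c) ^+ 2).
have h s : 0 <= s <= 1 -> snorm (\sum_(n < 2 * L) iter n (V s) e) ^+ 2 <=
    (2 * L%:R * Num.sqrt c) ^+ 2.
  move=> hs; have [h [Kh nh he]] := hB s hs.
  have sL : 0 <= 2 * L%:R * Num.sqrt c by rewrite !mulr_ge0 // ltW.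
  rewrite ler_pXn2r ?nnegrE ?snorm_ge0 //.
  apply: le_trans (snorm_sum_iter_twist s (2 * L) Ke Kh) _.
  have : (2 * L)%:R * snorm (e - (h - V s h)) <= (2 * L)%:R * eps.
    by rewrite ler_wpM2l // ltW.
  rewrite natrM /eps in BL *; lra.
move=> /(_ h) {h} hf.
have := @bessel R (L2t R) (fun k => en R (- Posz k)) (fejer (2 * L)) L.
have on i j : (i < L)%N -> (j < L)%N ->
    sdot (en R (- Posz i)) (en R (- Posz j)) = (i == j)%:R.
  by move=> _ _; rewrite sdot_en eqr_opp.
move=> /(_ on) hb.
have : \sum_(k < L) L%:R ^+ 2 * normc (sdot (u k) e) ^+ 2 <=
   (2 * L%:R * Num.sqrt c) ^+ 2 * ((2 * L)%:R * E).
  apply: le_trans hf; apply: le_trans hb; apply: ler_sum => k _.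
  have kL := ltn_ord k.
  rewrite sdot_fejer; last by lia.
  rewrite normcM exprMn ler_wpM2r ?sqr_ge0 // ler_pXn2r ?nnegrE ?normc_ge0 //.
  have -> : ((2 * L - k)%:R : R[i]) = ((2 * L - k)%:R : R)%:C%C by rewrite rmorph_nat.
  by rewrite normc_real ger0_norm // ler_nat; lia.
rewrite -mulr_sumr; set S := \sum_(k < L) _.
rewrite !exprMn sqr_sqrtr ?(ltW c0) // natrM.
have L2 : 0 < L%:R ^+ 2 :> R by rewrite exprn_gt0.
have -> : 2 ^+ 2 * L%:R ^+ 2 * c * (2 * L%:R * E) = L%:R ^+ 2 * (8 * E * c * L%:R) :> R by ring.
rewrite ler_pM2l // => hS; apply: le_trans hS _.
rewrite ler_wpM2r ?(ltW Lr) //.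
have cE : c * (8 * (E + 1)) = d by rewrite /c divfK // gt_eqF //; lra.
lra.
Qed.

End Orbit.

End MeanErgodic.

(** * Averages along orbits *)

Section CompactOrbit.
Variables (R : realType) (H : semiHilbertType R) (K : H -> Prop) (U : H -> H).
Hypothesis U_iso : forall f g, K f -> K g -> sdot (U f) (U g) = sdot f g.
Hypothesis K_U : forall f, K f -> K (U f).
Variable e : H.
Hypothesis Ke : K e.
Local Notation u n := (iter n U e).
Local Notation g k := (normc (sdot (u k) e)).

(** The entries depend only on [|n - m|] in modulus, and each value of that difference occurs at
    most [2 N] times. The induction adds one row and one column. *)
Lemma gram_sum_le N : \sum_(n < N) \sum_(m < N) normc (sdot (u n) (u m)) <=
  2 * N%:R * \sum_(k < N) g k.
Proof.
have so n m : sdot (u (n + m)) (u m) = sdot (u n) e by apply: (sdot_orbit (K := K)).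
elim: N => [|N IH]; first by rewrite !big_ord0 mulr0.
have hN : \sum_(m < N) normc (sdot (u N) (u m)) = \sum_(k < N) g k.+1.
  rewrite (reindex_inj rev_ord_inj); apply: eq_bigr => i _ /=.
  have {1}-> : N = (i.+1 + (N - i.+1))%N by rewrite subnKC.
  by rewrite so.
have gS : \sum_(k < N.+1) g k = g 0%N + \sum_(k < N) g k.+1 by rewrite big_ord_recl.
have gS' : \sum_(k < N.+1) g k = \sum_(k < N) g k + g N by rewrite big_ord_recr.
have gN : 0 <= g N by exact: normc_ge0.
rewrite big_ord_recr /= big_ord_recr /= hN.
have -> : \sum_(i < N) \sum_(m < N.+1) normc (sdot (u i) (u m)) =
    \sum_(i < N) \sum_(m < N) normc (sdot (u i) (u m)) + \sum_(k < N) g k.+1.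
  rewrite -hN -big_split; apply: eq_bigr => i _; rewrite big_ord_recr /=.
  by rewrite [X in _ + normc X]sdotC normc_conj.
have -> : sdot (u N) (u N) = sdot e e by rewrite (so 0%N N).
have N0 : 0 <= N%:R :> R by rewrite ler0n.
have h : N%:R * (\sum_(k < N) g k) <= N%:R * (\sum_(k < N.+1) g k).
  by rewrite ler_wpM2l // gS' lerDl.
have g0 : normc (sdot e e) = g 0%N by [].
have g00 : 0 <= g 0%N by exact: normc_ge0.
rewrite -[in leRHS]natr1 g0; move: IH h gS; rewrite -mulrA.
set A := \sum_(i < N) \sum_(m < N) _; set S := \sum_(k < N.+1) _; set S' := \sum_(k < N) _.
set S'' := \sum_(k < N) g k.+1.
by move=> h1 h2 h3; lra.
Qed.

(** [k n] stands for the image of [u n] under a compact operator: [k_bound] carries linearity and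
    boundedness, [k_tb] gives finite nets taken from the sequence itself, [wie] is Wiener's lemma
    for the orbit. *)
Variables (H' : semiHilbertType R) (k : nat -> H') (C : R).
Hypothesis C0 : 0 < C.
Hypothesis kC : forall n, snorm (k n) <= C.
Hypothesis k_bound : forall N (a : nat -> R[i]),
  snorm (\sum_(n < N) a n *: k n) <= C * snorm (\sum_(n < N) a n *: u n).
Hypothesis k_tb : forall eps : R, 0 < eps -> exists r, forall n, exists i,
  (i < r)%N /\ snorm (k n - k i) < eps.
Hypothesis wie : avg0 (fun k => g k ^+ 2).

(** A duality argument in place of an adjoint: with [c_n = conj (k n, y)], the sum of [|c_n|^2] is
    [Re (sum c_n k n, y)], at most [C ||y||] times [||sum c_n u n||]. The square of that last norm
    is bounded by the Gram sum, which is [o(N^2)]. *)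
Lemma avg0_functional (y : H') : avg0 (fun n => normc (sdot (k n) y) ^+ 2).
Proof.
pose Y := snorm y; have Y0 : 0 <= Y := snorm_ge0 y.
have ck n : normc (sdot (k n) y) <= C * Y.
  by apply: le_trans (cauchy_schwarz _ _) _; rewrite ler_wpM2r.
have hsum N : \sum_(n < N) normc (sdot (k n) y) ^+ 2 <=
    C * Y * snorm (\sum_(n < N) conjc (sdot (k n) y) *: u n).
  have e1 : \sum_(n < N) normc (sdot (k n) y) ^+ 2 =
      complex.Re (sdot (\sum_(n < N) conjc (sdot (k n) y) *: k n) y).
    rewrite sdot_suml Re_sum; apply: eq_bigr => n _.
    by rewrite sdotZl mulrC mulc_conj.
  rewrite e1; apply: le_trans (Re_sdot_le _ _) _.
  rewrite [leRHS]mulrAC ler_wpM2r //.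
  exact: (k_bound N (fun n => conjc (sdot (k n) y))).
have hgram N : snorm (\sum_(n < N) conjc (sdot (k n) y) *: u n) ^+ 2 <=
    (C * Y) ^+ 2 * (2 * N%:R * \sum_(j < N) g j).
  apply: le_trans (_ : (C * Y) ^+ 2 *
    (\sum_(n < N) \sum_(m < N) normc (sdot (u n) (u m))) <= _); last first.
    by rewrite ler_wpM2l ?sqr_ge0 // gram_sum_le.
  rewrite snorm2 sdot_suml; apply: le_trans (Re_le_normc _) _.
  apply: le_trans (normc_sum _ _ _) _; rewrite mulr_sumr; apply: ler_sum => n _.
  rewrite sdot_sumr; apply: le_trans (normc_sum _ _ _) _.
  rewrite mulr_sumr; apply: ler_sum => m _.
  rewrite sdotZl sdotZr mulrA normcM ler_wpM2r ?normc_ge0 //.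
  by rewrite normcM !normc_conj expr2 ler_pM ?normc_ge0.
(* The sum [S] will satisfy [S^2 <= 2 (C Y)^4 c L^2], which has to be at most [d^2 L^2]. *)
move=> d d0; pose c := d ^+ 2 / (2 * ((C * Y) ^+ 4 + 1)).
have CY : 0 <= C * Y by rewrite mulr_ge0 // ltW.
have CY4 : 0 <= (C * Y) ^+ 4 by rewrite exprn_ge0.
have c0 : 0 < c by rewrite divr_gt0 ?exprn_gt0 //; lra.
have [L0 hL0] := avg0_sqr wie c0; exists L0 => L hL.
have L0' : 0 <= L%:R :> R by rewrite ler0n.
set S := \sum_(n < L) _.
have S0 : 0 <= S by apply: sumr_ge0 => n _; rewrite sqr_ge0.
rewrite -(@ler_pXn2r _ 2) ?nnegrE ?mulr_ge0 ?(ltW d0) //.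
have hS := hsum L; have hG := hgram L; have hA := hL0 L hL.
rewrite -/S in hS.
have h1 : S ^+ 2 <= (C * Y) ^+ 2 * snorm (\sum_(n < L) conjc (sdot (k n) y) *: u n) ^+ 2.
  by rewrite -exprMn ler_pXn2r ?nnegrE // mulr_ge0 ?snorm_ge0.
apply: le_trans h1 _.
have h2 := ler_wpM2l (sqr_ge0 (C * Y)) hG; apply: le_trans h2 _.
have h3 : (C * Y) ^+ 2 * ((C * Y) ^+ 2 * (2 * L%:R * \sum_(j < L) g j)) <=
    (C * Y) ^+ 2 * ((C * Y) ^+ 2 * (2 * L%:R * (c * L%:R))).
  by do !rewrite ler_wpM2l ?sqr_ge0 ?mulr_ge0 //.
apply: le_trans h3 _.
have -> : (C * Y) ^+ 2 * ((C * Y) ^+ 2 * (2 * L%:R * (c * L%:R))) =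
  (2 * (C * Y) ^+ 4 * c) * L%:R ^+ 2 by ring.
rewrite [leRHS]exprMn ler_wpM2r ?sqr_ge0 //.
have : c * (2 * ((C * Y) ^+ 4 + 1)) = d ^+ 2 by rewrite /c divfK // gt_eqF //; lra.
lra.
Qed.

(* Approximating k n by one of finitely many k i reduces its norm to the
   functionals sdot _ (k i). *)
Theorem avg0_compact : avg0 (fun n => snorm (k n) ^+ 2).
Proof.
move=> d d0; pose eps := d / (2 * C); have eps0 : 0 < eps by rewrite divr_gt0 ?mulr_gt0.
have [r hr] := k_tb eps0.
have hk n : snorm (k n) ^+ 2 <= \sum_(i < r) normc (sdot (k n) (k i)) + d / 2.
  have [i [ir hi]] := hr n.
  have -> : snorm (k n) ^+ 2 = complex.Re (sdot (k n) (k i)) + complex.Re (sdot (k n) (k n - k i)).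
    by rewrite snorm2 sdotBr cReD cReN addrC subrK.
  apply: lerD.
    (* The index [i] varies with [n]; summing over all [i < r] gives one bound whose averages tend
       to 0. *)
    rewrite (bigD1 (Ordinal ir)) //=; apply: le_trans (Re_le_normc _) _.
    by rewrite lerDl; apply: sumr_ge0 => j _; exact: normc_ge0.
  apply: le_trans (Re_sdot_le _ _) _.
  have -> : d / 2 = C * eps by rewrite /eps; field; rewrite gt_eqF.
  by rewrite ler_pM ?snorm_ge0 // ltW.
have hs : avg0 (fun n => \sum_(i < r) normc (sdot (k n) (k i))).
  apply: (avg0_sum r (a := fun i n => normc (sdot (k n) (k i)))) => i.
  by apply: avg0_sqr; exact: avg0_functional.
have d2 : 0 < d / 2 by lra.
have [L0 hL0] := hs _ d2; exists L0 => L hL.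
apply: (@le_trans _ _ (\sum_(n < L) (\sum_(i < r) normc (sdot (k n) (k i)) + d / 2))).
  by apply: ler_sum => n _; exact: hk.
rewrite big_split /= sumr_const card_ord -[_ *+ L]mulr_natr.
have := hL0 L hL; lra.
Qed.

End CompactOrbit.

(** * Invariance of averages of bounded sequences under shifts *)

Section ShiftedAverages.
Variables (R : realType) (H : semiHilbertType R).

(** A shift by one replaces one term of the sum by another, whatever [N] is. *)
Lemma shift_sum_bound (b : nat -> R[i]) c s N : (forall n, normc (b n) <= c) ->
  normc (\sum_(n < N) b (n + s)%N - \sum_(n < N) b n) <= s%:R * (2 * c).
Proof.
move=> bc; elim: s => [|s IH].
  by rewrite mul0r; under eq_bigr do rewrite addn0; rewrite subrr normc0.
have -> : \sum_(n < N) b (n + s.+1)%N = \sum_(n < N) b (n + s)%N + (b (N + s)%N - b s).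
  elim: N {IH} => [|N IH]; first by rewrite !big_ord0 add0n subrr addr0.
  by rewrite !big_ord_recr /= IH addnS addSn !addrA [LHS]addrAC.
rewrite addrAC -[s.+1%:R]natr1 mulrDl mul1r.
apply: le_trans (le_normcD _ _) (lerD IH _).
apply: le_trans (le_normcD _ _) _; rewrite normcN.
have := bc (N + s)%N; have := bc s; lra.
Qed.

(* The (j, k) terms of the two quadratic forms differ by a shift by
   s - 1 - j - k of the sequence n |-> (v_(n+j), v_(n+k)). *)
Lemma reflected_average (v : nat -> H) (c : R) (D s : nat) (a : nat -> R[i]) :
  (forall n, snorm (v n) <= c) -> (2 * D <= s)%N ->
  exists C : R, forall N,
    \sum_(n < N) snorm (\sum_(k < D) conjc (a k) *: v (n + s - k.+1)%N) ^+ 2 <=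
    \sum_(n < N) snorm (\sum_(k < D) a k *: v (n + k)%N) ^+ 2 + C.
Proof.
move=> vc Ds; pose b j k n := sdot (v (n + j)%N) (v (n + k)%N).
pose w j k : R[i] := a j * conjc (a k).
have bc j k n : normc (b j k n) <= c ^+ 2.
  apply: le_trans (cauchy_schwarz _ _) _; rewrite expr2 ler_pM ?snorm_ge0 //.
have p1 n : snorm (\sum_(k < D) a k *: v (n + k)%N) ^+ 2 =
    complex.Re (\sum_(j < D) \sum_(k < D) w j k * b j k n).
  rewrite snorm2 sdot_suml; congr complex.Re; apply: eq_bigr => j _.
  by rewrite sdot_sumr; apply: eq_bigr => k _; rewrite sdotZl sdotZr mulrA.
have p2 n : snorm (\sum_(k < D) conjc (a k) *: v (n + s - k.+1)%N) ^+ 2 =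
    complex.Re (\sum_(j < D) \sum_(k < D) w j k * b j k (n + (s - j.+1 - k))%N).
  rewrite snorm2 sdot_suml; congr complex.Re.
  under eq_bigr do rewrite sdot_sumr.
  (* The reflection reverses the difference of the two indices and the conjugated coefficients swap
     their roles. After the exchange, the indices are [j] and [k] moved by [n + (s - j.+1 - k)], an
     exact subtraction since [2 D <= s]. *)
  rewrite exchange_big; apply: eq_bigr => j _; apply: eq_bigr => k _ /=.
  rewrite sdotZl sdotZr cconjK mulrA [conjc _ * _]mulrC /b /w.
  have jD := ltn_ord j; have kD := ltn_ord k.
  by congr (_ * sdot (v _) (v _)); lia.
exists (\sum_(j < D) \sum_(k < D) normc (w j k) * ((s - j.+1 - k)%:R * (2 * c ^+ 2))).
move=> N; rewrite -lerBlDl.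
under eq_bigr do rewrite p2; under [X in _ - X]eq_bigr do rewrite p1.
have -> : \sum_(n < N) complex.Re (\sum_(j < D) \sum_(k < D) w j k * b j k (n + (s - j.+1 - k))%N) -
    \sum_(n < N) complex.Re (\sum_(j < D) \sum_(k < D) w j k * b j k n) =
  complex.Re (\sum_(j < D) \sum_(k < D) w j k *
    (\sum_(n < N) b j k (n + (s - j.+1 - k))%N - \sum_(n < N) b j k n)).
  rewrite -!Re_sum -cReN -cReD; congr complex.Re.
  rewrite exchange_big [X in _ - X]exchange_big -sumrB; apply: eq_bigr => j _.
  rewrite exchange_big [X in _ - X]exchange_big -sumrB; apply: eq_bigr => k _.
  by rewrite -!mulr_sumr -mulrBr.
apply: le_trans (Re_le_normc _) _; apply: le_trans (normc_sum _ _ _) _.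
apply: ler_sum => j _; apply: le_trans (normc_sum _ _ _) _.
apply: ler_sum => k _; rewrite normcM ler_wpM2l ?normc_ge0 //.
exact: shift_sum_bound.
Qed.

End ShiftedAverages.

(** * Comparison of the two orbits *)

Section AlmostLinear.
Variables (R : realType) (H H' : semiHilbertType R).

Definition nulleq (G : semiHilbertType R) (f g : G) : Prop := snorm (f - g) = 0.

Lemma nulleq_refl (f : H) : nulleq f f.
Proof. by rewrite /nulleq subrr snorm0. Qed.

Lemma nulleq_sym (f g : H) : nulleq f g -> nulleq g f.
Proof. by rewrite /nulleq snormBC. Qed.

Lemma nulleq_trans (f g h : H) : nulleq f g -> nulleq g h -> nulleq f h.
Proof.
move=> fg gh; apply/eqP; rewrite eq_le snorm_ge0 andbT.
by apply: le_trans (ler_snorm_dist f g h) _; rewrite fg gh addr0.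
Qed.

Lemma nulleq_snorm (f g : H) : nulleq f g -> snorm f = snorm g.
Proof.
move=> fg; apply/eqP; rewrite eq_le; apply/andP; split.
  by apply: le_trans (snorm_le_dist f g) _; rewrite fg add0r.
by apply: le_trans (snorm_le_dist g f) _; rewrite snormBC fg add0r.
Qed.

Lemma nulleq_lin (a : R[i]) (f f' g g' : H) : nulleq f f' -> nulleq g g' ->
  nulleq (a *: f + g) (a *: f' + g').
Proof.
move=> ff gg; apply/eqP; rewrite eq_le snorm_ge0 andbT opprD addrACA -scalerBr.
by apply: le_trans (ler_snormD _ _) _; rewrite snormZ ff gg mulr0 addr0.
Qed.

Variable K : H -> Prop.

(* Linear and well defined up to null vectors: the shape in which bounded
   operators on spaces of a.e.-classes are given here. *)
Definition almost_linear (A : H -> H') : Prop :=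
  (forall (a : R[i]) f g, K f -> K g -> nulleq (A (a *: f + g)) (a *: A f + A g)) /\
  (forall f g, K f -> K g -> nulleq f g -> nulleq (A f) (A g)).

End AlmostLinear.

Section AlmostLinearTheory.
Variables (R : realType) (H H' : semiHilbertType R) (K : H -> Prop).
Hypothesis sK : is_subspace K.
Variable A : H -> H'.
Hypothesis lA : almost_linear K A.

Lemma almost_linear0 : snorm (A 0) = 0.
Proof.
have := lA.1 1 0 0 sK.1 sK.1; rewrite !scale1r addr0 /nulleq.
by rewrite opprD addrA subrr add0r snormN.
Qed.

Lemma almost_linearZ (a : R[i]) f : K f -> nulleq (A (a *: f)) (a *: A f).
Proof.
move=> Kf; have := lA.1 a f 0 Kf sK.1; rewrite addr0 => h.
apply: nulleq_trans h _; rewrite /nulleq addrC addrA addNr add0r.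
exact: almost_linear0.
Qed.

Lemma almost_linearB f g : K f -> K g -> nulleq (A (f - g)) (A f - A g).
Proof.
by move=> Kf Kg; have := lA.1 (-1) g f Kg Kf; rewrite !scaleN1r ![- _ + _]addrC.
Qed.

Lemma almost_linear_sum (u : nat -> H) (a : nat -> R[i]) N : (forall n, K (u n)) ->
  nulleq (A (\sum_(n < N) a n *: u n)) (\sum_(n < N) a n *: A (u n)).
Proof.
move=> Ku; elim: N => [|N IH].
  by rewrite !big_ord0 /nulleq subr0 almost_linear0.
rewrite !big_ord_recr /= addrC [X in nulleq _ X]addrC.
apply: nulleq_trans (lA.1 _ _ _ (Ku N) _) _.
  by apply: subspace_sum => // i _; exact: subspaceZ.
exact: nulleq_lin (nulleq_refl _) IH.
Qed.

(** Passes from the unit ball, where [opnorm] and [compact_op] look, to all vectors by scaling. A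
    null vector can be scaled by any [t] inside the ball, so its image is null. *)
Lemma almost_linear_bound C : 0 <= C ->
  (forall f, K f -> snorm f <= 1 -> snorm (A f) <= C) ->
  forall f, K f -> snorm (A f) <= C * snorm f.
Proof.
move=> C0 hC f Kf.
have key (t : R) : 0 < t -> t * snorm f <= 1 -> t * snorm (A f) <= C.
  move=> t0 tf; have nt : normc t%:C%C = t by rewrite normc_real gtr0_norm.
  have -> : t * snorm (A f) = snorm (A (t%:C%C *: f)).
    by rewrite (nulleq_snorm (almost_linearZ _ Kf)) snormZ nt.
  by apply: hC; [exact: subspaceZ|rewrite snormZ nt].
have := snorm_ge0 f; rewrite le_eqVlt => /orP[/eqP f0|f0].
  rewrite -f0 mulr0 leNgt; apply/negP => a0.
  have t0 : 0 < (C + 1) / snorm (A f) by rewrite divr_gt0 //; lra.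
  have := key _ t0; rewrite -f0 mulr0 ler01 divfK ?gt_eqF // => /(_ isT); lra.
have t0 : 0 < (snorm f)^-1 by rewrite invr_gt0.
have := key _ t0; rewrite mulVf ?gt_eqF // lexx => /(_ isT).
by rewrite mulrC ler_pdivrMr.
Qed.

End AlmostLinearTheory.

Lemma almost_linear_iter (R : realType) (H : semiHilbertType R) (K : H -> Prop)
  (A : H -> H) n : almost_linear K A -> (forall f, K f -> K (A f)) ->
  is_subspace K ->
  almost_linear K (iter n A) /\ forall f, K f -> K (iter n A f).
Proof.
move=> lA KA sK; elim: n => [|n [[IH1 IH2] KI]] /=.
  by split=> //; split=> // a f g _ _; exact: nulleq_refl.
split; last by move=> f Kf; apply: KA; exact: KI.
split=> [a f g Kf Kg|f g Kf Kg fg]; last by apply: lA.2; [exact: KI|exact: KI|exact: IH2].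
apply: nulleq_trans (lA.1 a _ _ (KI _ Kf) (KI _ Kg)).
apply: lA.2; [apply: KI; exact: sK.2|apply: sK.2; exact: KI|exact: IH1].
Qed.

(** * Transfer of operators on functions to operators on [L2t] *)

Section Lift.
Variables (R : realType) (p q : R -> R[i]).
Hypotheses (innp : inner_fun p) (innq : inner_fun q).
Variable A : (R -> R[i]) -> (R -> R[i]).
Hypothesis bA : bounded_op (Kmodel p) (Kmodel q) A.

Definition lift (f : L2t R) : L2t R := toL2 (A f).

Lemma liftE f : Ks p f -> L2val (lift f) = A f.
Proof.
move=> Kf; rewrite /lift toL2K //; apply: (@Kmodel_L2 _ q).
by apply: bA.1; exact/(KmodelP innp).
Qed.

Lemma Ks_lift f : Ks p f -> Ks q (lift f).
Proof.
by move=> Kf; apply/(KmodelP innq); rewrite liftE //; apply: bA.1; exact/(KmodelP innp).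
Qed.

Lemma lift_almost_linear : almost_linear (Ks p) lift.
Proof.
have [_ [bq [bl _]]] := bA; split=> [a f g Kf Kg|f g Kf Kg /aeqP fg].
  apply/aeqP; rewrite liftE; last exact: (subspace_Ks p).2.
  have := bl a f g (proj2 (KmodelP innp _) Kf) (proj2 (KmodelP innp _) Kg).
  move=> h; apply: ae_imp h _ => t Dt.
  by rewrite L2valD L2valZ !liftE.
apply/aeqP; rewrite !liftE //.
by apply: bq => //; exact/(KmodelP innp).
Qed.

Lemma lift_bounded : exists C, 0 < C /\ forall f, Ks p f -> snorm (lift f) <= C * snorm f.
Proof.
have [_ [_ [_ [C hC]]]] := bA; exists (`|C| + 1); split; first by rewrite ltr_wpDl.
move=> f Kf; rewrite snormE liftE //; apply: le_trans (hC f _) _.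
  exact/(KmodelP innp).
rewrite -snormE ler_wpM2r ?snorm_ge0 //.
by apply: le_trans (ler_norm C) _; rewrite lerDl.
Qed.

End Lift.

Lemma iter_lift (R : realType) (q : R -> R[i]) (A : (R -> R[i]) -> (R -> R[i])) :
  inner_fun q -> bounded_op (Kmodel q) (Kmodel q) A ->
  forall n f, Ks q f -> L2val (iter n (lift A) f) = iter n A f.
Proof.
move=> iq bA n f Kf.
have KI k : Ks q (iter k (lift A) f).
  by elim: k => //= k; exact: (Ks_lift iq iq bA).
by elim: n => //= n IH; rewrite (liftE iq bA) // IH.
Qed.

Lemma le_chain_absurd (F : realFieldType) (x y z p q : F) :
  x <= z + y -> z < 1 -> y + 1 <= p -> p <= q -> q < x -> False.
Proof. by move=> *; lra. Qed.

(** The arithmetic that ends [X'_backward]: [x] and [y] are [||X V^m f||] and [||X f||], [S] and [P]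
    the sums of squares over the backward and forward orbits, [C] the defect of the shifts. *)
Lemma average_squeeze (F : realFieldType) (L x M S P C d y e : F) :
  0 < L -> 0 <= M ^+ 2 -> L * x ^+ 2 <= M ^+ 2 * S -> S <= P + C ->
  P <= L * (M ^+ 2 * y ^+ 2) + d * L -> C <= d * L -> M ^+ 2 * d <= e / 2 ->
  x ^+ 2 <= (M ^+ 2 * y) ^+ 2 + e.
Proof.
move=> L0 M0 h1 h2 h3 h4 h5; rewrite -(ler_pM2l L0).
have h6 : M ^+ 2 * S <= M ^+ 2 * (L * (M ^+ 2 * y ^+ 2) + d * L + d * L).
  by rewrite ler_wpM2l //; lra.
have h7 : L * (M ^+ 2 * d) <= L * (e / 2) by rewrite ler_wpM2l // ltW.
apply: le_trans h1 _; apply: le_trans h6 _; lra.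
Qed.

(** * The operators [X], [K], [T] and the estimate for the powers of the inverse of [T] *)

Section Main.
Variables (R : realType) (th om g : R -> R[i]) (T Tinv : (R -> R[i]) -> (R -> R[i])).
Hypothesis inth : inner_fun th.
Hypothesis inom : inner_fun om.
Hypothesis th0 : at0 th = 0.
Hypothesis noeig : forall (lam : R[i]) f, Kmodel th f ->
  aeq (Uth th f) (fun t => lam * f t) -> aeq f (fun _ => 0).
Hypothesis Lg : forall f, Kmodel th f -> L2 (fun t => g t * f t).
Local Notation X := (fun f : R -> R[i] => orthproj (Kmodel om) (fun t => g t * f t)).
Local Notation KK := (fun f : R -> R[i] => orthproj (ocompl (Kmodel om)) (fun t => g t * f t)).
Hypothesis bX : bounded_op (Kmodel th) (Kmodel om) X.
Hypothesis dX : forall h, Kmodel om h -> forall eps : R, 0 < eps ->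
  exists f, Kmodel th f /\ l2norm (fun t => X f t - h t) < eps.
Hypothesis cKK : compact_op (Kmodel th) KK.
Hypothesis bT : bounded_op (Kmodel om) (Kmodel om) T.
Hypothesis bTi : bounded_op (Kmodel om) (Kmodel om) Tinv.
Hypothesis TTi : forall f, Kmodel om f -> aeq (Tinv (T f)) f /\ aeq (T (Tinv f)) f.
Hypothesis XU : forall f, Kmodel th f -> aeq (X (Uth th f)) (T (X f)).

Implicit Types f h y : L2t R.
Local Notation Kt := (Ks th).
Local Notation Ko := (Ks om).
Local Notation U := (Uop th).
Local Notation V := (Vop th).
Local Notation X' := (lift X).
Local Notation T' := (lift T).
Local Notation Ti' := (lift Tinv).

Let sKt := subspace_Ks th.
Let sKo := subspace_Ks om.
Let lX := lift_almost_linear inth bX.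
Let lT := lift_almost_linear inom bT.
Let lTi := lift_almost_linear inom bTi.

Definition Gop f : L2t R := toL2 (fun t => g t * f t).
Definition K' f : L2t R := toL2 (KK f).

Lemma GopE f t : Kt f -> Gop f t = g t * f t.
Proof. by move=> Kf; rewrite /Gop toL2K //; apply: Lg; exact/(KmodelP inth). Qed.

Lemma Gop_almost_linear : almost_linear Kt Gop.
Proof.
split=> [a f h Kf Kh|f h Kf Kh /aeqP fh].
  rewrite (_ : Gop _ = a *: Gop f + Gop h); first exact: nulleq_refl.
  apply: L2t_eq => t; rewrite L2valD L2valZ !GopE //; last exact: sKt.2.
  by rewrite L2valD L2valZ mulrDr mulrCA.
by apply/aeqP; apply: ae_imp fh _ => t Dt e; rewrite !GopE // e.
Qed.

Lemma L2_KK f : Kt f -> L2 (KK f).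
Proof.
by move=> Kf; have [[L _] _] := orthproj_ocompl inom (Lg (proj2 (KmodelP inth f) Kf)).
Qed.

(** The norm identity serves twice: it gives [||X f|| <= ||g f||] on the backward orbit, and on the
    forward orbit it shows that the excess is exactly the compact part. *)
Lemma Gop_split f : Kt f -> nulleq (Gop f) (X' f + K' f) /\
  snorm (Gop f) ^+ 2 = snorm (X' f) ^+ 2 + snorm (K' f) ^+ 2.
Proof.
move=> Kf; have Kf' := proj2 (KmodelP inth f) Kf.
have [h1 h2] := orthproj_pythagoras inom (Lg Kf'); split.
  apply/aeqP; apply: ae_imp h1 _ => t Dt.
  by rewrite GopE // L2valD (liftE inth bX) // /K' toL2K //; exact: L2_KK.
rewrite !snormE (liftE inth bX) // /K' toL2K; last exact: L2_KK.
by rewrite -h2 /Gop toL2K //; exact: Lg.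
Qed.

Lemma nulleq_K' f : Kt f -> nulleq (K' f) (Gop f - X' f).
Proof.
move=> Kf; have [h _] := Gop_split Kf; rewrite /nulleq -snormN !opprB.
by rewrite -[X in snorm X](_ : Gop f - (X' f + K' f) = _) // opprD addrA.
Qed.

(** The choice in [orthproj] gives no linearity by itself; it is inherited from multiplication by
    [g] and from [X], whose difference is [K'] up to null vectors. *)
Lemma K'_almost_linear : almost_linear Kt K'.
Proof.
have nB (f f' h h' : L2t R) : nulleq f f' -> nulleq h h' -> nulleq (f - h) (f' - h').
  by move=> e1 e2; have := nulleq_lin (-1) e2 e1; rewrite !scaleN1r ![- _ + _]addrC.
split=> [a f h Kf Kh|f h Kf Kh fh].
  apply: nulleq_trans (nulleq_K' (sKt.2 _ _ _ Kf Kh)) _.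
  apply: nulleq_trans (nB _ _ _ _ (Gop_almost_linear.1 a f h Kf Kh) (lX.1 a f h Kf Kh)) _.
  apply: nulleq_sym; apply: nulleq_trans (nulleq_lin a (nulleq_K' Kf) (nulleq_K' Kh)) _.
  rewrite scalerBr addrACA -opprD; exact: nulleq_refl.
apply: nulleq_trans (nulleq_K' Kf) _; apply: nulleq_sym.
apply: nulleq_trans (nulleq_K' Kh) _; apply: nulleq_sym.
by apply: nB; [exact: Gop_almost_linear.2|exact: lX.2].
Qed.

(** Otherwise some [u n] in the unit ball have [||K' (u n)|| > n], and no subsequence of these
    images is Cauchy. *)
Lemma K'_bounded : exists C, 0 < C /\ forall f, Kt f -> snorm (K' f) <= C * snorm f.
Proof.
suff [C [C0 hC]] : exists C, 0 <= C /\
    forall f, Kt f -> snorm f <= 1 -> snorm (K' f) <= C.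
  exists (C + 1); split; first by lra.
  move=> f Kf; apply: le_trans (almost_linear_bound sKt K'_almost_linear C0 hC Kf) _.
  by rewrite ler_wpM2r ?snorm_ge0 //; lra.
apply: contrapT => hn.
have /choice[u hu] (n : nat) : exists f, Kt f /\ snorm f <= 1 /\ n%:R < snorm (K' f).
  apply: contrapT => h; apply: hn; exists n%:R; split=> // f Kf nf.
  by rewrite leNgt; apply/negP => lt; apply: h; exists f.
have [|phi [phi_incr hphi]] := @cKK (fun n => u n : R -> R[i]).
  move=> n; have [Ku [nu _]] := hu n; split=> //; exact/(KmodelP inth).
have phi_ge n : (n <= phi n)%N.
  by elim: n => // n IH; apply: leq_ltn_trans IH (phi_incr n).
have [N hN] := hphi 1 ltr01.
have [n [nN nT]] : exists n, (N <= n)%N /\ snorm (K' (u (phi N))) + 1 <= n%:R.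
  exists (maxn N (Num.trunc (snorm (K' (u (phi N))) + 1)).+1); rewrite leq_maxl; split=> //.
  by apply: le_trans (ltW (truncnS_gt _)) _; rewrite ler_nat leq_maxr.
have := hN n N nN (leqnn N).
have [Ku1 [_ l1]] := hu (phi n); have [Ku2 [_ l2]] := hu (phi N).
have -> : (fun t => KK (u (phi n)) t - KK (u (phi N)) t) =
    L2val (K' (u (phi n)) - K' (u (phi N))).
  by apply/funext => t; rewrite L2valD L2valN /K' !toL2K //; exact: L2_KK.
rewrite -snormE => lt1.
have nphi : n%:R <= (phi n)%:R :> R by rewrite ler_nat.
exact: le_chain_absurd (snorm_le_dist _ _) lt1 nT nphi l1.
Qed.

Lemma K'_totally_bounded (u : nat -> L2t R) :
  (forall n, Kt (u n) /\ snorm (u n) <= 1) ->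
  forall eps : R, 0 < eps -> exists r, forall n, exists i,
    (i < r)%N /\ snorm (K' (u n) - K' (u i)) < eps.
Proof.
move=> hu eps e0; apply: contrapT => hn.
have /choice[v hv] (r : nat) : exists n, forall i, (i < r)%N ->
    eps <= snorm (K' (u n) - K' (u i)).
  apply: contrapT => h; apply: hn; exists r => n; apply: contrapT => h'.
  apply: h; exists n => i ir; rewrite leNgt; apply/negP => lt; apply: h'.
  by exists i.
(* [v r] is at distance at least [eps] from all indices below [r], so each new index is separated
   from all earlier ones; this also forces [s] to increase. *)
pose s := fix s j := if j is j'.+1 then v (s j').+1 else v 0%N.
have s_incr j : (s j < s j.+1)%N.
  rewrite ltnNge; apply/negP => h; have := hv (s j).+1 (s j.+1) h.
  by rewrite subrr snorm0 leNgt e0.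
have s_ltn i j : (i < j)%N -> (s i < s j)%N.
  elim: j => // j IH; rewrite ltnS leq_eqVlt => /orP[/eqP->|/IH h]; first exact: s_incr.
  exact: ltn_trans h (s_incr j).
have [|phi [phi_incr hphi]] := @cKK (fun n => u (s n) : R -> R[i]).
  by move=> n; have [Ku nu] := hu (s n); split=> //; exact/(KmodelP inth).
have [N hN] := hphi eps e0.
have := hN N.+1 N (leqnSn N) (leqnn N).
have -> : (fun t => KK (u (s (phi N.+1))) t - KK (u (s (phi N))) t) =
    L2val (K' (u (s (phi N.+1))) - K' (u (s (phi N)))).
  apply/funext => t; rewrite L2valD L2valN /K' !toL2K //; apply: L2_KK; exact: (hu _).1.
rewrite -snormE ltNge => /negP; apply.
have := phi_incr N; case: (phi N.+1) => // j pj; rewrite /=.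
apply: hv; rewrite ltnS; move: pj; rewrite ltnS leq_eqVlt => /orP[/eqP->//|h].
exact: ltnW (s_ltn _ _ h).
Qed.

Lemma noeig_Uop (s : R) f : Kt f -> snorm (U f - ecirc s *: f) = 0 -> snorm f = 0.
Proof.
move=> Kf h; have Kf' := proj2 (KmodelP inth f) Kf.
have : aeq f (fun _ => 0).
  apply: (@noeig (ecirc s) f Kf'); apply: aeq_trans (Uth_Uop inth Kf') _.
  by rewrite toL2_val; move/aeqP: h.
move=> h'; rewrite -(subr0 f); apply/aeqP; apply: ae_imp h' _ => t Dt ->.
by rewrite L2val0.
Qed.

Lemma avg0_K' f : Kt f -> snorm f <= 1 -> avg0 (fun n => snorm (K' (iter n U f)) ^+ 2).
Proof.
move=> Kf f1; have [C [C0 hC]] := K'_bounded.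
have KU h : Kt h -> Kt (U h) by exact: Ks_Uop.
have Uiso := sdot_Uop inth th0.
have KI n : Kt (iter n U f) by exact: Ks_iter_Uop.
have nI n : snorm (iter n U f) <= 1.
  by elim: n => //= n IH; rewrite /snorm Uiso.
apply: (@avg0_compact R _ Kt U Uiso KU f Kf _ (fun n => K' (iter n U f)) C C0).
- by move=> n; apply: le_trans (hC _ (KI n)) _; rewrite ler_piMr // ltW.
- move=> N a; rewrite -(nulleq_snorm (almost_linear_sum sKt K'_almost_linear a N KI)).
  by apply: hC; apply: subspace_sum => // i _; exact: subspaceZ.
- by apply: K'_totally_bounded.
- exact: (@wiener R _ Kt U sKt (@sclosed_Ks _ th) (Uop_lin th) KU Uiso noeig_Uop f Kf).
Qed.

Lemma X'_Uop f : Kt f -> nulleq (X' (U f)) (T' (X' f)).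
Proof.
move=> Kf; have Kf' := proj2 (KmodelP inth f) Kf.
have KU := Ks_Uop inth th0 Kf.
apply/aeqP; rewrite (liftE inth bX) // (liftE inom bT); last exact: (Ks_lift inth inom bX).
rewrite (liftE inth bX) //; apply: aeq_trans (XU Kf').
have [_ [bq _]] := bX; apply: bq.
- exact/(KmodelP inth).
- exact: (Kmodel_Uth inth th0).
- by apply: aeq_sym; have := Uth_Uop inth Kf'; rewrite toL2_val.
Qed.

Let iT n := almost_linear_iter n lT (Ks_lift inom inom bT) sKo.
Let iTi n := almost_linear_iter n lTi (Ks_lift inom inom bTi) sKo.
Let KX f : Kt f -> Ko (X' f) := @Ks_lift _ _ _ inth inom _ bX f.

Lemma X'_iter_Uop n f : Kt f -> nulleq (X' (iter n U f)) (iter n T' (X' f)).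
Proof.
move=> Kf; elim: n => [|n IH]; first exact: nulleq_refl.
have Kn : Kt (iter n U f) by exact: Ks_iter_Uop.
apply: nulleq_trans (X'_Uop Kn) _ => /=; apply: lT.2 => //; first exact: KX.
by apply: (iT n).2; exact: KX.
Qed.

Lemma iter_Tinv_T n y : Ko y -> nulleq (iter n Ti' (iter n T' y)) y.
Proof.
move=> Ky; elim: n => [|n IH]; first exact: nulleq_refl.
rewrite iterSr /=; set z := iter n T' y.
have Kz : Ko z by apply: (iT n).2.
have KTz : Ko (T' z) by exact: (Ks_lift inom inom bT).
apply: nulleq_trans _ IH; apply: (iTi n).1.2 => //.
  exact: (Ks_lift inom inom bTi).
apply/aeqP; rewrite (liftE inom bTi) // (liftE inom bT) //.
by have [] := TTi (proj2 (KmodelP inom z) Kz).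
Qed.

Variable M : R.
Hypothesis M0 : 0 <= M.
Hypothesis TM : forall n y, Ko y -> snorm (iter n T' y) <= M * snorm y.

Lemma X'_orbit_le n f : Kt f -> snorm (X' (iter n U f)) <= M * snorm (X' f).
Proof. by move=> Kf; rewrite (nulleq_snorm (X'_iter_Uop n Kf)); apply/TM/KX. Qed.

Lemma snorm_Gop_mod f h : Kt f -> Kt h ->
  {ae mu, forall t, I01 R t -> normc (f t) ^+ 2 = normc (h t) ^+ 2} ->
  snorm (Gop f) = snorm (Gop h).
Proof.
move=> Kf Kh fh; apply: snorm_ae; apply: ae_imp fh _ => t Dt e.
by rewrite !GopE // !normcM !exprMn e.
Qed.

(* Since |C f| = |f|, the norms |g V^n f| along the backward orbit are those of
   a reflected combination of the vectors g U^k 1. *)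
Lemma snorm_Gop_Vop n D (a : nat -> R[i]) : (D <= n)%N ->
  snorm (Gop (iter n V (\sum_(k < D) a k *: clark th k))) =
  snorm (\sum_(k < D) conjc (a k) *: Gop (clark th (n - k.+1))).
Proof.
move=> Dn; set f := \sum_(k < D) _.
have Kc := Ks_clark inth th0.
have Kf : Kt f by apply: subspace_sum => // i _; exact: subspaceZ.
have KVf : Kt (iter n V f) by exact: Ks_iter_Vop.
set w := \sum_(k < D) conjc (a k) *: clark th (n - k.+1).
have Kw : Kt w by apply: subspace_sum => // i _; exact: subspaceZ.
have := almost_linear_sum (A := Gop) sKt Gop_almost_linear
    (u := fun k => clark th (n - k.+1)) (fun k => conjc (a k)) D (fun k => Kc _).
move=> /nulleq_snorm <-; apply: snorm_Gop_mod => //.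
have := Cop_iter_Vop_sum inth th0 a Dn => /aeqP e1.
apply: ae_imp2 e1 (normc_Cop inth (iter n V f)) _ => t Dt e2 <-.
by rewrite e2.
Qed.

(** The bound on [snorm f] reflects [compact_op], which speaks of sequences in the unit ball;
    [X'_backward_span] removes it by scaling. *)
Lemma X'_backward m f : span (clark th) f -> snorm f <= 1 ->
  snorm (X' (iter m V f)) <= M ^+ 2 * snorm (X' f).
Proof.
move=> sf f1; have [D [a fE]] := spanP sf.
have Kc := Ks_clark inth th0.
have Kf : Kt f by rewrite fE; apply: subspace_sum => // i _; exact: subspaceZ.
pose v k := Gop (clark th k).
have [CX [CX0 hX]] := lift_bounded inth bX.
have [CK [CK0 hK]] := K'_bounded.
have nc k : snorm (clark th k) = snorm (clark th 0).
  by elim: k => //= k <-; rewrite /snorm (sdot_Uop inth th0).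
have vc k : snorm (v k) <= (CX + CK) * snorm (clark th 0).
  have [e _] := Gop_split (Kc k); rewrite /v (nulleq_snorm e) -(nc k).
  apply: le_trans (ler_snormD _ _) _.
  by rewrite mulrDl; apply: lerD; [exact: hX|exact: hK].
(* The shift [2 D + m] meets the demand of [reflected_average], and it allows to write
   [V^m f = U^(n + 2 D) V^(n + 2 D + m) f] for every [n]. *)
have Ds : (2 * D <= 2 * D + m)%N by rewrite leq_addr.
have [C hC] := reflected_average a vc Ds.
have P n : snorm (\sum_(k < D) a k *: v (n + k)%N) ^+ 2 <=
    M ^+ 2 * snorm (X' f) ^+ 2 + snorm (K' (iter n U f)) ^+ 2.
  have -> : snorm (\sum_(k < D) a k *: v (n + k)%N) = snorm (Gop (iter n U f)).
    have := almost_linear_sum (A := Gop) sKt Gop_almost_linear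
    (u := fun k => clark th (n + k)) a D (fun k => Kc _).
    move=> /nulleq_snorm <-; rewrite fE (iter_Uop_sum th n D a (clark th)).
    by congr (snorm (Gop _)); apply: eq_bigr => k _; rewrite /clark iterD.
  have Kn : Kt (iter n U f) by exact: Ks_iter_Uop.
  have [_ ->] := Gop_split Kn; rewrite lerD2r -exprMn.
  by rewrite ler_pXn2r ?nnegrE ?mulr_ge0 ?snorm_ge0 // X'_orbit_le.
have Q n : snorm (X' (iter m V f)) ^+ 2 <=
    M ^+ 2 * snorm (\sum_(k < D) conjc (a k) *: v (n + (2 * D + m) - k.+1)%N) ^+ 2.
  have DN : (D <= n + (2 * D + m))%N by lia.
  rewrite /v -(snorm_Gop_Vop a DN) -fE -exprMn.
  rewrite ler_pXn2r ?nnegrE ?mulr_ge0 ?snorm_ge0 //.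
  have KV : Kt (iter (n + (2 * D + m)) V f) by exact: Ks_iter_Vop.
  have -> : iter m V f = iter (n + 2 * D) U (iter (n + (2 * D + m)) V f).
    rewrite addnA [iter (n + 2 * D + m) V f]iterD (iter_Uop_Vop inth th0) //; exact: Ks_iter_Vop.
  apply: le_trans (X'_orbit_le _ KV) _; rewrite ler_wpM2l //.
  have [_ e] := Gop_split KV.
  rewrite -(@ler_pXn2r _ 2) ?nnegrE ?snorm_ge0 // e lerDl sqr_ge0 //.
have avg := avg0_K' Kf f1.
rewrite -(@ler_pXn2r _ 2) ?nnegrE ?mulr_ge0 ?snorm_ge0 ?sqr_ge0 //.
set x := snorm _; set y := snorm (X' f) in P *.
have M2 : 0 <= M ^+ 2 by exact: sqr_ge0.
apply/ler_addgt0Pr => e e0.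
(* Two errors of size [d] per term, the mean of the compact part and [C / L], get multiplied by
   [M^2]; together they must not exceed [e]. *)
pose d := e / (2 * (M ^+ 2 + 1)); have d0 : 0 < d by rewrite divr_gt0 //; lra.
have dM : M ^+ 2 * d <= e / 2.
  have : d * (2 * (M ^+ 2 + 1)) = e by rewrite divfK // gt_eqF //; lra.
  lra.
have [L0 hL0] := avg d d0.
have [L [LL0 Lpos CLd]] : exists L, [/\ (L0 <= L)%N, (0 < L)%N & `|C| / d <= L%:R].
  exists (maxn L0 (Num.trunc (`|C| / d)).+1); rewrite leq_maxl; split=> //.
    by rewrite leq_max orbT.
  by apply: le_trans (ltW (truncnS_gt _)) _; rewrite ler_nat leq_maxr.
have Lr : 0 < L%:R :> R by rewrite ltr0n.
have CL : C <= d * L%:R.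
  rewrite mulrC -ler_pdivrMr //; apply: le_trans CLd.
  by rewrite ler_wpM2r ?ler_norm // ltW // invr_gt0.
have h1 : L%:R * x ^+ 2 <= M ^+ 2 *
    (\sum_(n < L) snorm (\sum_(k < D) conjc (a k) *: v (n + (2 * D + m) - k.+1)%N) ^+ 2).
  rewrite mulr_sumr mulr_natl -[L in _ *+ L]card_ord -sumr_const.
  by apply: ler_sum => n _; exact: Q.
have h2 : \sum_(n < L) snorm (\sum_(k < D) a k *: v (n + k)%N) ^+ 2 <=
    L%:R * (M ^+ 2 * y ^+ 2) + d * L%:R.
  apply: (@le_trans _ _ (\sum_(n < L) (M ^+ 2 * y ^+ 2 + snorm (K' (iter n U f)) ^+ 2))).
    by apply: ler_sum => n _; exact: P.
  rewrite big_split /= sumr_const card_ord -[_ *+ L]mulr_natl lerD2l.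
  exact: hL0.
have h3 := hC L.
exact: average_squeeze Lr M2 h1 h3 h2 CL dM.
Qed.

Lemma X'_backward_span m f : span (clark th) f ->
  snorm (X' (iter m V f)) <= M ^+ 2 * snorm (X' f).
Proof.
move=> sf; have Kf : Kt f by apply: sf => // k; exact: Ks_clark.
have s1 : 0 < snorm f + 1 by rewrite ltr_wpDl ?snorm_ge0.
pose c : R := (snorm f + 1)^-1; have c0 : 0 < c by rewrite invr_gt0.
have nc : normc c%:C%C = c by rewrite normc_real gtr0_norm.
have := @X'_backward m (c%:C%C *: f) (subspaceZ _ (subspace_span (clark th)) sf).
rewrite snormZ nc /c mulrC ler_pdivrMr // mul1r lerDl ler01 => /(_ isT); rewrite -/c.
have -> : iter m V (c%:C%C *: f) = c%:C%C *: iter m V f.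
  have := iter_Vop_sum th m 1 (fun=> c%:C%C) (fun=> f).
  by rewrite !big_ord1.
have KV : Kt (iter m V f) by exact: Ks_iter_Vop.
rewrite (nulleq_snorm (almost_linearZ sKt lX _ KV)) (nulleq_snorm (almost_linearZ sKt lX _ Kf)).
by rewrite !snormZ nc mulrCA ler_pM2l.
Qed.

(** This bound may grow with [n]: it serves only to pass to the limit from a dense set of vectors,
    with [n] fixed. *)
Lemma iter_Tinv_bounded n : exists C, 0 < C /\
  forall y, Ko y -> snorm (iter n Ti' y) <= C * snorm y.
Proof.
have [C [C0 hC]] := lift_bounded inom bTi.
elim: n => [|n [C' [C'0 hC']]].
  by exists 1; split=> // y _; rewrite mul1r.
exists (C * C'); split; first exact: mulr_gt0.
move=> y Ky /=; apply: le_trans (hC _ ((iTi n).2 _ Ky)) _.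
by rewrite -mulrA ler_wpM2l ?hC' // ltW.
Qed.

Lemma snorm_iter_Tinv n y : Ko y -> snorm (iter n Ti' y) <= M ^+ 2 * snorm y.
Proof.
move=> Ky; have [Cn [Cn0 hCn]] := iter_Tinv_bounded n.
have [CX [CX0 hX]] := lift_bounded inth bX.
apply/ler_addgt0Pr => e e0.
have M2 : 0 <= M ^+ 2 by exact: sqr_ge0.
(* [X f'] will miss [y] by at most [CX d + d]. This error enters once through the [n]-th power of
   the inverse, with factor [Cn], and once through [||X f'||], with factor [M^2]. *)
have [d d0 hd] : exists2 d, 0 < d & (Cn + M ^+ 2) * (CX * d + d) <= e.
  have p : 0 < (Cn + M ^+ 2) * (CX + 1).
    by rewrite mulr_gt0 // ltr_wpDr // ltW.
  exists (e / ((Cn + M ^+ 2) * (CX + 1))); first exact: divr_gt0.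
  set d := e / _; have -> : CX * d + d = (CX + 1) * d by ring.
  by rewrite mulrA mulrC divfK // gt_eqF.
have [f [Kf hf]] := dX (proj2 (KmodelP inom y) Ky) d0.
have KF := Kmodel_toL2 inth Kf; set F := toL2 f in KF.
have h1 : snorm (X' F - y) < d.
  move: hf; rewrite snormE; congr (l2norm _ < _); apply/funext => t.
  by rewrite L2valD L2valN (liftE inth bX) // /F toL2K //; exact: (Kmodel_L2 Kf).
have [f' [sf' h2]] := clark_dense inth th0 KF d0.
have Kf' : Kt f' by apply: sf' => // k; exact: Ks_clark.
have hr : snorm (y - X' f') <= CX * d + d.
  apply: le_trans (ler_snorm_dist _ (X' F) _) _; rewrite addrC; apply: lerD.
    rewrite -(nulleq_snorm (almost_linearB lX KF Kf')).
    have KB : Kt (F - f') by exact: (subspaceB sKt).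
    by apply: le_trans (hX _ KB) _; rewrite ler_wpM2l // ltW.
  by rewrite snormBC ltW.
have Kh : Kt (iter n V f') by exact: Ks_iter_Vop.
(* From [f' = U^n V^n f'] one gets [X f' = T^n X V^n f'] up to null vectors, so the [n]-th power of
   the inverse sends [X f'] to [X V^n f']. *)
have h3 : snorm (iter n Ti' (X' f')) <= M ^+ 2 * snorm (X' f').
  apply: le_trans (X'_backward_span n sf').
  rewrite le_eqVlt; apply/orP; left; apply/eqP; apply: nulleq_snorm.
  apply: nulleq_trans (iter_Tinv_T n (KX Kh)).
  apply: (iTi n).1.2; [exact: KX|by apply: (iT n).2; exact: KX|].
  by have := X'_iter_Uop n Kh; rewrite (iter_Uop_Vop inth th0).
have KXf := KX Kf'.
apply: le_trans (snorm_le_dist _ (iter n Ti' (X' f'))) _.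
rewrite -(nulleq_snorm (almost_linearB (iTi n).1 Ky KXf)).
have KB : Ko (y - X' f') by exact: (subspaceB sKo).
have h4 : snorm (X' f') <= snorm (y - X' f') + snorm y.
  by rewrite snormBC; exact: snorm_le_dist.
apply: (@le_trans _ _ (Cn * (CX * d + d) + M ^+ 2 * ((CX * d + d) + snorm y))).
  apply: lerD.
    by apply: le_trans (hCn _ KB) _; rewrite ler_wpM2l // ltW.
  apply: le_trans h3 _; rewrite ler_wpM2l //; apply: le_trans h4 _.
  by rewrite lerD2r.
move: hd; move: (CX * d + d) => A hd.
by rewrite mulrDr addrA -mulrDl addrC lerD2l.
Qed.

End Main.

Theorem theorem6p1 (R : realType) (th om g : R -> R[i])
  (T Tinv : (R -> R[i]) -> (R -> R[i])) :
  inner_fun th -> inner_fun om -> at0 th = 0 ->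
  (* U_{(theta)1} has no eigenvalues *)
  (forall (lam : R[i]) f, Kmodel th f ->
     aeq (Uth th f) (fun t => lam * f t) -> aeq f (fun _ => 0)) ->
  L2 g ->
  (* X f = P_{K_omega}(g f) is well defined and bounded *)
  (forall f, Kmodel th f -> L2 (fun t => g t * f t)) ->
  bounded_op (Kmodel th) (Kmodel om)
    (fun f => orthproj (Kmodel om) (fun t => g t * f t)) ->
  (* X K_theta is dense in K_omega *)
  (forall h, Kmodel om h -> forall eps : R, 0 < eps ->
     exists f, Kmodel th f /\
       l2norm (fun t => orthproj (Kmodel om) (fun s => g s * f s) t - h t) < eps) ->
  (* K f = P_{L^2 \ominus K_omega}(g f) is compact *)
  compact_op (Kmodel th)
    (fun f => orthproj (ocompl (Kmodel om)) (fun t => g t * f t)) ->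
  (* T in L(K_omega) invertible, with inverse Tinv in L(K_omega) *)
  bounded_op (Kmodel om) (Kmodel om) T ->
  bounded_op (Kmodel om) (Kmodel om) Tinv ->
  (forall f, Kmodel om f -> aeq (Tinv (T f)) f /\ aeq (T (Tinv f)) f) ->
  (* X U_{(theta)1} = T X *)
  (forall f, Kmodel th f ->
     aeq (orthproj (Kmodel om) (fun t => g t * Uth th f t))
         (T (orthproj (Kmodel om) (fun t => g t * f t)))) ->
  (ereal_sup [set opnorm (Kmodel om) (iter n Tinv) | n in [set: nat]]
   <= ereal_sup [set opnorm (Kmodel om) (iter n T) | n in [set: nat]]
      * ereal_sup [set opnorm (Kmodel om) (iter n T) | n in [set: nat]])%E.
Proof.
move=> inth inom th0 noeig _ Lg bX dX cK bT bTi TTi XU.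
set S := ereal_sup [set opnorm (Kmodel om) (iter n T) | n in _].
have hS n f : Kmodel om f -> l2norm f <= 1 -> ((l2norm (iter n T f))%:E <= S)%E.
  move=> Kf f1; apply: (@le_trans _ _ (opnorm (Kmodel om) (iter n T))).
    by apply: ereal_sup_ubound; exists f.
  by apply: ereal_sup_ubound; exists n.
(* The zero vector belongs to the unit ball, so the supremum is nonnegative and [-oo] is
   excluded. *)
have K0 := proj2 (KmodelP inom 0) (subspace_Ks om).1.
have S0 : (0 <= S)%E.
  have := hS 0%N _ K0; rewrite -snormE snorm0 ler01 => /(_ isT).
  by [].
(* If [T] is not power bounded, the right-hand side is [+oo * +oo = +oo]. *)
case E : S S0 hS => [M| |] // S0 hS; last first.
  by rewrite mulyy leey.
have M0 : 0 <= M by move: S0; rewrite lee_fin.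
have sKo := subspace_Ks om.
have TM n y : Ks om y -> snorm (iter n (lift T) y) <= M * snorm y.
  have [lI _] := almost_linear_iter n (lift_almost_linear inom bT) (Ks_lift inom inom bT) sKo.
  apply: (almost_linear_bound sKo lI M0) => z Kz z1.
  rewrite snormE (iter_lift inom bT) // -lee_fin.
  by apply: hS => //; exact/(KmodelP inom).
apply: ge_ereal_sup => _ [n _ <-]; apply: ge_ereal_sup => _ [f [Kf f1] <-].
rewrite -EFinM lee_fin; have Ky := Kmodel_toL2 inom Kf.
have fE : L2val (toL2 f) = f by rewrite toL2K //; exact: (Kmodel_L2 Kf).
have := snorm_iter_Tinv inth inom th0 noeig Lg bX dX cK bT bTi TTi XU M0 TM n Ky.
rewrite snormE (iter_lift inom bTi) // fE => h; apply: le_trans h _.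
by rewrite expr2 ler_piMr ?mulr_ge0 // snormE fE.
Qed.
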